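(* Let $\alpha>-1/2$, $\lambda\geq0$, $\nu\geq0$, let $P_n(x)=Q_n^{(\alpha,\lambda,\nu)}(x)$ $(n\in\mathbb{N}_0)$ be the associated symmetric Pollaczek polynomials, and let $\ell^1(h)$ be the associated $L^1$-algebra. Then $\ell^1(h)$ is (i) point amenable if and only if $\alpha<1/2$ and $\lambda=0$, (ii) weakly amenable if and only if $\alpha<0$ and $\lambda=\nu=0$, (iii) never right character amenable, (iv) never amenable.
   Context: $\mathbb{N}=\{1,2,3,\ldots\}$, $\mathbb{N}_0=\mathbb{N}\cup\{0\}$. \textbf{Polynomials.} For $\alpha>-1/2$, $\lambda\geq0$, $\nu\geq0$, the associated Laguerre polynomials are given by $L_0^{(2\alpha,\nu)}(x)=1$, $L_1^{(2\alpha,\nu)}(x)=(-x+2\nu+2\alpha+1)/(\nu+1)$ and $(n+\nu+1)L_{n+1}^{(2\alpha,\nu)}(x)=(-x+2n+2\nu+2\alpha+1)L_n^{(2\alpha,\nu)}(x)-(n+\nu+2\alpha)L_{n-1}^{(2\alpha,\nu)}(x)$ $(n\in\mathbb{N})$; they are positive on $(-\infty,0]$. Put $c_0:=0$, $a_0:=1$ and, for $n\in\mathbb{N}$, $$c_n:=\frac{n+\nu+2\alpha}{2n+2\nu+2\alpha+2\lambda+1}\,\frac{L_{n-1}^{(2\alpha,\nu)}(-2\lambda)}{L_n^{(2\alpha,\nu)}(-2\lambda)}\in(0,1),\qquad a_n:=1-c_n.$$ Equivalently, $c_0=0$ and $c_n=\frac{1}{1-c_{n-1}}\cdot\frac{(n+\nu)(n+\nu+2\alpha)}{(2n+2\nu+2\alpha+2\lambda+1)(2n+2\nu+2\alpha+2\lambda-1)}$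 for $n\in\mathbb{N}$. The polynomials $P_n(x)=Q_n^{(\alpha,\lambda,\nu)}(x)$ are defined by $P_0(x)=1$, $P_1(x)=x$, $xP_n(x)=a_nP_{n+1}(x)+c_nP_{n-1}(x)$ $(n\in\mathbb{N})$. They are orthogonal with respect to a unique symmetric probability Borel measure $\mu$ on $\mathbb{R}$. \textbf{The algebra $\ell^1(h)$.} Let $g(m,n;k)$ be defined by $P_m(x)P_n(x)=\sum_{k=|m-n|}^{m+n}g(m,n;k)P_k(x)$. For these polynomials all $g(m,n;k)$ are nonnegative (property (P)), which makes the following well-defined. Let $h(n):=1/g(n,n;0)=1/\int_{\mathbb{R}}P_n^2\,\mathrm{d}\mu$; equivalently $h(0)=1$, $h(n+1)=\frac{a_n}{c_{n+1}}h(n)$. Let $\ell^1(h):=\{f:\mathbb{N}_0\to\mathbb{C}:\|f\|_1:=\sum_{k=0}^\infty|f(k)|h(k)<\infty\}$. For $f:\mathbb{N}_0\to\mathbb{C}$ let $T_nf(m):=\sum_{k=|m-n|}^{m+n}g(m,n;k)f(k)$, and for $f,g\in\ell^1(h)$ let $f\ast g(n):=\sum_{k=0}^\infty T_nf(k)g(k)h(k)$. With this convolution and $\|\cdot\|_1$, $\ell^1(h)$ is a commutative unital Banach algebra. Let $\widehat{\mathbb{N}_0}:=\{x\in\mathbb{R}:\sup_{n\in\mathbb{N}_0}|P_n(x)|<\infty\}$, and for $f\in\ell^1(h)$ and $x\in\widehat{\mathbb{N}_0}$ let $\widehat{f}(x):=\sum_{k=0}^\infty f(k)P_k(x)h(k)$.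 \textbf{Amenability notions.} $\ell^1(h)$ is called point amenable if there is no $x\in\widehat{\mathbb{N}_0}$ admitting a nonzero bounded linear functional $D:\ell^1(h)\to\mathbb{C}$ with $D(f\ast g)=\widehat{f}(x)D(g)+\widehat{g}(x)D(f)$ for all $f,g\in\ell^1(h)$. For a Banach algebra $A$ with structure space $\Delta(A)$ (the nonzero multiplicative linear functionals): a derivation into a Banach $A$-bimodule $X$ is a linear map $D:A\to X$ with $D(ab)=a\cdot D(b)+D(a)\cdot b$; it is inner if $D(a)=a\cdot x-x\cdot a$ $(a\in A)$ for some $x\in X$. $A$ is amenable if for every Banach $A$-bimodule $X$ every bounded derivation from $A$ into the dual module $X^\ast$ is inner; weakly amenable if every bounded derivation from $A$ into $A^\ast$ is inner (for commutative $A$: every bounded derivation into $A^\ast$ is zero); $\varphi$-amenable, for $\varphi\in\Delta(A)$, if for every Banach $A$-bimodule $X$ such that $a\cdot x=\varphi(a)x$ $(a\in A,x\in X)$ every bounded derivation from $A$ into $X^\ast$ is inner; right character amenable if $A$ is $\varphi$-amenable for every $\varphi\in\Delta(A)$ and $A$ has a bounded right approximate identity. *)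

(* Defs.v *)
From HB Require Import structures.
From mathcomp Require Import all_boot all_order all_algebra.
From mathcomp Require Import complex.
From mathcomp Require Import all_classical all_reals all_analysis.

Set Implicit Arguments.
Unset Strict Implicit.
Unset Printing Implicit Defensive.

Import Order.TTheory GRing.Theory Num.Theory.
Import numFieldNormedType.Exports.

Local Open Scope classical_set_scope.
Local Open Scope complex_scope.
Local Open Scope ring_scope.

(* Normed spaces and algebras over C = R[i] are presented as operations on an
   ambient vector space together with the subset on which they are meaningful:
   all notions below only quantify over elements of [dom].  In this way the
   space of summable sequences lives inside the space of all sequences, and no
   algebra axiom has to be established before the notions can be stated. *)
Record nspace (R : realType) := NSpace {
  ambient :> lmodType R[i];
  dom : set ambient;
  nrm : ambient -> R }.

Record nalgebra (R : realType) := NAlgebra {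
  space_of :> nspace R;
  mul : space_of -> space_of -> space_of }.

(* In the library the norm of a normed module over R[i] takes its values in
   R[i]; these values are real. *)
Definition nspace_of_normedMod (R : realType) (X : normedModType R[i]) :
  nspace R := @NSpace R X [set: X] (fun x => complex.Re `|x|).

Section Functionals.
Variables (R : realType) (X : nspace R).

Definition functional (phi : X -> R[i]) :=
  forall (k : R[i]) (x y : X), dom x -> dom y ->
    phi (k *: x + y) = k * phi x + phi y.

Definition bounded_functional (phi : X -> R[i]) :=
  functional phi /\
  exists M : R, forall x : X, dom x -> Normc.normc (phi x) <= M * nrm x.

End Functionals.

Section Amenability.
Variables (R : realType) (A : nalgebra R).

(* [lact a x] is a . x and [ract x a] is x . a. *)
Record banach_bimodule (X : completeNormedModType R[i])
    (lact : A -> X -> X) (ract : X -> A -> X) : Prop := BanachBimodule {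
  lact_linearl : forall (k : R[i]) (a b : A) (x : X), dom a -> dom b ->
    lact (k *: a + b) x = k *: lact a x + lact b x;
  lact_linearr : forall (k : R[i]) (a : A) (x y : X), dom a ->
    lact a (k *: x + y) = k *: lact a x + lact a y;
  ract_linearl : forall (k : R[i]) (x y : X) (a : A), dom a ->
    ract (k *: x + y) a = k *: ract x a + ract y a;
  ract_linearr : forall (k : R[i]) (x : X) (a b : A), dom a -> dom b ->
    ract x (k *: a + b) = k *: ract x a + ract x b;
  lactM : forall (a b : A) (x : X), dom a -> dom b ->
    lact (mul a b) x = lact a (lact b x);
  ractM : forall (x : X) (a b : A), dom a -> dom b ->
    ract x (mul a b) = ract (ract x a) b;
  lract : forall (a b : A) (x : X), dom a -> dom b ->
    ract (lact a x) b = lact a (ract x b);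
  lact_bounded : exists K : R, forall (a : A) (x : X), dom a ->
    complex.Re `|lact a x| <= K * nrm a * complex.Re `|x|;
  ract_bounded : exists K : R, forall (a : A) (x : X), dom a ->
    complex.Re `|ract x a| <= K * nrm a * complex.Re `|x| }.

Section DualDerivations.
Variables (X : nspace R) (lact : A -> X -> X) (ract : X -> A -> X).

(* The dual X* is the A-bimodule with (a . phi)(x) = phi (x . a) and
   (phi . a)(x) = phi (a . x); a map D : A -> X* is written in curried form,
   and the operator norm of D a is unfolded in the last clause. *)
Definition bounded_dual_derivation (D : A -> X -> R[i]) :=
  [/\ forall a : A, dom a -> bounded_functional (D a),
      forall (k : R[i]) (a b : A) (x : X), dom a -> dom b -> dom x ->
        D (k *: a + b) x = k * D a x + D b x,
      forall (a b : A) (x : X), dom a -> dom b -> dom x ->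
        D (mul a b) x = D b (ract x a) + D a (lact b x)
    & exists M : R, forall (a : A) (x : X), dom a -> dom x ->
        Normc.normc (D a x) <= M * nrm a * nrm x].

Definition inner_dual_derivation (D : A -> X -> R[i]) :=
  exists2 phi : X -> R[i], bounded_functional phi &
    forall (a : A) (x : X), dom a -> dom x ->
      D a x = phi (ract x a) - phi (lact a x).

Definition bounded_dual_derivations_inner :=
  forall D : A -> X -> R[i],
    bounded_dual_derivation D -> inner_dual_derivation D.

End DualDerivations.

Definition amenable :=
  forall (X : completeNormedModType R[i])
    (lact : A -> X -> X) (ract : X -> A -> X),
    banach_bimodule lact ract ->
    @bounded_dual_derivations_inner (nspace_of_normedMod X) lact ract.

Definition weakly_amenable :=
  @bounded_dual_derivations_inner A (@mul R A) (@mul R A).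

Definition character (phi : A -> R[i]) :=
  [/\ functional phi,
      forall a b : A, dom a -> dom b -> phi (mul a b) = phi a * phi b
    & exists2 a : A, dom a & phi a <> 0].

Definition phi_amenable (phi : A -> R[i]) :=
  forall (X : completeNormedModType R[i])
    (lact : A -> X -> X) (ract : X -> A -> X),
    banach_bimodule lact ract ->
    (forall (a : A) (x : X), dom a -> lact a x = phi a *: x) ->
    @bounded_dual_derivations_inner (nspace_of_normedMod X) lact ract.

(* A net is a family indexed by a type that carries a proper filter. *)
Definition bounded_right_approximate_identity (I : Type) (F : set_system I)
    (e : I -> A) :=
  [/\ forall i, dom (e i),
      exists M : R, forall i, nrm (e i) <= M
    & forall a : A, dom a -> nrm (mul a (e i) - a) @[i --> F] --> (0 : R)].

Definition right_character_amenable :=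
  (forall phi : A -> R[i], character phi -> phi_amenable phi) /\
  exists (I : Type) (F : set_system I) (e : I -> A),
    ProperFilter F /\ bounded_right_approximate_identity F e.

End Amenability.

Section PolynomialHypergroup.
Variables (R : realType) (P : nat -> {poly R}).

Definition linearizes (g : nat -> nat -> nat -> R) :=
  forall m n : nat,
    P m * P n = \sum_(`|m - n|%N <= k < (m + n).+1) g m n k *: P k.

(* Only the values g(m,n;k) with |m-n| <= k <= m+n are ever used; these are
   determined by [linearizes] whenever P n has degree n for all n. *)
Definition lin_coef : nat -> nat -> nat -> R :=
  xget (fun _ _ _ => 0) [set g | linearizes g].

Definition haar (n : nat) : R := (lin_coef n n 0)^-1.

Definition csum (u : nat -> R[i]) : R[i] := limn (series (u : nat -> R[i]^o)).

Definition l1norm (f : nat -> R[i]) : \bar R :=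
  (\sum_(0 <= k <oo) (Normc.normc (f k) * haar k)%:E)%E.

Definition translation (n : nat) (f : nat -> R[i]) (m : nat) : R[i] :=
  \sum_(`|m - n|%N <= k < (m + n).+1) (lin_coef m n k)%:C * f k.

Definition convolution (f g : nat -> R[i]) (n : nat) : R[i] :=
  csum (fun k => translation n f k * g k * (haar k)%:C).

Definition l1alg : nalgebra R :=
  @NAlgebra R
    (@NSpace R (nat -> R[i]^o) [set f | (l1norm f < +oo)%E]
       (fun f => fine (l1norm f)))
    convolution.

Definition dual_space : set R :=
  [set x | has_ubound (range (fun n => `|(P n).[x]|))].

Definition fourier (f : nat -> R[i]) (x : R) : R[i] :=
  csum (fun k => f k * ((P k).[x])%:C * (haar k)%:C).

Definition point_derivation (x : R) (D : l1alg -> R[i]) :=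
  bounded_functional D /\
  forall f g : l1alg, dom f -> dom g ->
    D (mul f g) = fourier f x * D g + fourier g x * D f.

Definition point_amenable :=
  ~ exists2 x : R, dual_space x &
      exists2 D : l1alg -> R[i], point_derivation x D &
        exists2 f : l1alg, dom f & D f <> 0.

End PolynomialHypergroup.

Section AssociatedPollaczek.
Variable R : realType.

(* The associated Laguerre polynomials L_n^(beta,nu), as functions of x. *)
Fixpoint laguerre (beta nu : R) (n : nat) (x : R) : R :=
  match n with
  | 0 => 1
  | m.+1 =>
    match m with
    | 0 => (- x + 2 * nu + beta + 1) / (nu + 1)
    | k.+1 =>
      ((- x + 2 * m%:R + 2 * nu + beta + 1) * laguerre beta nu m x
        - (m%:R + nu + beta) * laguerre beta nu k x) / (m%:R + nu + 1)
    end
  end.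

Definition pollaczek_c (alpha lambda nu : R) (n : nat) : R :=
  if n is k.+1 then
    (n%:R + nu + 2 * alpha) / (2 * n%:R + 2 * nu + 2 * alpha + 2 * lambda + 1)
    * (laguerre (2 * alpha) nu k (- 2 * lambda)
        / laguerre (2 * alpha) nu n (- 2 * lambda))
  else 0.

Fixpoint recurrence_poly (c : nat -> R) (n : nat) : {poly R} :=
  match n with
  | 0 => 1
  | m.+1 =>
    match m with
    | 0 => 'X
    | k.+1 =>
      (1 - c m)^-1 *: ('X * recurrence_poly c m - c m *: recurrence_poly c k)
    end
  end.

Definition pollaczek (alpha lambda nu : R) : nat -> {poly R} :=
  recurrence_poly (pollaczek_c alpha lambda nu).

End AssociatedPollaczek.

(* Main.v *)
Require Import Defs.
From HB Require Import structures.
From mathcomp Require Import all_boot all_order all_algebra.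
From mathcomp Require Import complex ring lra zify.
From mathcomp Require Import all_classical all_reals all_analysis.

Import Order.TTheory GRing.Theory Num.Theory.
Import numFieldNormedType.Exports.

(** The proof works with the Jacobi operator [J u n = a_n u (n+1) + c_n u (n-1)]
on sequences. The value at 0 of [P_n(J) u] is [u n], so the translation [T_n] is
[P_n(J)], and polynomial identities become identities in the algebra. The
coefficients [c_n] increase and stay at most [1/2] ([pollaczek_szwarc]). This
makes the linearization coefficients nonnegative ([product_nonneg]), hence the
translations are contractions of the bounded sequences, [l1alg] is a commutative
Banach algebra, and its dual is the space of bounded sequences
([functional_pair]).

Right character amenability, and with it amenability, fails because of the
character [phi] given by the Fourier transform at 0. As [c_n / a_n] is at most
[1 - k/n] for large [n], with [k] positive, [P_2n(0)] tends to 0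
([P_even_at0_to0]). Let [E] be the sequence of the [P_n(0)]. The algebra acts on
bounded sequences by [phi] on one side, and on the other side by translation
followed by the projection along [E] that removes the value at 0. If the
derivation that sends [a] to the functional [u |-> (a u)(0) - phi(a) u(0)] were
inner, some bounded functional [M] would vanish on all [J u] and take the value
1 at [E]. Then [|M(delta_(n+2))| >= |M(delta_n)|] and the signs alternate;
boundedness forces [M] to vanish at every [delta_n], and therefore at [E], which
is a uniform limit of finitely supported sequences ([not_phi_amenable]).

As to point amenability, a point derivation at [x] is a multiple of the pairing
with the sequence [P_n'(x)], so the question is whether this sequence is
bounded. If [alpha >= 1/2] or [lambda > 0], then [c_n <= N / (2 (N + 1))]
eventually, where [N = n + nu]; hence [n P_n(0)] is bounded, and then so is
[P_n'(0)] ([bounded_at_0]). If [lambda = 0] and [alpha < 1/2], then [|P_n'(x)|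
>= n] for [|x| >= 1], while for [|x| < 1] a quadratic form in [P_n(x),
P_(n+1)(x)] stays between two positive constants, because [c_(n+1) a_n]
decreases and is at least [1/4]. Consequently the sum of [h_k P_k(x)^2] over [k
<= n] grows linearly. By the Christoffel-Darboux formula a bound on [P_n'(x)]
would make this sum [O(sqrt h_n)], contradicting [h_n = o(n^2)]
([unbounded_inside], [weight_small]).

As to weak amenability, a derivation into the dual is determined by one bounded
sequence [u], and its values on the [delta_n] are the sequences [P_n'(J) u];
conversely any [u] with [P_n'(J) u] uniformly bounded and [u 0 <> 0] gives a
nonzero derivation. If [P_n'(0)] is bounded, [u = E] works. If [lambda = 0] and
[alpha < 1/2], take [u = (1 - J^2) delta_0]. Then [(1 - X^2) P_n'] is a
combination of [P_(n-1)], [X P_n] and an associated polynomial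
([structure_relation]); the coefficients of order [n] are absorbed by [h_n],
which grows at least linearly unless [nu = 0] and [alpha < 0], and the
associated polynomials are bounded nonnegative combinations of the [P_k] if [nu
> 0] and do not occur if [nu = 0]. In the remaining ultraspherical case the
Chebyshev identity
[1 = 2/(n+1) T_n T_(n+1)' - 1/(2n+1) T_(2n+1)']
bounds [u k] by [||T_n|| ||T_(n+1)|| / n + ||T_(2n+1)|| / n] up to a constant.
All the coefficients of [T_n] over the [P_k] except the leading one are
nonpositive, so its norm is controlled by the leading coefficient and is [o(sqrt
n)] ([weakly_amenable_ultraspherical]). *)

Local Open Scope classical_set_scope.
Local Open Scope complex_scope.
Local Open Scope ring_scope.

Set Implicit Arguments.
Unset Strict Implicit.
Unset Printing Implicit Defensive.
Import Normc.

(** * Series of complex numbers *)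

Section ComplexSeries.
Variable R : realType.
Implicit Types (u v : nat -> R[i]) (x y z : R[i]).

Lemma normr_normc z : `|z| = (normc z)%:C. Proof. by []. Qed.

Lemma normc_ge0 z : 0 <= normc z.
Proof. by rewrite -ler0c -normr_normc normr_ge0. Qed.

Lemma normc_eq0 z : (normc z == 0) = (z == 0).
Proof. by apply/eqP/eqP => [/eq0_normc//|->]; rewrite normc0. Qed.

Lemma ler_normcD x y : normc (x + y) <= normc x + normc y.
Proof. by rewrite -lecR rmorphD /= -!normr_normc ler_normD. Qed.

Lemma normc_opp x : normc (- x) = normc x.
Proof. by apply: complexI; rewrite -!normr_normc normrN. Qed.

Lemma normc_real (r : R) : normc r%:C = `|r|.
Proof. by rewrite /normc /= expr0n /= addr0 sqrtr_sqr. Qed.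

Lemma ler_normc_sum (I : Type) (s : seq I) (P : pred I) (F : I -> R[i]) :
  normc (\sum_(i <- s | P i) F i) <= \sum_(i <- s | P i) normc (F i).
Proof.
elim/big_rec2: _ => [|i a b _ H]; first by rewrite normc0.
by apply: (le_trans (ler_normcD _ _)); rewrite lerD2l.
Qed.

Lemma ler_Re_normc z : `|complex.Re z| <= normc z.
Proof.
case: z => a b /=; rewrite -[leLHS]sqrtr_sqr.
by rewrite ler_wsqrtr// lerDl sqr_ge0.
Qed.

Lemma ler_Im_normc z : `|complex.Im z| <= normc z.
Proof.
case: z => a b /=; rewrite -[leLHS]sqrtr_sqr.
by rewrite ler_wsqrtr// lerDr sqr_ge0.
Qed.

Lemma normc_le_ReIm z : normc z <= `|complex.Re z| + `|complex.Im z|.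
Proof.
rewrite {1}[z]complexE; apply: (le_trans (ler_normcD _ _)).
rewrite normcM !normc_real /= expr0n /= add0r expr1n sqrtr1 mul1r lexx //.
Qed.

Lemma eq_of_normc_lt x y : (forall e : R, 0 < e -> normc (x - y) < e) -> x = y.
Proof.
move=> H; apply/eqP; rewrite -subr_eq0 -normc_eq0; apply/eqP/le_anti.
rewrite normc_ge0 andbT; apply/ler_addgt0Pr => e e0; rewrite add0r.
exact/ltW/H.
Qed.

Lemma ReD x y : complex.Re (x + y) = complex.Re x + complex.Re y.
Proof. by case: x y => a b [c d]. Qed.

Lemma ImD x y : complex.Im (x + y) = complex.Im x + complex.Im y.
Proof. by case: x y => a b [c d]. Qed.

Lemma ReN x : complex.Re (- x) = - complex.Re x.
Proof. by case: x. Qed.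

Lemma ImN x : complex.Im (- x) = - complex.Im x.
Proof. by case: x. Qed.

Definition abs_bounded u (M : R) :=
  forall N : nat, \sum_(k < N) normc (u k) <= M.

Lemma real_series_approx (w : nat -> R) (M : R) :
  (forall N : nat, \sum_(k < N) `|w k| <= M) ->
  exists l : R, forall e : R, 0 < e ->
    exists N : nat, forall n, (N <= n)%N -> `|l - \sum_(k < n) w k| < e.
Proof.
move=> hM.
have cn : cvgn [normed series w].
  apply: nondecreasing_is_cvgn.
    by apply: nondecreasing_series => i _ _; exact: normr_ge0.
  by exists M => _ [n _ <-]; rewrite /normed_series_of seriesEord; exact: hM.
have /cvgrPdist_lt cw := normed_cvg cn.
exists (limn (series w)) => e e0.
have [N _ hN] := cw e e0.
by exists N => n Nn; have := hN n Nn; rewrite seriesEord.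
Qed.

Lemma csum_unique u (l : R[i]) :
  (forall e : R, 0 < e -> exists N : nat, forall n, (N <= n)%N ->
      normc (l - \sum_(k < n) u k) < e) ->
  csum u = l.
Proof.
move=> H; apply: (@cvg_lim (R[i]^o) (@norm_hausdorff _ (R[i]^o))).
apply/cvgrPdist_lt => e e0.
have [r re] : exists r : R, e = r%:C.
  by exists (complex.Re e); rewrite RRe_real // realE ltW.
rewrite re ltcR in e0; have [N hN] := H r e0.
exists N => // n /= Nn; have := hN n Nn.
by rewrite seriesEord re normr_normc ltcR.
Qed.

Lemma csum_approx u (M : R) : abs_bounded u M ->
  forall e : R, 0 < e -> exists N : nat, forall n, (N <= n)%N ->
    normc (csum u - \sum_(k < n) u k) < e.
Proof.
move=> uM.
have [l1 h1] : exists l : R, forall e : R, 0 < e ->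
    exists N : nat, forall n, (N <= n)%N ->
      `|l - \sum_(k < n) complex.Re (u k)| < e.
  apply: (@real_series_approx (fun k => complex.Re (u k)) M) => N; apply: le_trans (uM N).
  by apply: ler_sum => i _; exact: ler_Re_normc.
have [l2 h2] : exists l : R, forall e : R, 0 < e ->
    exists N : nat, forall n, (N <= n)%N ->
      `|l - \sum_(k < n) complex.Im (u k)| < e.
  apply: (@real_series_approx (fun k => complex.Im (u k)) M) => N; apply: le_trans (uM N).
  by apply: ler_sum => i _; exact: ler_Im_normc.
have H : forall e : R, 0 < e -> exists N : nat, forall n, (N <= n)%N ->
    normc ((l1 +i* l2) - \sum_(k < n) u k) < e.
  move=> e e0; have e2 : 0 < e / 2 by rewrite divr_gt0.
  have [N1 H1] := h1 _ e2; have [N2 H2] := h2 _ e2.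
  exists (maxn N1 N2) => n; rewrite geq_max => /andP[n1 n2].
  apply: (le_lt_trans (normc_le_ReIm _)); rewrite ReD ImD !ReN !ImN.
  rewrite (big_morph (@complex.Re R) ReD erefl).
  rewrite (big_morph (@complex.Im R) ImD erefl).
  by rewrite [ltRHS](splitr e) ltrD ?H1 ?H2.
by rewrite (csum_unique H).
Qed.

Lemma normc_csum_le u (M : R) : abs_bounded u M -> normc (csum u) <= M.
Proof.
move=> uM; apply/ler_addgt0Pr => e e0.
have [N hN] := csum_approx uM e0.
have -> : csum u = (csum u - \sum_(k < N) u k) + \sum_(k < N) u k.
  by rewrite subrK.
apply: (le_trans (ler_normcD _ _)); rewrite addrC; apply: lerD; last exact/ltW/hN.
by apply: le_trans (uM N); exact: ler_normc_sum.
Qed.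

Lemma csum_linear (a : R[i]) u v (M M' : R) :
  abs_bounded u M -> abs_bounded v M' ->
  csum (fun k => a * u k + v k) = a * csum u + csum v.
Proof.
move=> uM vM; apply: csum_unique => e e0.
have e2 : 0 < e / 2 by rewrite divr_gt0.
have e3 : 0 < e / 2 / (normc a + 1).
  by rewrite divr_gt0 // ltr_wpDl // normc_ge0.
have [N1 H1] := csum_approx uM e3; have [N2 H2] := csum_approx vM e2.
exists (maxn N1 N2) => n; rewrite geq_max => /andP[n1 n2].
rewrite big_split /= -mulr_sumr opprD addrACA -mulrBr.
apply: (le_lt_trans (ler_normcD _ _)); rewrite normcM.
rewrite [ltRHS](splitr e) ler_ltD ?H2 //.
have := H1 n n1; rewrite ltr_pdivlMr ?ltr_wpDl ?normc_ge0 // => h.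
apply: le_trans (ltW h).
by rewrite mulrC ler_wpM2l ?normc_ge0 // lerDl.
Qed.

Lemma csum_finite u (N : nat) : (forall k, (N <= k)%N -> u k = 0) ->
  csum u = \sum_(k < N) u k.
Proof.
move=> u0; apply: csum_unique => e e0; exists N => n Nn.
rewrite -!(big_mkord xpredT u) (@big_cat_nat _ _ _ N 0 n) //=.
rewrite opprD addrA subrr sub0r normc_opp big1_seq ?normc0 //.
by move=> i /=; rewrite mem_index_iota => /andP[/u0].
Qed.

End ComplexSeries.

(** * Functional calculus of the Jacobi operator *)

(** Under these conditions the product of any two [recurrence_poly c] is a
nonnegative combination of the [recurrence_poly c] (a criterion of Szwarc). *)
Record szwarc_coefs (R : realType) (c : nat -> R) : Prop := SzwarcCoefs {
  szwarc0 : c 0%N = 0;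
  szwarc_gt0 : forall n, 0 < c n.+1;
  szwarc_le_half : forall n, c n <= 1 / 2;
  szwarc_mono : forall n, c n <= c n.+1 }.

Section FunctionalCalculus.
Variables (R : realType) (c : nat -> R).
Hypothesis hc : szwarc_coefs c.
Implicit Types (u v : nat -> R[i]) (p q : {poly R}).

Local Notation P := (recurrence_poly c).

Lemma a_gt0 n : 0 < 1 - c n.
Proof. by have := szwarc_le_half hc n; lra. Qed.

Lemma a_neq0 n : 1 - c n != 0.
Proof. by rewrite gt_eqF ?a_gt0. Qed.

Lemma c_neq0 n : c n.+1 != 0.
Proof. by rewrite gt_eqF // (szwarc_gt0 hc). Qed.

Lemma c_ge0 n : 0 <= c n.
Proof. by case: n => [|n]; rewrite ?(szwarc0 hc) // ltW // (szwarc_gt0 hc). Qed.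

Lemma c_le m n : (m <= n)%N -> c m <= c n.
Proof.
move=> /subnKC <-; elim: (n - m)%N => [|k IH]; first by rewrite addn0.
by rewrite addnS (le_trans IH) ?(szwarc_mono hc).
Qed.

Lemma mulX_rec n : 'X * P n = (1 - c n) *: P n.+1 + c n *: P n.-1.
Proof.
case: n => [|n] /=; first by rewrite (szwarc0 hc) subr0 scale0r addr0 scale1r mulr1.
by rewrite scalerA divff ?a_neq0 // scale1r subrK.
Qed.

(** The truncated predecessor makes [k = 0] uniform, because [c 0 = 0]. *)
Definition jacobi u (k : nat) : R[i] :=
  (1 - c k)%:C * u k.+1 + (c k)%:C * u k.-1.

(** [calc p u] is [p(J) u] for the Jacobi operator [J]. *)
Definition calc p u (n : nat) : R[i] :=
  \sum_(i < size p) (p`_i)%:C * iter i jacobi u n.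

Lemma calc_wide N p u n : (size p <= N)%N ->
  calc p u n = \sum_(i < N) (p`_i)%:C * iter i jacobi u n.
Proof.
move=> pN; rewrite /calc.
rewrite -(big_mkord xpredT (fun i => (p`_i)%:C * iter i jacobi u n)).
rewrite -(big_mkord xpredT (fun i => (p`_i)%:C * iter i jacobi u n)).
rewrite (@big_cat_nat _ _ _ (size p) 0 N) //= [X in _ + X]big1_seq ?addr0 //.
move=> i /=; rewrite mem_index_iota => /andP[pi _].
by rewrite nth_default // mul0r.
Qed.

Lemma calcD p q u n : calc (p + q) u n = calc p u n + calc q u n.
Proof.
rewrite (@calc_wide (maxn (size p) (size q)) (p + q)) ?size_polyD //.
rewrite (@calc_wide (maxn (size p) (size q)) p) ?leq_maxl //.
rewrite (@calc_wide (maxn (size p) (size q)) q) ?leq_maxr //.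
rewrite -big_split /=; apply: eq_bigr => i _.
by rewrite coefD rmorphD /= mulrDl.
Qed.

Lemma calcZ (a : R) p u n : calc (a *: p) u n = a%:C * calc p u n.
Proof.
rewrite (@calc_wide (size p) (a *: p)) ?size_scale_leq // mulr_sumr.
by apply: eq_bigr => i _; rewrite coefZ rmorphM mulrA.
Qed.

Lemma calc0 u n : calc 0 u n = 0.
Proof. by rewrite /calc size_poly0 big_ord0. Qed.

Lemma calcN p u n : calc (- p) u n = - calc p u n.
Proof. by rewrite -scaleN1r calcZ rmorphN1 mulN1r. Qed.

Lemma calcB p q u n : calc (p - q) u n = calc p u n - calc q u n.
Proof. by rewrite calcD calcN. Qed.

Lemma calc_sum (I : Type) (s : seq I) (Q : pred I) (F : I -> {poly R}) u n :
  calc (\sum_(i <- s | Q i) F i) u n = \sum_(i <- s | Q i) calc (F i) u n.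
Proof.
by elim/big_rec2: _ => [|i a b _ <-]; rewrite ?calc0 // calcD.
Qed.

Lemma calcC (a : R) u n : calc a%:P u n = a%:C * u n.
Proof.
rewrite (@calc_wide 1) ?size_polyC_leq1 // big_ord1 coefC /=.
by [].
Qed.

Lemma calc1 u : calc 1 u = u.
Proof. by apply: funext => n; rewrite -[1]/(1%:P) calcC mul1r. Qed.

Lemma calc_mulX p u n : calc ('X * p) u n = calc p (jacobi u) n.
Proof.
rewrite (@calc_wide (size p).+1) ?(leq_trans (size_polyMleq _ _)) ?size_polyX //.
rewrite big_ord_recl coefXM /= mul0r add0r; apply: eq_bigr => i _.
by rewrite coefXM /= -iterSr.
Qed.

Lemma jacobi_lin (a : R[i]) u v n :
  jacobi (fun k => a * u k + v k) n = a * jacobi u n + jacobi v n.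
Proof. by rewrite /jacobi; ring. Qed.

Lemma jacobi_calc p u : jacobi (calc p u) = calc p (jacobi u).
Proof.
apply: funext => n; rewrite /jacobi /calc !mulr_sumr -big_split /=.
apply: eq_bigr => i _.
by rewrite -iterSr /= /jacobi; ring.
Qed.

Lemma calcM p q u : calc (p * q) u = calc p (calc q u).
Proof.
elim/poly_ind: p u => [|p a IH] u.
  by apply: funext => n; rewrite mul0r !calc0.
apply: funext => n; rewrite mulrDl calcD -mulrA (mulrCA p) calc_mulX IH.
rewrite calcD [p * 'X]mulrC calc_mulX calcC -jacobi_calc; congr (_ + _).
by rewrite mul_polyC calcZ.
Qed.

Lemma calc_linear p (a : R[i]) u v n :
  calc p (fun k => a * u k + v k) n = a * calc p u n + calc p v n.
Proof.
elim/poly_ind: p u v n => [|p b IH] u v n; first by rewrite !calc0 mulr0 addr0.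
rewrite !calcD !calcC [p * 'X]mulrC !calc_mulX.
have -> : jacobi (fun k => a * u k + v k) = fun k => a * jacobi u k + jacobi v k.
  by apply: funext => k; rewrite jacobi_lin.
by rewrite IH; ring.
Qed.

Definition trans n u := calc (P n) u.

Lemma trans0 u : trans 0 u = u.
Proof. exact: calc1. Qed.

Lemma trans1 u : trans 1 u = jacobi u.
Proof. by rewrite /trans /= -['X]mulr1; apply: funext => n; rewrite calc_mulX calc1. Qed.

Lemma transS n u k :
  (1 - c n)%:C * trans n.+1 u k = jacobi (trans n u) k - (c n)%:C * trans n.-1 u k.
Proof.
by rewrite /trans jacobi_calc -calc_mulX mulX_rec calcD !calcZ addrK.
Qed.

Lemma aC_neq0 n : (1 - c n)%:C != 0.
Proof. by rewrite (inj_eq (@complexI R) _ 0) a_neq0. Qed.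

Lemma nat_ind2 (Q : nat -> Prop) : Q 0%N -> Q 1%N ->
  (forall n, Q n -> Q n.+1 -> Q n.+2) -> forall n, Q n.
Proof.
move=> Q0 Q1 H n; suff [] : Q n /\ Q n.+1 by [].
by elim: n => [|n [IH1 IH2]]; split=> //; exact: H.
Qed.

(** Evaluating [J u] at 0 gives the entry at 1, and the recurrence of the [P n]
propagates this along the sequence: [P_n(J)] moves the entry [n] to 0. *)
Lemma trans_at0 n u : trans n u 0 = u n.
Proof.
elim/nat_ind2: n u => [|| n IH0 IH1] u; first by rewrite trans0.
  by rewrite trans1 /jacobi (szwarc0 hc) subr0 mul1r mul0r addr0.
apply: (mulfI (aC_neq0 n.+1)); rewrite transS IH0.
rewrite -[jacobi (trans _ _)]/(jacobi (calc _ _)) jacobi_calc -/(trans _ _) IH1.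
by rewrite /jacobi addrK.
Qed.

Lemma transC m n u : trans m (trans n u) = trans n (trans m u).
Proof. by rewrite /trans -!calcM mulrC. Qed.

(** Both sides are the value at 0 of [P_m(J) P_n(J) u]. *)
Lemma trans_sym m n u : trans m u n = trans n u m.
Proof. by rewrite -trans_at0 transC trans_at0. Qed.

(** The linear functional on polynomials with moments [u] in the basis [P n]. *)
Definition psi u p := calc p u 0.

Lemma psiP u n : psi u (P n) = u n.
Proof. exact: trans_at0. Qed.

Lemma psiM u m n : psi u (P m * P n) = trans m u n.
Proof. by rewrite /psi calcM -/(trans m _) trans_at0 -/(trans n _) trans_sym. Qed.

End FunctionalCalculus.

(** * Property (P) and the Haar weights *)

Section PropertyP.
Variables (R : realType) (c : nat -> R).
Hypothesis hc : szwarc_coefs c.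
Implicit Types (u v : nat -> R[i]) (p q : {poly R}).

Local Notation P := (recurrence_poly c).

Fixpoint weight (n : nat) : R :=
  if n is m.+1 then (1 - c m) / c n * weight m else 1.

Lemma weightS n : c n.+1 * weight n.+1 = (1 - c n) * weight n.
Proof. by rewrite /=; field; exact: c_neq0. Qed.

Lemma weight_gt0 n : 0 < weight n.
Proof.
elim: n => [|n IH] //=.
by rewrite mulr_gt0 // divr_gt0 ?a_gt0 ?(szwarc_gt0 hc).
Qed.

Lemma weight_neq0 n : weight n != 0.
Proof. by rewrite gt_eqF ?weight_gt0. Qed.

Arguments weight : simpl never.

Lemma weight_ge1 n : 1 <= weight n.
Proof.
elim: n => [|n IH] //.
have := weightS n; have := szwarc_le_half hc n; have := szwarc_le_half hc n.+1.
have := szwarc_gt0 hc n; have := weight_gt0 n; have := weight_gt0 n.+1.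
by nra.
Qed.

(** These multiples satisfy the transposed recurrence, for which the product
identity below takes a simple form. *)
Definition dualP n : {poly R} := weight n *: P n.
Local Notation Q := dualP.

Lemma mulX_dualP n :
  'X * Q n.+1 = c n.+2 *: Q n.+2 + (1 - c n) *: Q n.
Proof.
rewrite /dualP -!scalerAr (mulX_rec hc) /= scalerDr !scalerA.
rewrite weightS [weight n.+1 * _]mulrC.
by rewrite [_ * c n.+1]mulrC weightS.
Qed.

Lemma mulX_dualP0 : 'X * Q 0 = c 1 *: Q 1.
Proof.
by rewrite /dualP -!scalerAr scalerA weightS (szwarc0 hc) subr0 mul1r mulr1.
Qed.

(** The two sums of the product identity, over [Q_(n+k) Q_(m-k)] and over
[Q_(n-k) Q_(m-k)] for [1 <= k <= m], written as recursions in [m]. *)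
Fixpoint fwd (n m : nat) : {poly R} :=
  if m is k.+1 then (c n.+1 - c k) *: (Q n.+1 * Q k) + fwd n.+1 k else 0.

Fixpoint bwd (n m : nat) : {poly R} :=
  if m is k.+1 then (1 - c n.-1 - c k) *: (Q n.-1 * Q k) + bwd n.-1 k else 0.

(** The induction lets ['X] act on either factor of [Q_(n+1) Q_(m+1)].  The point of
the identity is that the products on the right have a smaller second index, and
that their coefficients [c_(n+k) - c_(m-k)] and [1 - c_(n-k) - c_(m-k)] are
nonnegative as [c] is increasing and at most [1/2]. *)
Lemma product_identity n m : (m <= n)%N ->
  c m *: (Q n * Q m) = fwd n m + bwd n m.
Proof.
elim/nat_ind2: m n => [|| m IH0 IH1] [|n] //= mn.
- by rewrite (szwarc0 hc) scale0r addr0.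
- by rewrite (szwarc0 hc) scale0r addr0.
- rewrite (szwarc0 hc) !subr0 !addr0 [c 1 *: _]scalerAr.
  rewrite -mulX_dualP0 mulrA [_ * 'X]mulrC mulX_dualP.
  by rewrite mulrDl -(scalerAl (c n.+2)) -(scalerAl (1 - c n)).
have IHa := IH1 n.+2 (leq_trans (ltnW mn) (leqnSn _)).
have IHb := IH1 n mn.
have IHc := IH0 n.+1 (ltnW (ltnW mn)).
have -> : c m.+2 *: (Q n.+1 * Q m.+2) =
   c n.+2 *: (Q n.+2 * Q m.+1) + (1 - c n) *: (Q n * Q m.+1)
   - (1 - c m) *: (Q n.+1 * Q m).
  rewrite [c m.+2 *: _]scalerAr.
  have -> : c m.+2 *: Q m.+2 = 'X * Q m.+1 - (1 - c m) *: Q m.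
    by rewrite mulX_dualP addrK.
  rewrite mulrBr -(scalerAr (1 - c m)) mulrA [_ * 'X]mulrC mulX_dualP.
  by rewrite mulrDl -(scalerAl (c n.+2)) -(scalerAl (1 - c n)).
have -> : (1 - c m) *: (Q n.+1 * Q m) = bwd n.+2 m.+1 + fwd n m.+1.
  rewrite /= addrACA [bwd _ _ + _]addrC -IHc -!scalerDl; congr (_ *: _).
  by ring.
rewrite !scalerBl in IHa IHb *; rewrite IHa IHb /=.
rewrite !scalerBl !scale1r.
set x1 := Q n.+2 * Q m.+1; set x2 := Q n * Q m.+1; set x3 := Q n.+1 * Q m.
set f1 := fwd n.+3 m; set f2 := bwd n.+1 m.
by rewrite -!mul_polyC; ring.
Qed.

Definition nonneg_comb (lo hi : nat) p := exists2 g : nat -> R,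
  forall k, 0 <= g k & p = \sum_(lo <= k < hi) g k *: P k.

Lemma nonneg_comb0 lo hi : nonneg_comb lo hi 0.
Proof. by exists (fun=> 0) => //; rewrite big1 // => i _; rewrite scale0r. Qed.

Lemma nonneg_combD lo hi p q :
  nonneg_comb lo hi p -> nonneg_comb lo hi q -> nonneg_comb lo hi (p + q).
Proof.
move=> [g g0 ->] [f f0 ->]; exists (fun k => g k + f k) => [k|].
  by rewrite addr_ge0.
by rewrite -big_split; apply: eq_bigr => i _; rewrite scalerDl.
Qed.

Lemma nonneg_combZ lo hi (a : R) p :
  0 <= a -> nonneg_comb lo hi p -> nonneg_comb lo hi (a *: p).
Proof.
move=> a0 [g g0 ->]; exists (fun k => a * g k) => [k|]; first exact: mulr_ge0.
by rewrite scaler_sumr; apply: eq_bigr => i _; rewrite scalerA.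
Qed.

Lemma nonneg_comb_widen lo hi lo' hi' p : (lo' <= lo)%N -> (hi <= hi')%N ->
  nonneg_comb lo hi p -> nonneg_comb lo' hi' p.
Proof.
move=> hlo hhi [g g0 ->]; exists (fun k => if (lo <= k < hi)%N then g k else 0).
  by move=> k; case: ifP.
rewrite (big_nat_widenl _ lo') // (big_nat_widen _ _ hi') // big_mkcond /=.
by apply: eq_bigr => i _; rewrite andbC; case: ifP; rewrite ?scale0r.
Qed.

Lemma nonneg_combP lo hi n : (lo <= n < hi)%N -> nonneg_comb lo hi (P n).
Proof.
move=> /andP[h1 h2]; apply: (@nonneg_comb_widen n n.+1) => //.
by exists (fun=> 1) => //; rewrite big_nat1 scale1r.
Qed.

(** Property (P), by strong induction on the second index with the product
identity. *)
Lemma product_nonneg n m : (m <= n)%N ->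
  nonneg_comb (n - m) (n + m).+1 (Q n * Q m).
Proof.
have [M] := ubnP m; elim: M m n => // M IH m n; rewrite ltnS => mM mn.
case: m mM mn => [|m] mM mn.
  rewrite /dualP scale1r mulr1; apply: nonneg_combZ; first exact/ltW/weight_gt0.
  by apply: nonneg_combP; rewrite subn0 addn0 ltnSn leqnn.
have -> : Q n * Q m.+1 = (c m.+1)^-1 *: (fwd n m.+1 + bwd n m.+1).
  by rewrite -product_identity // scalerA mulVf ?c_neq0 // scale1r.
apply: nonneg_combZ; first by rewrite invr_ge0 c_ge0.
set lo := (n - m.+1)%N; set hi := (n + m.+1).+1.
apply: nonneg_combD.
- suff H : forall j n', (j <= M)%N -> (j <= n')%N -> (lo <= n' - j)%N ->
      (n' + j < hi)%N -> nonneg_comb lo hi (fwd n' j).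
    by apply: H => //; exact: leqnn.
  elim=> [|j IHj] n' jM jn h1 h2 /=; first exact: nonneg_comb0.
  apply: nonneg_combD; last by apply: IHj; lia.
  apply: nonneg_combZ; first by rewrite subr_ge0 (c_le hc) //; lia.
  apply: (nonneg_comb_widen (lo := n'.+1 - j) (hi := (n'.+1 + j).+1)); [lia|lia|].
  by apply: IH => //; lia.
- suff H : forall j n', (j <= M)%N -> (j <= n')%N -> (lo <= n' - j)%N ->
      (n' + j < hi)%N -> nonneg_comb lo hi (bwd n' j).
    by apply: H => //; exact: leqnn.
  elim=> [|j IHj] n' jM jn h1 h2 /=; first exact: nonneg_comb0.
  apply: nonneg_combD; last by apply: IHj; lia.
  apply: nonneg_combZ.
    by have := szwarc_le_half hc n'.-1; have := szwarc_le_half hc j; lra.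
  apply: (nonneg_comb_widen (lo := n'.-1 - j) (hi := (n'.-1 + j).+1)); [lia|lia|].
  by apply: IH => //; lia.
Qed.

Lemma linearization_exists m n : exists2 g : nat -> R,
  forall k, 0 <= g k &
  P m * P n = \sum_(`|m - n|%N <= k < (m + n).+1) g k *: P k.
Proof.
wlog mn : m n / (m <= n)%N.
  move=> H; have /orP[|] := leq_total m n; first exact: H.
  by move=> /H[g g0 e]; exists g => //; rewrite mulrC e distnC addnC.
have [g g0 e] := product_nonneg mn.
exists (fun k => (weight m)^-1 * (weight n)^-1 * g k) => [k|].
  by rewrite !mulr_ge0 // invr_ge0 ltW // weight_gt0.
have -> : P m * P n = ((weight m)^-1 * (weight n)^-1) *: (Q n * Q m).
  rewrite /dualP -scalerAl -scalerAr !scalerA [P m * _]mulrC.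
  have := weight_gt0 m; have := weight_gt0 n => h1 h2.
  by rewrite -[LHS]scale1r; congr (_ *: _); field; rewrite !gt_eqF.
rewrite e scaler_sumr distnEr // [(m + n)%N]addnC.
by apply: eq_bigr => i _; rewrite scalerA.
Qed.

Lemma lin_coefP : linearizes P (lin_coef P).
Proof.
rewrite /lin_coef; case: xgetP => [g _ /=|H] //.
have [g hg] : exists g : nat -> nat -> nat -> R, linearizes P g.
  have H2 (mn : nat * nat) : exists f : nat -> R, P mn.1 * P mn.2 =
      \sum_(`|mn.1 - mn.2|%N <= k < (mn.1 + mn.2).+1) f k *: P k.
    by have [g _ ->] := linearization_exists mn.1 mn.2; exists g.
  have [f hf] := choice H2.
  by exists (fun m n => f (m, n)) => m n; exact: hf (m, n).
by have := H g.
Qed.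

Definition delta (n k : nat) : R[i] := (k == n)%:R.

Lemma psi_comb u lo hi (g : nat -> R) :
  psi c u (\sum_(lo <= k < hi) g k *: P k) = \sum_(lo <= k < hi) (g k)%:C * u k.
Proof.
by rewrite /psi calc_sum; apply: eq_bigr => k _; rewrite calcZ -/(psi c _ _) (psiP hc).
Qed.

Lemma sum_delta lo hi (g : nat -> R) j : (lo <= j < hi)%N ->
  \sum_(lo <= k < hi) (g k)%:C * delta j k = (g j)%:C.
Proof.
move=> h; rewrite (bigD1_seq j) /= ?mem_index_iota ?iota_uniq //.
rewrite /delta eqxx mulr1 big1 ?addr0 // => i /negbTE ->.
by rewrite mulr0.
Qed.

Lemma translationE n u : translation P n u = trans c n u.
Proof.
apply: funext => m; rewrite /translation -psi_comb -lin_coefP.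
by rewrite (psiM hc) (trans_sym hc).
Qed.

(** Equal to [lin_coef] inside the range of the latter and 0 outside, which
removes the range conditions from all later sums. *)
Definition lin (n m k : nat) : R := complex.Re (trans c n (delta k) m).

Lemma lin_coefE (m n k : nat) : (`|m - n|%N <= k < (m + n).+1)%N ->
  lin_coef P m n k = lin m n k.
Proof.
move=> h; apply: complexI; rewrite -(sum_delta _ h) -psi_comb -lin_coefP (psiM hc).
rewrite /lin; have [g _ e] := linearization_exists m n.
by rewrite -(psiM hc) e psi_comb (sum_delta _ h).
Qed.

Lemma lin_eq m n (g : nat -> R) :
  P m * P n = \sum_(`|m - n|%N <= k < (m + n).+1) g k *: P k ->
  forall k, lin m n k = if (`|m - n|%N <= k < (m + n).+1)%N then g k else 0.
Proof.
move=> e k; rewrite /lin -(psiM hc) e psi_comb; case: ifP => h.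
  by rewrite (sum_delta _ h).
rewrite big1_seq // => i /=; rewrite mem_index_iota => hi.
rewrite /delta; case: eqP => [ik|]; last by rewrite mulr0.
by rewrite -ik hi in h.
Qed.

Lemma lin_ge0 m n k : 0 <= lin m n k.
Proof.
have [g g0 /lin_eq e] := linearization_exists m n.
by rewrite e; case: ifP.
Qed.

Lemma lin_out (m n k : nat) : ~~ (`|m - n|%N <= k < (m + n).+1)%N -> lin m n k = 0.
Proof.
have [g g0 /lin_eq e] := linearization_exists m n.
by move=> h; rewrite e ifN.
Qed.

Lemma lin_poly m n N : (m + n < N)%N -> P m * P n = \sum_(k < N) lin m n k *: P k.
Proof.
move=> hN; have [g g0 e] := linearization_exists m n.
rewrite -(big_mkord xpredT (fun k => lin m n k *: P k)) {1}e.
rewrite (big_nat_widenl _ 0) // (big_nat_widen _ _ N) // big_mkcond /=.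
apply: eq_bigr => i _; rewrite (lin_eq e) andbC.
by case: ifP; rewrite ?scale0r.
Qed.

Lemma transE m n N u : (m + n < N)%N ->
  trans c m u n = \sum_(k < N) (lin m n k)%:C * u k.
Proof.
move=> hN; rewrite -(psiM hc) (lin_poly hN) /psi calc_sum.
by apply: eq_bigr => k _; rewrite calcZ -/(psi c _ _) (psiP hc).
Qed.

Lemma P_at1 n : (P n).[1] = 1.
Proof.
elim/nat_ind2: n => [|| n h0 h1] /=; rewrite ?hornerE //.
move: h0 h1 => /= h0 h1.
by rewrite h0 h1 mulr1 mulVf ?a_neq0.
Qed.

Lemma lin_sum1 m n N : (m + n < N)%N -> \sum_(k < N) lin m n k = 1.
Proof.
move=> hN; have := congr1 (fun p => p.[1]) (lin_poly hN).
rewrite hornerM !P_at1 mulr1 horner_sum => ->.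
by apply: eq_bigr => k _; rewrite hornerZ P_at1 mulr1.
Qed.

Lemma pred_eqSF n : (n.-1 == n.+1) = false.
Proof. by lia. Qed.

Lemma eq_SSF n : (n == n.+2) = false.
Proof. by lia. Qed.

Lemma pred_eqS k n : k != n.+2 -> (k.-1 == n.+1) = false.
Proof. by lia. Qed.

(** Orthogonality of the [P n]: pairing with [delta 0] is integration against the
orthogonality measure, and the weights are the inverses of the squared norms. *)
Lemma trans_delta0 n : trans c n (delta 0) = fun k => (weight n)^-1%:C * delta n k.
Proof.
elim/nat_ind2: n => [|| n h0 h1]; apply: funext => k.
- by rewrite trans0 /weight invr1 mul1r.
- have W1 : (weight 1)^-1 = c 1 by rewrite /weight (szwarc0 hc) subr0 mulr1 div1r invrK.
  rewrite W1 trans1 /jacobi /delta; case: k => [|[|k]] /=.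
  + by rewrite (szwarc0 hc) !mulr0 mul0r addr0.
  + by rewrite mulr0 add0r.
  + by rewrite !mulr0 addr0.
apply: (mulfI (aC_neq0 hc n.+1)); rewrite (transS hc) h1 /= h0.
rewrite /jacobi /delta.
have W0 := weight_gt0 n; have W1 := weight_gt0 n.+1; have W2 := weight_gt0 n.+2.
have E1 := weightS n; have E2 := weightS n.+1.
have D1 : (1 - c n) / weight n.+1 = c n.+1 / weight n.
  by apply/eqP; rewrite eqr_div ?weight_neq0 // E1.
have D2 : (1 - c n.+1) / weight n.+2 = c n.+2 / weight n.+1.
  by apply/eqP; rewrite eqr_div ?weight_neq0 // E2.
have C1 : (1 - c n)%:C * (weight n.+1)^-1%:C = (c n.+1)%:C * (weight n)^-1%:C.
  by rewrite -!rmorphM /= D1.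
have C2 : (1 - c n.+1)%:C * (weight n.+2)^-1%:C = (c n.+2)%:C * (weight n.+1)^-1%:C.
  by rewrite -!rmorphM /= D2.
rewrite [RHS]mulrA C2 eqSS; have [->|nk] := eqVneq k n.
  by rewrite pred_eqSF eq_SSF mulr1 !mulr0 addr0 C1 mulr1 subrr.
have [->|kn] := eqVneq k n.+2.
  by rewrite /= eqxx !mulr1 !mulr0 add0r subr0.
by rewrite pred_eqS // !mulr0 addr0 subr0.
Qed.

Lemma haarE n : haar P n = weight n.
Proof.
rewrite /haar lin_coefE; last by rewrite distnn.
by rewrite /lin trans_delta0 /delta eqxx mulr1 /= invrK.
Qed.

Lemma delta_trans k : delta k = fun i => (weight k)%:C * trans c k (delta 0) i.
Proof.
apply: funext => i; rewrite trans_delta0 mulrA -rmorphM /=.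
by rewrite divff ?mul1r // gt_eqF // weight_gt0.
Qed.

Lemma transZ n (a : R[i]) u k : trans c n (fun i => a * u i) k = a * trans c n u k.
Proof.
have := calc_linear c (P n) a u (fun=> 0) k.
have -> : (fun k => a * u k + 0) = (fun i => a * u i).
  by apply: funext => i; rewrite addr0.
rewrite /trans => ->; have -> : calc c (P n) (fun=> 0) k = 0; last by rewrite addr0.
by rewrite -/(trans c n _) (@transE n k (n + k).+1) // big1 // => i _; rewrite mulr0.
Qed.

(** Both sides are [w_n w_j] times the integral of [P_n P_k P_j]. *)
Lemma lin_sym n k j : weight n * lin n k j = weight j * lin j k n.
Proof.
suff H : (weight n)%:C * trans c n (delta j) k = (weight j)%:C * trans c j (delta n) k.
  have ReM (a : R) (z : R[i]) : complex.Re (a%:C * z) = a * complex.Re z.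
    by case: z => x y /=; rewrite mul0r subr0.
  by rewrite /lin -!ReM H.
rewrite (delta_trans j) (delta_trans n) !transZ (transC c j n).
by ring.
Qed.

End PropertyP.

(** * The algebra of summable sequences *)

Section L1Algebra.
Variables (R : realType) (c : nat -> R).
Hypothesis hc : szwarc_coefs c.
Implicit Types (u v : nat -> R[i]).

Local Notation P := (recurrence_poly c).
Local Notation w := (weight c).
Local Notation A := (l1alg P).
Local Notation mul := (@Defs.mul R A).
Implicit Types (f g : A).

Lemma w_ge0 k : 0 <= w k.
Proof. exact/ltW/(weight_gt0 hc). Qed.

Lemma l1normE f :
  l1norm P f = (\sum_(0 <= k <oo) (normc (f k) * w k)%:E)%E.
Proof. by apply: eq_eseriesr => k _; rewrite (haarE hc). Qed.

Lemma l1_term_ge0 f k : 0 <= normc (f k) * w k.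
Proof. by rewrite mulr_ge0 ?normc_ge0 ?w_ge0. Qed.

Lemma dom_intro f (M : R) : (forall N : nat, \sum_(k < N) normc (f k) * w k <= M) ->
  dom f /\ nrm f <= M.
Proof.
move=> H.
have L : (l1norm P f <= M%:E)%E.
  rewrite l1normE; apply: lime_le.
    by apply: is_cvg_nneseries => k _ _; rewrite lee_fin l1_term_ge0.
  by apply: nearW => n; rewrite sumEFin lee_fin big_mkord.
split; first by rewrite /= (le_lt_trans L) ?ltry.
have L0 : (0 <= l1norm P f)%E.
  by rewrite l1normE; apply: nneseries_ge0 => k _ _; rewrite lee_fin l1_term_ge0.
by rewrite /=; case: (l1norm P f) L L0.
Qed.

Lemma dom_bound f (N : nat) : dom f -> \sum_(k < N) normc (f k) * w k <= nrm f.
Proof.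
rewrite /= => fd.
have L0 : (0 <= l1norm P f)%E.
  by rewrite l1normE; apply: nneseries_ge0 => k _ _; rewrite lee_fin l1_term_ge0.
have : ((\sum_(k < N) normc (f k) * w k)%:E <= l1norm P f)%E.
  rewrite l1normE -(big_mkord xpredT (fun k => normc (f k) * w k)) -sumEFin.
  by apply: nneseries_lim_ge => k _; rewrite lee_fin l1_term_ge0.
by case: (l1norm P f) fd L0.
Qed.

Lemma nrm_ge0 f : dom f -> 0 <= nrm f.
Proof. by move=> fd; have := dom_bound 0 fd; rewrite big_ord0. Qed.

Lemma dom_le_at f k : dom f -> normc (f k) <= nrm f.
Proof.
move=> fd; apply: le_trans (dom_bound k.+1 fd); rewrite big_ord_recr /=.
rewrite -[leLHS]add0r lerD ?sumr_ge0 // => [i _|]; first exact: l1_term_ge0.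
by rewrite ler_peMr ?normc_ge0 ?(weight_ge1 hc).
Qed.

Lemma dom_lin (a : R[i]) f g : dom f -> dom g ->
  dom (a *: f + g : A) /\ nrm (a *: f + g : A) <= normc a * nrm f + nrm g.
Proof.
move=> fd gd; apply: dom_intro => N.
apply: (@le_trans _ _ (normc a * (\sum_(k < N) normc (f k) * w k) +
                       \sum_(k < N) normc (g k) * w k)).
  rewrite mulr_sumr -big_split /=; apply: ler_sum => k _.
  rewrite mulrA -mulrDl ler_wpM2r ?w_ge0 // -normcM.
  exact: ler_normcD.
by rewrite lerD ?ler_wpM2l ?normc_ge0 ?dom_bound.
Qed.

Lemma dom0 : dom (0 : A).
Proof.
by have [] : dom (0 : A) /\ nrm (0 : A) <= 0 by apply: dom_intro => N; rewrite big1 // => i _; rewrite normc0 mul0r.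
Qed.

Lemma dom_scale (a : R[i]) f : dom f -> dom (a *: f : A).
Proof. by move=> fd; have [] := dom_lin a fd dom0; rewrite addr0. Qed.

Lemma dom_finite f (N : nat) : (forall k, (N <= k)%N -> f k = 0) ->
  dom f /\ nrm f <= \sum_(k < N) normc (f k) * w k.
Proof.
move=> f0; apply: dom_intro => n.
rewrite -!(big_mkord xpredT (fun k => normc (f k) * w k)).
have [nN|Nn] := leqP n N.
  rewrite [leRHS](@big_cat_nat _ _ _ n 0 N) //= lerDl sumr_ge0 // => i _.
  exact: l1_term_ge0.
rewrite (@big_cat_nat _ _ _ N 0 n) ?(ltnW Nn) //= [X in _ + X]big1_seq ?addr0 //.
by move=> i /=; rewrite mem_index_iota => /andP[/f0 ->]; rewrite normc0 mul0r.
Qed.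

Lemma delta_out n k : (n.+1 <= k)%N -> delta R n k = 0.
Proof. by move=> h; rewrite /delta gtn_eqF. Qed.

Lemma sum_delta_at (V : pzSemiRingType) (F : nat -> V) n :
  \sum_(k < n.+1) F k * (k == n :> nat)%:R = F n.
Proof.
rewrite big_ord_recr /= eqxx mulr1 big1 ?add0r // => i _.
by rewrite ltn_eqF ?mulr0.
Qed.

Lemma dom_delta n : dom (delta R n : A) /\ nrm (delta R n : A) <= w n.
Proof.
have [d h] := @dom_finite (delta R n) n.+1 (@delta_out n).
split=> //; apply: le_trans h _.
rewrite -[leRHS](sum_delta_at w); apply: ler_sum => i _.
rewrite mulrC; case: eqP => [->|/eqP ne].
  by rewrite /delta eqxx normc1.
by rewrite /delta (negbTE ne) normc0.
Qed.

Lemma lin_combo_mul (a x y z t : R[i]) :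
  (a * x + y) * z * t = a * (x * z * t) + y * z * t.
Proof. by ring. Qed.

Definition seq_bounded u (B : R) := forall k, normc (u k) <= B.

(** The duality between summable and bounded sequences. *)
Definition pair f u : R[i] := csum (fun k => f k * u k * (w k)%:C).

Lemma pair_abs f u (B : R) : dom f -> seq_bounded u B ->
  abs_bounded (fun k => f k * u k * (w k)%:C) (nrm f * B).
Proof.
move=> fd uB N.
have B0 : 0 <= B by exact: le_trans (normc_ge0 _) (uB 0%N).
apply: (@le_trans _ _ ((\sum_(k < N) normc (f k) * w k) * B)).
  rewrite mulr_suml; apply: ler_sum => k _.
  rewrite !normcM normc_real ger0_norm ?w_ge0 // mulrAC ler_wpM2l //.
  exact: l1_term_ge0.
by rewrite ler_wpM2r ?dom_bound.
Qed.

Lemma pair_le f u (B : R) : dom f -> seq_bounded u B ->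
  normc (pair f u) <= nrm f * B.
Proof. by move=> fd uB; exact: normc_csum_le (pair_abs fd uB). Qed.

Lemma pair_linl (a : R[i]) f g u (B : R) : dom f -> dom g -> seq_bounded u B ->
  pair (a *: f + g) u = a * pair f u + pair g u.
Proof.
move=> fd gd uB; rewrite /pair -(csum_linear a (pair_abs fd uB) (pair_abs gd uB)).
congr csum; apply: funext => k.
exact: lin_combo_mul.
Qed.

Lemma pair_linr (a : R[i]) f u v (B B' : R) :
  dom f -> seq_bounded u B -> seq_bounded v B' ->
  pair f (fun k => a * u k + v k) = a * pair f u + pair f v.
Proof.
move=> fd uB vB; rewrite /pair -(csum_linear a (pair_abs fd uB) (pair_abs fd vB)).
by congr csum; apply: funext => k; ring.
Qed.

Lemma pair_zero f : pair f (fun=> 0) = 0.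
Proof.
by rewrite /pair (@csum_finite _ _ 0) ?big_ord0 // => k _; rewrite mulr0 mul0r.
Qed.

Lemma pair_scale (a : R[i]) f u (B : R) : dom f -> seq_bounded u B ->
  pair f (fun k => a * u k) = a * pair f u.
Proof.
move=> fd uB; have z0 : seq_bounded (fun=> 0) 0 by move=> k; rewrite normc0.
rewrite -[RHS]addr0 -(pair_zero f) -(pair_linr a fd uB z0).
by congr (pair f); apply: funext => k; rewrite addr0.
Qed.

Lemma pair_delta n u : pair (delta R n) u = u n * (w n)%:C.
Proof.
rewrite /pair (@csum_finite _ _ n.+1) => [|k /delta_out ->]; last by rewrite !mul0r.
rewrite -[RHS](sum_delta_at (fun k => u k * (w k)%:C)); apply: eq_bigr => i _.
by rewrite -mulrA mulrC.
Qed.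

Lemma pair_functional u (B : R) : seq_bounded u B ->
  bounded_functional (pair^~ u : A -> R[i]).
Proof.
move=> uB; split=> [a f g fd gd|]; first exact: pair_linl uB.
by exists B => f fd; rewrite mulrC pair_le.
Qed.

Lemma functional0 (F : A -> R[i]) : functional F -> F 0 = 0.
Proof.
move=> FF; have := FF 1 0 0 dom0 dom0; rewrite scaler0 addr0 mul1r => /eqP.
by rewrite -subr_eq0 opprD addNKr oppr_eq0 => /eqP.
Qed.

Lemma linE (a : R[i]) f g k :
  ((a *: f + g : A) k : R[i]) = a * (f k : R[i]) + (g k : R[i]).
Proof. by []. Qed.

Lemma subE f g k : ((f - g : A) k : R[i]) = (f k : R[i]) - (g k : R[i]).
Proof. by []. Qed.

Definition trunc (n : nat) f : A := fun k => if (k < n)%N then f k else 0.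

Lemma dom_trunc n f : dom (trunc n f).
Proof.
by have [|//] := @dom_finite (trunc n f) n; move=> k; rewrite /trunc ltnNge => ->.
Qed.

Lemma trunc_functional0 (F : A -> R[i]) n f : functional F ->
  (forall k, F (delta R k) = 0) -> F (trunc n f) = 0.
Proof.
move=> FF F0; elim: n => [|n IH].
  by rewrite (_ : trunc 0 f = 0) ?functional0 //; apply: funext.
have -> : trunc n.+1 f = ((f n : R[i]) *: (delta R n : A) + trunc n f : A).
  apply: funext => k; rewrite linE /trunc /delta.
  by rewrite ltnS; case: ltngtP => [_|_|->]; rewrite ?mulr0 ?mulr1 ?add0r ?addr0.
rewrite (FF (f n : R[i]) (delta R n) (trunc n f) (dom_delta n).1 (dom_trunc n f)).
by rewrite F0 IH mulr0 addr0.
Qed.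

Lemma tail_small f (e : R) : dom f -> 0 < e ->
  exists n : nat, dom (f - trunc n f : A) /\ nrm (f - trunc n f : A) <= e.
Proof.
move=> fd e0.
have [N hN] : exists N : nat, nrm f - e < \sum_(k < N) normc (f k) * w k.
  apply: contrapT => /forallNP H.
  have [_] : dom f /\ nrm f <= nrm f - e.
    by apply: dom_intro => N; rewrite leNgt; exact/negP/H.
  by rewrite lerBrDr gerDl leNgt e0.
exists N; apply: dom_intro => n.
apply: (@le_trans _ _ (\sum_(N <= k < maxn n N) normc (f k) * w k)).
  rewrite -(big_mkord xpredT (fun k => normc ((f - trunc N f : A) k) * w k)).
  apply: (@le_trans _ _ (\sum_(0 <= k < maxn n N) normc ((f - trunc N f : A) k) * w k)).
    rewrite [leRHS](@big_cat_nat _ _ _ n 0) ?leq_maxl //= lerDl sumr_ge0 // => i _.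
    exact: l1_term_ge0.
  rewrite (@big_cat_nat _ _ _ N 0) ?leq_maxr //= big1_seq ?add0r => [|i /=].
    rewrite big_nat [leRHS]big_nat; apply: ler_sum => i /andP[Ni _].
    by rewrite subE /trunc ltnNge Ni subr0.
  by rewrite mem_index_iota subE /trunc => /andP[_ ->]; rewrite subrr normc0 mul0r.
have := dom_bound (maxn n N) fd; move: hN.
rewrite -!(big_mkord xpredT (fun k => normc (f k) * w k)).
rewrite (@big_cat_nat _ _ _ N 0 (maxn n N)) ?leq_maxr //=.
rewrite ltrBlDr => h1 h2; rewrite -(lerD2l (\sum_(0 <= k < N) normc (f k) * w k)).
exact: le_trans h2 (ltW h1).
Qed.

Lemma functional_zero (F : A -> R[i]) f : bounded_functional F ->
  (forall k, F (delta R k) = 0) -> dom f -> F f = 0.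
Proof.
move=> [FF [M FM]] F0 fd; apply: eq_of_normc_lt => e e0; rewrite subr0.
have M0 : 0 < `|M| + 1 by rewrite ltr_wpDl.
have [n [td tn]] := tail_small fd (divr_gt0 e0 (mulr_gt0 (ltr0n _ 2) M0)).
have -> : F f = F (f - trunc n f : A).
  have := FF 1 (f - trunc n f) (trunc n f) td (dom_trunc n f).
  by rewrite scale1r subrK mul1r trunc_functional0 // addr0.
apply: (le_lt_trans (FM _ td)).
apply: (@le_lt_trans _ _ ((`|M| + 1) * (e / (2 * (`|M| + 1))))).
  apply: (@le_trans _ _ ((`|M| + 1) * nrm (f - trunc n f : A))).
    by rewrite ler_wpM2r ?(nrm_ge0 td) // (le_trans (ler_norm M)) // lerDl.
  by rewrite ler_wpM2l ?(ltW M0).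
have -> : (`|M| + 1) * (e / (2 * (`|M| + 1))) = e / 2 by field; rewrite gt_eqF.
by rewrite ltr_pdivrMr // mulr_natr mulr2n ltrDl.
Qed.

(** Finitely supported sequences are dense. *)
Lemma functional_ext (F G : A -> R[i]) f :
  bounded_functional F -> bounded_functional G ->
  (forall k, F (delta R k) = G (delta R k)) -> dom f -> F f = G f.
Proof.
move=> [FF [M FM]] [GG [M' GM]] FG fd; apply/eqP; rewrite -subr_eq0; apply/eqP.
apply: (@functional_zero (fun h => F h - G h)) => // [|k]; last by rewrite FG subrr.
split=> [a h h' hd hd'|]; first by rewrite FF // GG //; ring.
exists (M + M') => h hd; apply: (le_trans (ler_normcD _ _)).
by rewrite normc_opp mulrDl lerD ?FM ?GM.
Qed.

(** Used to transfer identities between finitely supported sequences to the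
algebra, in place of exchanging infinite sums. *)
Lemma bilinear_ext (B B' : A -> A -> R[i]) f g :
  (forall h, dom h -> bounded_functional (B h)) ->
  (forall h, dom h -> bounded_functional (B^~ h)) ->
  (forall h, dom h -> bounded_functional (B' h)) ->
  (forall h, dom h -> bounded_functional (B'^~ h)) ->
  (forall m n, B (delta R m) (delta R n) = B' (delta R m) (delta R n)) ->
  dom f -> dom g -> B f g = B' f g.
Proof.
move=> b1 b2 b3 b4 H fd gd.
apply: (functional_ext (b2 _ gd) (b4 _ gd)) => // m.
have md := (dom_delta m).1.
exact: (functional_ext (b1 _ md) (b3 _ md)).
Qed.

(** The sequence [F (delta k) / w k] is bounded as [delta k] has norm at most
[w k], and it represents [F] by density. *)
Lemma functional_pair (F : A -> R[i]) : bounded_functional F ->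
  exists u, [/\ exists B, seq_bounded u B,
    forall k, F (delta R k) = u k * (w k)%:C & forall f, dom f -> F f = pair f u].
Proof.
move=> FF; pose u k := F (delta R k) / (w k)%:C.
have wC k : (w k)%:C != 0 by rewrite (inj_eq (@complexI R) _ 0) (weight_neq0 hc).
have Fu k : F (delta R k) = u k * (w k)%:C by rewrite /u divfK.
have [B uB] : exists B, seq_bounded u B.
  have [M FM] := FF.2; exists `|M| => k; rewrite /u normcM normcV.
  rewrite normc_real ger0_norm ?w_ge0 // ler_pdivrMr ?(weight_gt0 hc) //.
  apply: (le_trans (FM _ (dom_delta k).1)).
  apply: (@le_trans _ _ (`|M| * nrm (delta R k : A))).
    by rewrite ler_wpM2r ?ler_norm // nrm_ge0 //; exact: (dom_delta k).1.
  by rewrite ler_wpM2l // (dom_delta k).2.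
exists u; split=> //; first by exists B.
move=> f fd; apply: (functional_ext FF (pair_functional uB)) => // k.
by rewrite pair_delta Fu.
Qed.

(** A translate is a convex combination of entries, by [lin_ge0] and
[lin_sum1]. *)
Lemma trans_bounded n u (B : R) : seq_bounded u B -> seq_bounded (trans c n u) B.
Proof.
move=> uB m; rewrite (transE hc _ (ltnSn (n + m))).
apply: (le_trans (ler_normc_sum _ _ _)).
rewrite -[leRHS]mul1r -(lin_sum1 hc (ltnSn (n + m))) mulr_suml.
apply: ler_sum => k _; rewrite normcM normc_real ger0_norm ?(lin_ge0 hc) //.
by rewrite ler_wpM2l ?(lin_ge0 hc).
Qed.

Lemma dom_seq_bounded f : dom f -> seq_bounded f (nrm f).
Proof. by move=> fd k; exact: dom_le_at. Qed.

Lemma mulE f g n : (mul f g n : R[i]) = pair g (trans c n f).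
Proof.
rewrite /= /convolution /pair; congr csum; apply: funext => k.
by rewrite (translationE hc) (haarE hc) [trans _ _ _ _ * _]mulrC.
Qed.

Lemma uniform_rank (Q : nat -> nat -> Prop) :
  (forall n, exists K, forall m, (K <= m)%N -> Q n m) ->
  forall N, exists K, forall n, (n < N)%N -> forall m, (K <= m)%N -> Q n m.
Proof.
move=> H; elim=> [|N [K hK]]; first by exists 0%N.
have [K' hK'] := H N; exists (maxn K K') => n; rewrite ltnS leq_eqVlt.
move=> /orP[/eqP ->|nN] m; rewrite geq_max => /andP[h1 h2]; first exact: hK'.
exact: hK.
Qed.

(** After [lin_sym] has moved the weight of the outer index to an inner one, the
sum of the linearization coefficients over the outer index is at most 1; all
sums are finite. *)
Lemma mul_partial f g (N K : nat) : dom f -> dom g ->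
  \sum_(n < N) normc (\sum_(k < K) g k * trans c n f k * (w k)%:C) * w n
  <= nrm f * nrm g.
Proof.
move=> fd gd.
apply: (@le_trans _ _ (\sum_(n < N) \sum_(k < K) \sum_(j < N + K)
    (normc (g k) * w k) * (normc (f j) * w j) * lin c j k n)).
  apply: ler_sum => n _.
  apply: (@le_trans _ _ ((\sum_(k < K) normc (g k) * w k *
      \sum_(j < N + K) lin c n k j * normc (f j)) * w n)).
    rewrite ler_wpM2r ?w_ge0 //; apply: (le_trans (ler_normc_sum _ _ _)).
    apply: ler_sum => k _; rewrite !normcM normc_real ger0_norm ?w_ge0 //.
    rewrite mulrAC ler_wpM2l ?l1_term_ge0 //.
    rewrite (transE hc (N := N + K)) ?ltn_add2r; last first.
      by rewrite (leq_trans (_ : _ < n.+1 + k)%N) ?leq_add // ltnW.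
    apply: (le_trans (ler_normc_sum _ _ _)); apply: ler_sum => j _.
    by rewrite normcM normc_real ger0_norm ?(lin_ge0 hc).
  rewrite mulr_suml; apply: ler_sum => k _; rewrite mulr_sumr mulr_suml.
  apply: ler_sum => j _; rewrite le_eqVlt; apply/orP; left; apply/eqP.
  have := lin_sym hc n k j => E.
  transitivity (normc (g k) * w k * normc (f j) * (w n * lin c n k j)); first by ring.
  by rewrite E; ring.
rewrite exchange_big /=.
apply: (@le_trans _ _ (\sum_(k < K) (normc (g k) * w k) * nrm f)); last first.
  by rewrite -mulr_suml mulrC ler_wpM2l ?nrm_ge0 // dom_bound.
apply: ler_sum => k _; rewrite exchange_big /=.
apply: (@le_trans _ _ (\sum_(j < N + K) (normc (g k) * w k) * (normc (f j) * w j))).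
  apply: ler_sum => j _; rewrite -mulr_sumr ler_piMr ?mulr_ge0 ?l1_term_ge0 ?normc_ge0 ?w_ge0 //.
  rewrite -(lin_sum1 hc (m := j) (n := k) (N := (j + k).+1 + N)) ?ltn_addr //.
  rewrite -!(big_mkord xpredT (lin c j k)).
  rewrite [leRHS](@big_cat_nat _ _ _ N 0) ?leq_addl //= lerDl sumr_ge0 // => i _.
  exact: (lin_ge0 hc).
by rewrite -mulr_sumr ler_wpM2l ?l1_term_ge0 ?dom_bound.
Qed.

Lemma mul_dom f g : dom f -> dom g ->
  dom (mul f g : A) /\ nrm (mul f g : A) <= nrm f * nrm g.
Proof.
move=> fd gd; apply: dom_intro => N; apply/ler_addgt0Pr => e e0.
pose W := \sum_(n < N) w n + 1.
have W0 : 0 < W by rewrite ltr_wpDl // sumr_ge0 // => i _; exact: w_ge0.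
have eW : 0 < e / W by rewrite divr_gt0.
have [K hK] : exists K, forall n, (n < N)%N -> forall m, (K <= m)%N ->
    normc (mul f g n - \sum_(k < m) g k * trans c n f k * (w k)%:C) < e / W.
  apply: uniform_rank => n; rewrite mulE.
  exact: csum_approx (pair_abs gd (trans_bounded n (dom_seq_bounded fd))) _ eW.
apply: (@le_trans _ _ (\sum_(n < N)
    (normc (\sum_(k < K) g k * trans c n f k * (w k)%:C) * w n + e / W * w n))).
  apply: ler_sum => n _; rewrite -mulrDl ler_wpM2r ?w_ge0 //.
  have h := hK n (ltn_ord n) K (leqnn K).
  rewrite -[X in normc X](subrK (\sum_(k < K) g k * trans c n f k * (w k)%:C)).
  by rewrite (le_trans (ler_normcD _ _)) // addrC lerD2l ltW.
rewrite big_split /= lerD ?mul_partial // -mulr_sumr.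
rewrite -[leRHS](divfK (lt0r_neq0 W0)) ler_wpM2l ?ltW //.
by rewrite /W ltrDl.
Qed.

Lemma mul_linl (a : R[i]) f f' g : dom f -> dom f' -> dom g ->
  mul (a *: f + f' : A) g = (a *: mul f g + mul f' g : A).
Proof.
move=> fd fd' gd; apply: funext => n; rewrite linE !mulE.
rewrite -(pair_linr a gd (trans_bounded n (dom_seq_bounded fd))
  (trans_bounded n (dom_seq_bounded fd'))).
by congr (pair g); apply: funext => k; exact: calc_linear.
Qed.

Lemma mul_linr (a : R[i]) f g g' : dom f -> dom g -> dom g' ->
  mul f (a *: g + g' : A) = (a *: mul f g + mul f g' : A).
Proof.
move=> fd gd gd'; apply: funext => n; rewrite linE !mulE.
exact: (pair_linl a gd gd' (trans_bounded n (dom_seq_bounded fd))).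
Qed.

Lemma comp_mul_functionall (F : A -> R[i]) g : bounded_functional F -> dom g ->
  bounded_functional (fun f => F (mul f g)).
Proof.
move=> [FF [M FM]] gd; split=> [a f f' fd fd'|].
  by rewrite mul_linl // FF //; exact: (mul_dom _ _).1.
exists (`|M| * nrm g) => f fd; have [d h] := mul_dom fd gd.
apply: (le_trans (FM _ d)); rewrite -mulrA [nrm g * _]mulrC.
apply: (@le_trans _ _ (`|M| * nrm (mul f g : A))).
  by rewrite ler_wpM2r ?ler_norm ?nrm_ge0.
by rewrite ler_wpM2l.
Qed.

Lemma comp_mul_functionalr (F : A -> R[i]) f : bounded_functional F -> dom f ->
  bounded_functional (fun g => F (mul f g)).
Proof.
move=> [FF [M FM]] fd; split=> [a g g' gd gd'|].
  by rewrite mul_linr // FF //; exact: (mul_dom _ _).1.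
exists (`|M| * nrm f) => g gd; have [d h] := mul_dom fd gd.
apply: (le_trans (FM _ d)); rewrite -mulrA.
apply: (@le_trans _ _ (`|M| * nrm (mul f g : A))).
  by rewrite ler_wpM2r ?ler_norm ?nrm_ge0.
by rewrite ler_wpM2l.
Qed.

Lemma mul_deltaE m n k :
  (mul (delta R m : A) (delta R n) k : R[i]) = (lin c k n m * w n)%:C.
Proof.
rewrite mulE pair_delta rmorphM /=; congr (_ * _).
rewrite (transE hc (N := (k + n).+1 + m.+1)) ?ltn_addr // /lin.
have h : (m < (k + n).+1 + m.+1)%N by lia.
by rewrite -(big_mkord xpredT (fun i => (lin c k n i)%:C * delta R m i)) sum_delta.
Qed.

Lemma pair_mul_delta u m n :
  pair (mul (delta R m : A) (delta R n)) u = (w m * w n)%:C * trans c m u n.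
Proof.
rewrite /pair (@csum_finite _ _ (m + n).+1) => [|k kmn]; last first.
  by rewrite mul_deltaE (lin_out hc) ?mul0r //; apply/negP => /andP[h1 h2]; lia.
rewrite (transE hc u (ltnSn _)) mulr_sumr; apply: eq_bigr => k _.
rewrite mul_deltaE.
transitivity ((w k * lin c k n m * w n)%:C * u k); first by rewrite !rmorphM /=; ring.
by rewrite (lin_sym hc) !rmorphM /=; ring.
Qed.

Lemma pair_at f n : pair f (delta R n) = f n * (w n)%:C.
Proof.
rewrite /pair (@csum_finite _ _ n.+1) => [|k /delta_out ->]; last by rewrite mulr0 mul0r.
rewrite -[RHS](sum_delta_at (fun k => f k * (w k)%:C)); apply: eq_bigr => i _.
by rewrite mulrAC.
Qed.

Lemma delta_bounded n : seq_bounded (delta R n) 1.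
Proof. by move=> k; rewrite /delta; case: eqP; rewrite ?normc1 ?normc0. Qed.

Lemma mul_comm f g : dom f -> dom g -> mul f g = mul g f :> A.
Proof.
move=> fd gd; apply: funext => n.
have wC : (w n)%:C != 0 by rewrite (inj_eq (@complexI R) _ 0) (weight_neq0 hc).
apply: (mulIf wC); rewrite -!(pair_at (_ : A)).
have bn := pair_functional (@delta_bounded n).
apply: (@bilinear_ext (fun f g => pair (mul f g) (delta R n))
  (fun f g => pair (mul g f) (delta R n))) => // [h hd|h hd|h hd|h hd|i j].
- exact: comp_mul_functionalr bn hd.
- exact: comp_mul_functionall bn hd.
- exact: comp_mul_functionall bn hd.
- exact: comp_mul_functionalr bn hd.
by rewrite !pair_mul_delta (trans_sym hc) [w i * _]mulrC.
Qed.

(** The module action of the algebra on its dual: [act f u] represents the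
functional [g |-> pair (mul g f) u]. *)
Definition act f u (n : nat) : R[i] := pair f (trans c n u).

Lemma act_bounded f u (B : R) : dom f -> seq_bounded u B ->
  seq_bounded (act f u) (nrm f * B).
Proof. by move=> fd uB n; apply: pair_le => //; exact: trans_bounded. Qed.

Lemma act_delta k u : act (delta R k) u = fun n => (w k)%:C * trans c k u n.
Proof. by apply: funext => n; rewrite /act pair_delta (trans_sym hc) mulrC. Qed.

Lemma act_functional u (B : R) n : seq_bounded u B ->
  bounded_functional (fun f => act f u n).
Proof. by move=> uB; exact: pair_functional (trans_bounded n uB). Qed.

Lemma pair_act_functional u (B : R) f : seq_bounded u B -> dom f ->
  bounded_functional (fun g => pair f (act g u)).
Proof.
move=> uB fd; split=> [a g g' gd gd'|].
  rewrite -(pair_linr a fd (act_bounded gd uB) (act_bounded gd' uB)).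
  congr (pair f); apply: funext => n.
  exact: (pair_linl a gd gd' (trans_bounded n uB)).
exists (nrm f * B) => g gd; apply: le_trans (pair_le fd (act_bounded gd uB)) _.
by rewrite mulrA mulrAC.
Qed.

Lemma pair_mul f g u (B : R) : dom f -> dom g -> seq_bounded u B ->
  pair (mul f g) u = pair f (act g u).
Proof.
move=> fd gd uB; have bu := pair_functional uB.
apply: (@bilinear_ext (fun f g => pair (mul f g) u) (fun f g => pair f (act g u)))
  => // [h hd|h hd|h hd|h hd|i j].
- exact: comp_mul_functionalr bu hd.
- exact: comp_mul_functionall bu hd.
- exact: pair_act_functional uB hd.
- exact: pair_functional (act_bounded hd uB).
by rewrite pair_mul_delta pair_delta act_delta (trans_sym hc) rmorphM /=; ring.
Qed.

Lemma trans_act n f u (B : R) : dom f -> seq_bounded u B ->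
  trans c n (act f u) = act f (trans c n u).
Proof.
move=> fd uB; apply: funext => m.
apply: (@functional_ext (fun f => trans c n (act f u) m)
   (fun f => act f (trans c n u) m)) => //.
- split=> [a g g' gd gd'|]; last first.
    exists B => g gd; rewrite mulrC.
    exact: (trans_bounded n (act_bounded gd uB)).
  rewrite -calc_linear; congr (calc _ _ _ _); apply: funext => k.
  exact: (pair_linl a gd gd' (trans_bounded k uB)).
- exact: act_functional (trans_bounded n uB).
by move=> k; rewrite !act_delta (transZ hc) transC.
Qed.

Lemma act_mul f g u (B : R) : dom f -> dom g -> seq_bounded u B ->
  act (mul f g) u = act f (act g u).
Proof.
move=> fd gd uB; apply: funext => n.
rewrite /act (pair_mul fd gd (trans_bounded n uB)).
by rewrite -(trans_act n gd uB).
Qed.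

Definition unit_seq : A := delta R 0.

Lemma act_unit u : act unit_seq u = u.
Proof. by rewrite act_delta; apply: funext => n; rewrite trans0 mul1r. Qed.

(** The eigenvectors of the Jacobi operator; if bounded, they represent the
characters. *)
Definition evalP (x : R) (k : nat) : R[i] := ((P k).[x])%:C.

Lemma jacobi_evalP x : jacobi c (evalP x) = fun k => x%:C * evalP x k.
Proof.
apply: funext => k; rewrite /jacobi /evalP -!rmorphM -rmorphD /=; congr (_%:C).
have := congr1 (fun p => p.[x]) (mulX_rec hc k).
by rewrite !hornerE => ->.
Qed.

Lemma calc_evalP p x : calc c p (evalP x) = fun k => (p.[x])%:C * evalP x k.
Proof.
elim/poly_ind: p => [|p a IH]; apply: funext => k.
  by rewrite calc0 horner0 mul0r.
rewrite calcD calcC [p * 'X]mulrC calc_mulX -jacobi_calc IH.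
rewrite [jacobi _ _ _](_ : _ = p.[x]%:C * jacobi c (evalP x) k); last first.
  by rewrite /jacobi; ring.
by rewrite jacobi_evalP !hornerE !rmorphD !rmorphM /=; ring.
Qed.

Lemma trans_evalP n x : trans c n (evalP x) = fun k => evalP x n * evalP x k.
Proof. exact: calc_evalP. Qed.

Lemma fourierE f x : fourier P f x = pair f (evalP x).
Proof. by rewrite /fourier /pair; congr csum; apply: funext => k; rewrite (haarE hc). Qed.

Lemma act_evalP f x (B : R) : dom f -> seq_bounded (evalP x) B ->
  act f (evalP x) = fun k => fourier P f x * evalP x k.
Proof.
move=> fd uB; apply: funext => n; rewrite /act trans_evalP fourierE.
by rewrite (pair_scale _ fd uB) mulrC.
Qed.

Lemma fourier_mul f g x (B : R) : dom f -> dom g -> seq_bounded (evalP x) B ->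
  fourier P (mul f g) x = fourier P f x * fourier P g x.
Proof.
move=> fd gd uB; have fgd := (mul_dom fd gd).1.
have := congr1 (fun u => u 0%N) (act_mul fd gd uB).
have -> : act f (act g (evalP x)) 0 = fourier P f x * fourier P g x.
  rewrite (act_evalP gd uB) /act trans0 (pair_scale _ fd uB).
  by rewrite [fourier P f x]fourierE mulrC.
by move=> <-; rewrite /act trans0 fourierE.
Qed.

End L1Algebra.

(** * The Banach space of bounded sequences *)

Section BoundedSequences.
Variable R : realType.

Definition linf_pred : {pred nat -> R[i]^o} :=
  fun u => `[< exists B : R, seq_bounded u B >].

Lemma linf_submod : submod_closed linf_pred.
Proof.
split; first by apply/asboolP; exists 0 => k; rewrite normc0.
move=> a u v /asboolP[B uB] /asboolP[B' vB]; apply/asboolP.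
exists (normc a * B + B') => k.
apply: le_trans (ler_normcD (a * u k) (v k)) _.
by rewrite normcM lerD // ler_wpM2l ?normc_ge0.
Qed.

HB.instance Definition _ :=
  GRing.isSubmodClosed.Build R[i] (nat -> R[i]^o) linf_pred linf_submod.

Record linf := Linf { linf_fun :> nat -> R[i]^o; _ : linf_fun \in linf_pred }.

HB.instance Definition _ := [isSub for linf_fun].
HB.instance Definition _ := [Choice of linf by <:].
HB.instance Definition _ := [SubChoice_isSubLmodule of linf by <:].

Lemma linf_bounded (u : linf) : exists B : R, seq_bounded u B.
Proof. by case: u => u /= /asboolP. Qed.

Lemma linfP (u v : linf) : (forall k, u k = v k) -> u = v.
Proof. by move=> uv; apply/val_inj/funext. Qed.

Lemma linf_lin (a : R[i]) (u v : linf) k :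
  ((a *: u + v) k : R[i]) = a * (u k : R[i]) + (v k : R[i]).
Proof. by []. Qed.

Lemma linf_scale (a : R[i]) (u : linf) k :
  ((a *: u) k : R[i]) = a * (u k : R[i]).
Proof. by []. Qed.

Lemma linf0 k : ((0 : linf) k : R[i]) = 0.
Proof. by []. Qed.

Definition supnorm (u : linf) : R := sup (range (fun k => normc (u k))).

Lemma supnorm_has_sup (u : linf) : has_sup (range (fun k => normc (u k))).
Proof.
split; first by exists (normc (u 0%N)), 0%N.
by have [B uB] := linf_bounded u; exists B => _ [k _ <-].
Qed.

Lemma supnorm_ub (u : linf) : seq_bounded u (supnorm u).
Proof. by move=> k; apply: ub_le_sup; [have [] := supnorm_has_sup u|exists k]. Qed.

Lemma supnorm_le (u : linf) (B : R) : seq_bounded u B -> supnorm u <= B.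
Proof.
by move=> uB; apply: ge_sup; [exists (normc (u 0%N)), 0%N|move=> _ [k _ <-]].
Qed.

Lemma supnorm_ge0 (u : linf) : 0 <= supnorm u.
Proof. exact: le_trans (normc_ge0 (u 0%N)) (supnorm_ub u 0). Qed.

Definition linf_norm (u : linf) : R[i] := (supnorm u)%:C.

Lemma linf_normD (u v : linf) : linf_norm (u + v) <= linf_norm u + linf_norm v.
Proof.
rewrite /linf_norm -rmorphD lecR; apply: supnorm_le => k.
apply: le_trans (ler_normcD (u k) (v k)) _.
by rewrite lerD ?supnorm_ub.
Qed.

Lemma linf_normZ (a : R[i]) (u : linf) : linf_norm (a *: u) = `|a| * linf_norm u.
Proof.
have le1 b v : supnorm (b *: v) <= normc b * supnorm v.
  apply: supnorm_le => k; apply: (@le_trans _ _ (normc (b * v k))) => //.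
  by rewrite normcM ler_wpM2l ?normc_ge0 // supnorm_ub.
rewrite normr_normc /linf_norm -rmorphM /=; congr (_%:C); apply/le_anti.
rewrite le1 /=; have [->|a0] := eqVneq a 0.
  by rewrite normc0 mul0r supnorm_ge0.
have na : 0 < normc a by rewrite lt_def normc_ge0 normc_eq0 a0.
rewrite -ler_pdivlMl // -normcV.
by have := le1 a^-1 (a *: u); rewrite scalerA mulVf // scale1r.
Qed.

Lemma linf_norm0_eq0 (u : linf) : linf_norm u = 0 -> u = 0.
Proof.
move=> /complexI u0; apply: linfP => k; apply/eqP; rewrite -normc_eq0.
by rewrite eq_le normc_ge0 andbT -u0 supnorm_ub.
Qed.

HB.instance Definition _ :=
  @Lmodule_isNormed.Build R[i] linf linf_norm linf_normD linf_normZ linf_norm0_eq0.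

Lemma linf_normE (u : linf) : `|u| = (supnorm u)%:C.
Proof. by []. Qed.

Lemma linf_ball_half (F : set_system linf) : ProperFilter F -> cauchy F ->
  exists x : nat -> linf, forall k, F [set u | supnorm (x k - u) < (1 / 2) ^+ k].
Proof.
move=> FF /cauchyP Fc.
suff H k : exists x : linf, F [set u | supnorm (x - u) < (1 / 2) ^+ k].
  by have [x hx] := choice H; exists x.
have e0 : 0 < ((1 / 2 : R) ^+ k)%:C by rewrite ltcR exprn_gt0.
have [x Fx] := Fc _ e0; exists x; apply: filterS Fx => u.
by rewrite -ball_normE /= linf_normE ltcR.
Qed.

Lemma linf_complete (F : set_system linf) : ProperFilter F -> cauchy F -> cvg F.
Proof.
move=> FF Fc; have [x hx] := linf_ball_half FF Fc.
pose e k : R := (1 / 2) ^+ k.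
have eS k : e k = e k.+1 + e k.+1 by rewrite /e exprS; field.
have e_ge0 k : 0 <= e k by rewrite exprn_ge0.
have e_small r : 0 < r -> exists M, e M < r.
  move=> r0; have : (fun k => e k) @ \oo --> (0 : R).
    by apply: cvg_expr; rewrite ger0_norm; lra.
  move=> /cvgrPdist_lt /(_ _ r0)[M _ hM]; exists M.
  by have := hM M (leqnn M); rewrite /= sub0r normrN ger0_norm.
have supC u v : supnorm (u - v) = supnorm (v - u).
  by apply: complexI; rewrite -!linf_normE distrC.
have supD u v t : supnorm (u - t) <= supnorm (u - v) + supnorm (v - t).
  by rewrite -lecR rmorphD /= -!linf_normE ler_distD.
(* F is eventually within 1/2^k of x k, so the x k form a fast Cauchy sequence;
   the limit is the pointwise sum of the increments d. *)
have dx k l : supnorm (x k - x l) <= e k + e l.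
  have [u [h1 h2]] := filter_ex (filterI (hx k) (hx l)).
  by rewrite (le_trans (supD _ u _)) // lerD ?ltW // supC.
have dn k l n : normc (x k n - x l n) <= e k + e l.
  exact: le_trans (supnorm_ub (x k - x l) n) (dx k l).
have sum_e N : \sum_(k < N) (e k + e k.+1) <= 4 - 3 * e N.
  elim: N => [|N IH]; first by rewrite big_ord0 /e expr0; lra.
  by rewrite big_ord_recr /=; have := eS N; lra.
pose d n k : R[i] := x k.+1 n - x k n.
have dbnd n : abs_bounded (d n) 4.
  move=> N; apply: (@le_trans _ _ (\sum_(k < N) (e k + e k.+1))).
    by apply: ler_sum => k _; rewrite addrC dn.
  by apply: le_trans (sum_e N) _; have := e_ge0 N; lra.
pose y n : R[i] := csum (d n) + x 0%N n.
have part n N : \sum_(k < N) d n k + x 0%N n = x N n.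
  elim: N => [|N IH]; first by rewrite big_ord0 add0r.
  by rewrite big_ord_recr /= addrAC IH /d addrC subrK.
have yx n m : normc (y n - x m n) <= e m.
  apply/ler_addgt0Pr => r r0; have r2 : 0 < r / 2 by rewrite divr_gt0.
  have [N hN] := csum_approx (dbnd n) r2.
  have [M hM] := e_small _ r2.
  pose K := maxn N M.
  have hK : e K <= e M.
    rewrite /e /K; apply: ler_wiXn2l; lra || exact: leq_maxr.
  have -> : y n - x m n = (csum (d n) - \sum_(k < K) d n k) + (x K n - x m n).
    by rewrite -(part n K) /y; ring.
  apply: (le_trans (ler_normcD _ _)).
  have h1 := hN K (leq_maxl _ _); have h2 := dn K m n.
  by move: h1 h2 hK hM; set a := normc _; set b := normc _; lra.
have yB : (y : nat -> R[i]^o) \in linf_pred.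
  apply/asboolP; exists (e 0%N + supnorm (x 0%N)) => n.
  have -> : y n = (y n - x 0%N n) + x 0%N n by rewrite subrK.
  by apply: (le_trans (ler_normcD _ _)); rewrite lerD ?yx ?supnorm_ub.
apply/cvg_ex; exists (Linf yB); apply/cvg_ballP => r r0.
have [s rs] : exists s : R, r = s%:C.
  by exists (complex.Re r); rewrite RRe_real // realE ltW.
rewrite rs ltcR in r0 *; have r2 : 0 < s / 2 by rewrite divr_gt0.
have [M hM] := e_small _ r2.
apply: filterS (hx M) => u hu; rewrite -ball_normE /= linf_normE ltcR.
apply: (le_lt_trans (supD _ (x M) _)).
have : supnorm (Linf yB - x M) <= e M by apply: supnorm_le => n; exact: yx.
by move: hu hM; rewrite /= -/(e M); lra.
Qed.

HB.instance Definition _ := Uniform_isComplete.Build linf linf_complete.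

End BoundedSequences.

(** * Failure of amenability at the point 0 *)

Section CharacterAtZero.
Variables (R : realType) (c : nat -> R).
Hypothesis hc : szwarc_coefs c.

Local Notation P := (recurrence_poly c).
Local Notation w := (weight c).
Local Notation A := (l1alg P).
Local Notation mul := (@Defs.mul R A).
Local Notation E := (evalP c 0).
Implicit Types (f g a b : A) (u v x : linf R).

Definition phi (f : A) : R[i] := fourier P f 0.

Lemma P_at0S n : (1 - c n.+1) * (P n.+2).[0] = - (c n.+1 * (P n).[0]).
Proof.
have := congr1 (fun p => p.[0]) (mulX_rec hc n.+1); rewrite !hornerE /=.
by move=> /eqP; rewrite eq_sym addr_eq0 => /eqP.
Qed.

Lemma P_at0_abs n : (1 - c n.+1) * `|(P n.+2).[0]| = c n.+1 * `|(P n).[0]|.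
Proof.
have := congr1 (fun y : R => `|y|) (P_at0S n).
by rewrite normrN !normrM (ger0_norm (ltW (a_gt0 hc n.+1))) (ger0_norm (c_ge0 hc n.+1)).
Qed.

Lemma P_at0_le n : `|(P n.+2).[0]| <= `|(P n).[0]|.
Proof.
have := P_at0_abs n.
have := szwarc_le_half hc n.+1; have := c_ge0 hc n.+1.
have := normr_ge0 (P n.+2).[0]; have := normr_ge0 (P n).[0]; have := a_gt0 hc n.+1.
set p := `|_|; set q := `|_|; move=> h1 h2 h3 h4 h5 h6.
have : (1 - c n.+1) * q <= (1 - c n.+1) * p by rewrite h6 ler_wpM2r //; lra.
by rewrite ler_pM2l.
Qed.

Lemma P_odd_at0 n : (P n.*2.+1).[0] = 0.
Proof.
elim: n => [|n IH]; first by rewrite /= hornerX.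
apply: (mulfI (a_neq0 hc n.*2.+2)).
by rewrite doubleS P_at0S IH !mulr0 oppr0.
Qed.

Lemma P_at0_le1 n : `|(P n).[0]| <= 1.
Proof.
elim/nat_ind2: n => [||n h0 _]; last exact: le_trans (P_at0_le n) h0.
- by rewrite hornerE normr1.
- by rewrite hornerX normr0.
Qed.

Lemma E_bounded : seq_bounded E 1.
Proof. by move=> k; rewrite /evalP normc_real P_at0_le1. Qed.

Lemma E_at0 : E 0 = 1.
Proof. by rewrite /evalP hornerE. Qed.

Lemma phi_pair f : phi f = pair f E.
Proof. exact (fourierE hc f 0). Qed.

Lemma phi_functional : bounded_functional phi.
Proof.
rewrite (_ : phi = (fun f => pair f E)); last by apply: funext => f; exact: phi_pair.
exact (pair_functional hc E_bounded).
Qed.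

Lemma phi_mul a b : dom a -> dom b -> phi (mul a b) = phi a * phi b.
Proof. by move=> ad bd; exact (fourier_mul hc ad bd E_bounded). Qed.

Lemma phi_unit : phi (delta R 0) = 1.
Proof. by rewrite phi_pair pair_delta E_at0 mul1r. Qed.

Lemma phi_character : character phi.
Proof.
split; [exact: phi_functional.1|exact: phi_mul|].
by exists (delta R 0); [exact: (dom_delta hc 0).1|rewrite phi_unit; apply/eqP; exact: oner_neq0].
Qed.

Lemma phi_le a : dom a -> normc (phi a) <= nrm a.
Proof. by move=> ad; rewrite phi_pair -[leRHS]mulr1 pair_le //; exact: E_bounded. Qed.

(** [E] spans the sequences on which the algebra acts by [phi]; subtracting the
multiple of [E] with the same value at 0 is compatible with the action. *)
Definition proj_act (u : nat -> R[i]) a (n : nat) : R[i] :=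
  act a u n - act a u 0 * E n.

Lemma proj_act_bounded u a : dom a ->
  seq_bounded (proj_act u a) (2 * nrm a * supnorm u).
Proof.
move=> ad n; have aB := act_bounded hc ad (supnorm_ub u).
apply: (le_trans (ler_normcD _ _)); rewrite normc_opp normcM.
have h1 := aB n; have h2 := aB 0%N; have h3 := E_bounded n.
have h4 := normc_ge0 (act a u 0).
have : normc (act a u 0) * normc (E n) <= normc (act a u 0) by rewrite ler_piMr.
by move: h1 h2; set p := normc _; set q := normc _; set r := _ * normc _; lra.
Qed.

Definition ractE u a : linf R := insubd (0 : linf R) (proj_act u a : nat -> R[i]^o).
Definition lactE a u : linf R := phi a *: u.

Lemma ractEE u a n : dom a -> (ractE u a n : R[i]) = proj_act u a n.
Proof.
move=> ad; rewrite /ractE -[linf_fun _]/(val _) insubdK //.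
by apply/asboolP; eexists; exact: proj_act_bounded.
Qed.

Lemma act_linl (k : R[i]) a b (u : linf R) n : dom a -> dom b ->
  act (k *: a + b : A) u n = k * act a u n + act b u n.
Proof.
by move=> ad bd; exact: (pair_linl hc k ad bd (trans_bounded hc n (supnorm_ub u))).
Qed.

Lemma act_linr (k : R[i]) a (u v : linf R) n : dom a ->
  act a (k *: u + v) n = k * act a u n + act a v n.
Proof.
move=> ad; rewrite -(pair_linr hc k ad (trans_bounded hc n (supnorm_ub u))
  (trans_bounded hc n (supnorm_ub v))).
by congr (pair a); apply: funext => m; rewrite -calc_linear.
Qed.

Lemma act_scale (k : R[i]) a (u : linf R) n : dom a ->
  act a (k *: u) n = k * act a u n.
Proof.
move=> ad; have act0 : act a (0 : linf R) n = 0.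
  have := @act_linr 1 a 0 0 n ad; rewrite scale1r addr0 mul1r => /eqP.
  by rewrite -subr_eq0 opprD addNKr oppr_eq0 => /eqP.
by rewrite -[k *: u]addr0 act_linr // act0 addr0.
Qed.

Lemma act_ractE u a b n : dom a -> dom b ->
  act b (ractE u a) n = act b (act a u) n - act a u 0 * phi b * E n.
Proof.
move=> ad bd.
have -> : (ractE u a : nat -> R[i]) = (fun k => - act a u 0 * E k + act a u k).
  by apply: funext => k; rewrite ractEE // /proj_act addrC mulNr.
have hE := trans_bounded hc n E_bounded.
have hA := trans_bounded hc n (act_bounded hc ad (supnorm_ub u)).
rewrite {1}/act (_ : trans c n _ = fun k => - act a u 0 * trans c n E k
    + trans c n (act a u) k); last by apply: funext => k; rewrite -calc_linear.
rewrite (pair_linr hc _ bd hE hA) -/(act b E n) -/(act b _ n).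
by rewrite (act_evalP hc bd E_bounded) -/(phi b); ring.
Qed.

Lemma normed_Re (u : linf R) : complex.Re `|u| = supnorm u.
Proof. by []. Qed.

Lemma supnorm_Z (k : R[i]) u : supnorm (k *: u) = normc k * supnorm u.
Proof.
apply: complexI; rewrite rmorphM /= -!linf_normE normrZ.
by [].
Qed.

Lemma bimoduleE : banach_bimodule (A := A) lactE ractE.
Proof.
have pF := phi_functional.1.
split.
- by move=> k a b x ad bd; rewrite /lactE pF // scalerDl scalerA.
- by move=> k a x y ad; rewrite /lactE scalerDr !scalerA mulrC.
- move=> k x y a ad; apply: linfP => n; rewrite linf_lin !ractEE // /proj_act.
  by rewrite !act_linr //; ring.
- move=> k x a b ad bd; have [abd _] := dom_lin hc k ad bd.
  apply: linfP => n; rewrite linf_lin !ractEE // /proj_act.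
  by rewrite !act_linl //; ring.
- by move=> a b x ad bd; rewrite /lactE phi_mul // scalerA.
- move=> x a b ad bd; have [abd _] := mul_dom hc ad bd.
  apply: linfP => n; rewrite !ractEE // /proj_act !act_ractE //.
  rewrite (mul_comm hc ad bd) !(act_mul hc bd ad (supnorm_ub x)) E_at0 mulr1.
  by ring.
- move=> a b x ad bd; apply: linfP => n.
  rewrite linf_scale !ractEE // /proj_act !act_scale //.
  by ring.
- exists 1 => a x ad; rewrite normed_Re supnorm_Z mul1r normed_Re.
  by rewrite ler_wpM2r ?supnorm_ge0 ?phi_le.
- exists 2 => a x ad; rewrite !normed_Re; apply: supnorm_le => n.
  by rewrite ractEE // proj_act_bounded.
Qed.

(** If the right action were translation without the projection, this derivation
would be inner, by evaluation at 0. *)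
Definition derE a (u : linf R) : R[i] := act a u 0 - phi a * u 0%N.

Lemma derE_le a u : dom a -> normc (derE a u) <= 2 * nrm a * supnorm u.
Proof.
move=> ad; apply: (le_trans (ler_normcD _ _)); rewrite normc_opp normcM.
have h1 := act_bounded hc ad (supnorm_ub u) 0.
have h2 : normc (phi a) * normc (u 0%N) <= nrm a * supnorm u.
  by apply: ler_pM; rewrite ?normc_ge0 ?phi_le ?supnorm_ub.
by rewrite -mulrA mulr_natl mulr2n lerD.
Qed.

Lemma derE_derivation : @bounded_dual_derivation R A
  (nspace_of_normedMod (linf R)) lactE ractE derE.
Proof.
have pF := phi_functional.1.
split.
- move=> a ad; split=> [k x y _ _|].
    by rewrite /derE act_linr // linf_lin; ring.
  by exists (2 * nrm a) => x _; exact: derE_le.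
- by move=> k a b x ad bd _; rewrite /derE act_linl // pF //; ring.
- move=> a b x ad bd _; rewrite /derE act_ractE // E_at0 ractEE // /proj_act E_at0.
  rewrite phi_mul // (mul_comm hc ad bd) (act_mul hc bd ad (supnorm_ub x)).
  by rewrite /lactE act_scale // linf_scale; ring.
- by exists 2 => a x ad _; exact: derE_le.
Qed.

Definition dlt (k : nat) : linf R := insubd (0 : linf R) (delta R k : nat -> R[i]^o).

Lemma dltE k n : (dlt k n : R[i]) = delta R k n.
Proof.
rewrite /dlt -[linf_fun _]/(val _) insubdK //.
by apply/asboolP; exists 1; exact: delta_bounded.
Qed.

Definition comb (s : nat -> R[i]) (N : nat) : linf R := \sum_(k < N) s k *: dlt k.

Lemma combE s N n : (comb s N n : R[i]) = if (n < N)%N then s n else 0.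
Proof.
rewrite /comb; elim: N => [|N IH]; first by rewrite big_ord0.
have -> : \sum_(k < N.+1) s k *: dlt k = s N *: dlt N + \sum_(k < N) s k *: dlt k.
  by rewrite big_ord_recr addrC.
rewrite linf_lin IH dltE /delta ltnS.
by case: ltngtP => [_|_|->]; rewrite ?mulr0 ?mulr1 ?add0r ?addr0.
Qed.

Definition Elinf : linf R := insubd (0 : linf R) (E : nat -> R[i]^o).

Lemma ElinfE n : (Elinf n : R[i]) = E n.
Proof.
rewrite /Elinf -[linf_fun _]/(val _) insubdK //.
by apply/asboolP; exists 1; exact: E_bounded.
Qed.

(** What an inner [derE] would provide.  By the range condition [M] is zero at the
finitely supported sequences, and then also at [E]. *)
Section Mean.
Variable M : linf R -> R[i].
Hypothesis Mlin : forall (k : R[i]) u v, M (k *: u + v) = k * M u + M v.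
Hypothesis Mbnd : exists B : R, forall u, normc (M u) <= B * supnorm u.
Hypothesis Mjac : forall u v,
  (forall n, (v n : R[i]) = jacobi c (u : nat -> R[i]) n) -> M v = 0.

Lemma M0 : M 0 = 0.
Proof.
have := Mlin 1 0 0; rewrite scaler0 addr0 mul1r => /eqP.
by rewrite -subr_eq0 opprD addNKr oppr_eq0 => /eqP.
Qed.

Lemma M_comb s N : M (comb s N) = \sum_(k < N) s k * M (dlt k).
Proof.
rewrite /comb; elim: N => [|N IH]; first by rewrite !big_ord0 M0.
by rewrite !big_ord_recr /= addrC Mlin IH addrC.
Qed.

Lemma M_dlt1 : M (dlt 1) = 0.
Proof.
have cC : (c 1)%:C != 0 by rewrite (inj_eq (@complexI R) _ 0) (c_neq0 hc).
apply: (mulfI cC); rewrite mulr0 -[LHS]addr0 -[X in _ + X]M0 -Mlin.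
apply: (@Mjac (dlt 0)) => n; rewrite linf_lin linf0.
rewrite dltE addr0 /jacobi !dltE /delta.
case: n => [|[|n]] /=; rewrite ?(szwarc0 hc) ?mulr0 ?mulr1 ?add0r ?mul0r //.
Qed.

Lemma M_dltS n : (1 - c n)%:C * M (dlt n) + (c n.+2)%:C * M (dlt n.+2) = 0.
Proof.
rewrite -[_ * M (dlt n.+2)]addr0 -[X in _ + (_ + X)]M0 -!Mlin.
apply: (@Mjac (dlt n.+1)) => k; rewrite !linf_lin linf0.
rewrite !dltE addr0 /jacobi !dltE /delta eqSS.
have [->|kn] := eqVneq k n; first by rewrite pred_eqSF eq_SSF !mulr0.
have [->|kn2] := eqVneq k n.+2; first by rewrite /= eqxx !mulr0 !add0r.
by rewrite pred_eqS // !mulr0.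
Qed.

(** Applying [M] to [J delta_(n+1)] gives
[a_n M(delta_n) + c_(n+2) M(delta_(n+2)) = 0], and [a_n >= 1/2 >= c_(n+2)]: along
the even indices the values of [M] alternate in sign and do not decrease in
modulus. *)
Lemma M_dlt_growth n : exists r : R, (if odd n then 0 else 1) <= r /\
  (if odd n then 0 else (-1) ^+ n./2) * M (dlt n) = r%:C * M (dlt 0).
Proof.
elim/nat_ind2: n => [||n [r [r1 rE]] _].
- by exists 1; rewrite /= expr0.
- by exists 0; rewrite /= !mul0r.
have c0 := szwarc_gt0 hc n.+1.
have h1 := szwarc_le_half hc n; have h2 := szwarc_le_half hc n.+2.
exists ((1 - c n) / c n.+2 * r); rewrite /= negbK; split.
  have r0 : 0 <= r by move: r1; case: ifP => _; lra.
  apply: le_trans r1 _; rewrite -[leLHS]mul1r ler_wpM2r //.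
  by rewrite ler_pdivlMr // mul1r; lra.
have cC : (c n.+2)%:C != 0 by rewrite (inj_eq (@complexI R) _ 0) gt_eqF.
apply: (mulfI cC); rewrite !rmorphM /= fmorphV.
have := M_dltS n => /eqP; rewrite addrC addr_eq0 => /eqP e.
rewrite mulrCA e.
transitivity ((1 - c n)%:C * ((if odd n then 0 else (-1) ^+ n./2) * M (dlt n))).
  by case: ifP => _; rewrite ?exprS; ring.
by rewrite rE rmorphB /=; field.
Qed.

Lemma M_dlt0 : M (dlt 0) = 0.
Proof.
have [r hr] := choice M_dlt_growth.
(* Test [M] on the alternating sequence: its norm is 1, but the contributions
   of the even entries all point in the direction of M (dlt 0). *)
pose s k : R[i] := if odd k then 0 else (-1) ^+ k./2.
have [B hB] := Mbnd.
have sB N : supnorm (comb s N) <= 1.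
  apply: supnorm_le => n; rewrite combE; case: ifP => _; last by rewrite normc0.
  rewrite /s; case: ifP => _; first by rewrite normc0.
  have -> : ((-1) ^+ n./2 : R[i]) = ((-1) ^+ n./2 : R)%:C by rewrite rmorphXn rmorphN1.
  by rewrite normc_real normrX normrN1 expr1n.
have MN N : M (comb s N) = (\sum_(k < N) r k)%:C * M (dlt 0).
  rewrite M_comb rmorph_sum mulr_suml; apply: eq_bigr => k _.
  by rewrite (hr k).2.
have rN N : N%:R <= \sum_(k < N.*2) r k.
  elim: N => [|N IH]; first by rewrite big_ord0.
  rewrite doubleS !big_ord_recr /= -addrA -natr1 lerD //.
  have := (hr N.*2).1; have := (hr N.*2.+1).1; rewrite /= odd_double /=.
  by lra.
apply/eqP; rewrite -normc_eq0; apply: contraT => m0.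
have mp : 0 < normc (M (dlt 0)) by rewrite lt_def m0 normc_ge0.
pose N := (Num.trunc (`|B| / normc (M (dlt 0)))).+1.
have : `|B| < N%:R * normc (M (dlt 0)).
  by rewrite -ltr_pdivrMr // /N truncnS_gt.
have := hB (comb s N.*2); rewrite MN normcM normc_real.
have h := rN N; rewrite ger0_norm ?(le_trans _ h) // => h1 h2.
have : N%:R * normc (M (dlt 0)) <= `|B|.
  apply: (@le_trans _ _ (`|B| * supnorm (comb s N.*2))).
    apply: le_trans (ler_wpM2r _ h) _; first exact: ltW.
    apply: (le_trans h1); rewrite ler_wpM2r ?supnorm_ge0 ?ler_norm //.
  by rewrite ler_piMr.
by rewrite leNgt h2.
Qed.

Lemma M_dlt n : M (dlt n) = 0.
Proof.
elim/nat_ind2: n => [||n h0 _]; [exact: M_dlt0|exact: M_dlt1|].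
have := M_dltS n; rewrite h0 mulr0 add0r => /eqP; rewrite mulf_eq0 => /orP[|/eqP//].
by rewrite (inj_eq (@complexI R) _ 0) (negbTE (c_neq0 hc _)).
Qed.

(** [E] is the uniform limit of its truncations, as [|P_k(0)|] decreases to 0
along the even indices and vanishes at the odd ones. *)
Lemma M_vanish : (forall e : R, 0 < e -> exists n, `|(P n.*2).[0]| < e) ->
  M Elinf = 0.
Proof.
move=> lim0; apply: eq_of_normc_lt => e e0; rewrite subr0.
have [B hB] := Mbnd; have B0 : 0 < `|B| + 1 by rewrite ltr_wpDl.
have [n hn] := lim0 _ (divr_gt0 e0 (mulr_gt0 (ltr0n _ 2) B0)).
set d := e / _ in hn.
have small k : (n.*2 <= k)%N -> `|(P k).[0]| <= d.
  move=> /subnKC <-; elim/nat_ind2: (k - n.*2)%N => [||j h _].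
  - by rewrite addn0 ltW.
  - by rewrite addn1 P_odd_at0 normr0 ltW // /d divr_gt0 // mulr_gt0.
  - by rewrite !addnS (le_trans (P_at0_le _)).
have -> : M Elinf = M (Elinf - comb E n.*2).
  have := Mlin 1 (Elinf - comb E n.*2) (comb E n.*2).
  rewrite scale1r subrK mul1r M_comb => ->.
  by rewrite big1 ?addr0 // => i _; rewrite M_dlt mulr0.
apply: (le_lt_trans (hB _)).
have hd : supnorm (Elinf - comb E n.*2) <= d.
  apply: supnorm_le => k.
  rewrite [linf_fun _ k](_ : _ = (Elinf k : R[i]) - (comb E n.*2 k : R[i])) //.
  rewrite ElinfE combE; case: ltnP => h.
    by rewrite subrr normc0 ltW // /d divr_gt0 // mulr_gt0.
  by rewrite subr0 normc_real small.
apply: (@le_lt_trans _ _ ((`|B| + 1) * d)).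
  apply: (@le_trans _ _ ((`|B| + 1) * supnorm (Elinf - comb E n.*2))).
    by rewrite ler_wpM2r ?supnorm_ge0 // (le_trans (ler_norm B)) // lerDl.
  by rewrite ler_wpM2l // ltW.
have -> : (`|B| + 1) * d = e / 2 by rewrite /d; field; rewrite gt_eqF.
by rewrite ltr_pdivrMr // mulr_natr mulr2n ltrDl.
Qed.

End Mean.

(** If [derE] is inner by [m], then [M u = u 0 - m u] annihilates the range of
the Jacobi operator (apply the equation to [delta 1]), while [m E = 0] and
hence [M E = 1]. *)
Lemma not_phi_amenable :
  (forall e : R, 0 < e -> exists n, `|(P n.*2).[0]| < e) ->
  ~ @phi_amenable R A phi.
Proof.
move=> lim0 /(_ (linf R) lactE ractE bimoduleE).
move=> /(_ (fun a x _ => erefl)) /(_ _ derE_derivation) [m [mlin [K mK]] hm].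
have mlin' (k : R[i]) u v : m (k *: u + v) = k * m u + m v by exact: mlin.
have m0 : m 0 = 0.
  have := mlin' 1 0 0; rewrite scaler0 addr0 mul1r => /eqP.
  by rewrite -subr_eq0 opprD addNKr oppr_eq0 => /eqP.
have mZ (k : R[i]) u : m (k *: u) = k * m u by have := mlin' k u 0; rewrite m0 !addr0.
have mE : m Elinf = 0.
  have ud := (dom_delta hc 0).1.
  have := hm (delta R 0) Elinf ud I; rewrite /derE phi_unit act_unit // mul1r subrr.
  rewrite /lactE phi_unit scale1r (_ : ractE _ _ = 0) ?m0 ?sub0r.
    by move=> /eqP; rewrite eq_sym oppr_eq0 => /eqP.
  apply: linfP => n; rewrite ractEE // /proj_act act_unit // !ElinfE E_at0.
  by rewrite mul1r subrr.
pose M (u : linf R) : R[i] := (u 0%N : R[i]) - m u.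
have : M Elinf = 0.
  apply: M_vanish lim0 => //.
  - by move=> k u v; rewrite /M mlin' linf_lin; ring.
  - exists (1 + K) => u; apply: (le_trans (ler_normcD _ _)).
    by rewrite normc_opp mulrDl mul1r lerD ?supnorm_ub //; exact: mK.
  - move=> u v uv; have dd := (dom_delta hc 1).1.
    have p1 : phi (delta R 1) = 0 by rewrite phi_pair pair_delta /evalP /= hornerX mul0r.
    have aE n : act (delta R 1 : A) u n = (w 1)%:C * v n.
      by rewrite (congr1 (fun h => h n) (act_delta hc 1 u)) trans1 uv.
    have := hm (delta R 1) u dd I; rewrite /derE p1 mul0r subr0 aE.
    rewrite /lactE p1 scale0r m0 subr0.
    have -> : ractE u (delta R 1) = (w 1)%:C *: (- (v 0%N : R[i]) *: Elinf + v).
      apply: linfP => n; rewrite ractEE // /proj_act !aE -[_ *: _]addr0 linf_lin.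
      rewrite linf0 linf_lin ElinfE.
      by rewrite addr0; ring.
    rewrite mZ mlin' mE mulr0 add0r => /mulfI; rewrite (inj_eq (@complexI R) _ 0).
    by move=> /(_ (weight_neq0 hc _)) e; rewrite /M e subrr.
by rewrite /M mE subr0 ElinfE E_at0 => /eqP; rewrite oner_eq0.
Qed.

Lemma not_right_character_amenable_of_lim :
  (forall e : R, 0 < e -> exists n, `|(P n.*2).[0]| < e) ->
  ~ right_character_amenable A /\ ~ amenable A.
Proof.
move=> lim0; split=> [[H _]|H]; apply: (not_phi_amenable lim0).
  exact: H phi_character.
by move=> X la ra hX _; exact: H.
Qed.

End CharacterAtZero.

(** * Point derivations and derivations into the dual *)

Section Derivations.
Variables (R : realType) (c : nat -> R).
Hypothesis hc : szwarc_coefs c.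

Local Notation P := (recurrence_poly c).
Local Notation w := (weight c).
Local Notation A := (l1alg P).
Local Notation mul := (@Defs.mul R A).
Implicit Types (f g h a b : A) (u v : nat -> R[i]).

Lemma wC_neq0 k : (w k)%:C != 0.
Proof. by rewrite (inj_eq (@complexI R) _ 0) (weight_neq0 hc). Qed.

Lemma deriv_rec n :
  P n + 'X * (P n)^`() = (1 - c n) *: (P n.+1)^`() + c n *: (P n.-1)^`().
Proof.
by have /= := congr1 (fun p : {poly R} => p^`()) (mulX_rec hc n); rewrite derivM derivX mul1r derivD !derivZ.
Qed.

Definition dseq (x : R) (n : nat) : R[i] := ((P n)^`().[x])%:C.

(** The derivative of the eigenvalue equation: [dseq x] is a generalized
eigenvector. *)
Lemma jacobi_dseq x : jacobi c (dseq x) = fun k => x%:C * dseq x k + evalP c x k.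
Proof.
apply: funext => k; rewrite /jacobi /dseq /evalP -!rmorphM -!rmorphD /=; congr (_%:C).
have := congr1 (fun p => p.[x]) (deriv_rec k).
by rewrite !hornerE => <-; rewrite addrC.
Qed.

Lemma calc_dseq p x k :
  calc c p (dseq x) k = (p.[x])%:C * dseq x k + (p^`().[x])%:C * evalP c x k.
Proof.
elim/poly_ind: p k => [|p a IH] k; first by rewrite deriv0 calc0 !horner0 !mul0r addr0.
rewrite calcD calcC [p * 'X]mulrC calc_mulX -jacobi_calc.
have -> : calc c p (dseq x) = fun k => (p.[x])%:C * dseq x k
    + ((p^`().[x])%:C * evalP c x k + 0).
  by apply: funext => j; rewrite IH addr0.
rewrite !jacobi_lin {3}/jacobi !mulr0 addr0 jacobi_dseq (jacobi_evalP hc) derivD derivM derivX derivC !hornerE.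
by rewrite !rmorphD !rmorphM /=; ring.
Qed.

(** The derivation rule on [delta m] and [delta n] is the addition formula
[T_m u (n) = P_m(x) u(n) + P_n(x) u(m)]; with [m = 1] it is the recurrence of the
derivatives, so that [u] is a multiple of [dseq x]. *)
Lemma point_derivation_dseq x (D : A -> R[i]) : point_derivation x D ->
  exists z : R[i], (exists B, seq_bounded (fun n => dseq x n * z) B) /\
    forall f, dom f -> D f = pair f (fun n => dseq x n * z).
Proof.
move=> [DF Dmul]; have [u [[B uB] Du Dp]] := functional_pair hc DF.
have dd k := (dom_delta hc k).1.
have F n : fourier P (delta R n) x = evalP c x n * (w n)%:C.
  by rewrite (fourierE hc) pair_delta.
have E m n : trans c m u n = evalP c x m * u n + evalP c x n * u m.
  have := Dmul _ _ (dd m) (dd n).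
  rewrite (Dp _ (mul_dom hc (dd m) (dd n)).1) (pair_mul_delta hc) !F !Du => e.
  apply: (mulfI (wC_neq0 m)); apply: (mulfI (wC_neq0 n)).
  transitivity ((w m * w n)%:C * trans c m u n); first by rewrite rmorphM /=; ring.
  by rewrite e; ring.
have e0 : evalP c x 0 = 1 by rewrite /evalP hornerE.
have u0 : u 0%N = 0.
  have := E 0%N 0%N; rewrite trans0 e0 mul1r => /eqP.
  by rewrite -subr_eq0 opprD addNKr oppr_eq0 => /eqP.
have e1 : evalP c x 1 = x%:C by rewrite /evalP /= hornerX.
have uE n : u n = dseq x n * u 1%N.
  elim/nat_ind2: n => [||n h0 h1].
  - by rewrite u0 /dseq /= derivC horner0 mul0r.
  - by rewrite /dseq /= derivX hornerE mul1r.
  apply: (mulfI (aC_neq0 hc n.+1)).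
  have := E 1%N n.+1; rewrite trans1 /jacobi /= e1 h0 h1 => /eqP.
  rewrite eq_sym -subr_eq => /eqP <-.
  have := congr1 (fun v => v n.+1) (jacobi_dseq x); rewrite {1}/jacobi /= => /eqP.
  rewrite eq_sym -subr_eq => /eqP e; rewrite [RHS]mulrA -e.
  by ring.
have uEE : u = fun n => dseq x n * u 1%N by apply: funext.
exists (u 1%N); rewrite -uEE; split=> //.
by exists B.
Qed.

Lemma point_amenable_of_unbounded :
  (forall x (B : R), exists n, B < `|(P n)^`().[x]|) -> point_amenable P.
Proof.
move=> H [x xd [D /point_derivation_dseq[z [[B zB] DE]] [f fd]]]; apply.
have z0 : z = 0.
  apply/eqP; rewrite -normc_eq0; apply: contraT => nz.
  have zp : 0 < normc z by rewrite lt_def nz normc_ge0.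
  have [n hn] := H x (B / normc z); have := zB n.
  by rewrite normcM normc_real -ler_pdivlMr // leNgt hn.
rewrite DE // /pair (@csum_finite _ _ 0) ?big_ord0 // => k _.
by rewrite z0 !mulr0 mul0r.
Qed.

Lemma not_point_amenable_of_bounded x (B B' : R) : (forall n, `|(P n).[x]| <= B) ->
  (forall n, `|(P n)^`().[x]| <= B') -> ~ point_amenable P.
Proof.
move=> xB dB; apply; exists x.
  by exists B => _ [n _ <-].
have uB : seq_bounded (dseq x) B' by move=> n; rewrite /dseq normc_real.
have eB : seq_bounded (evalP c x) B by move=> n; rewrite /evalP normc_real.
have DF := pair_functional hc uB; have FF := pair_functional hc eB.
have dd k := (dom_delta hc k).1.
exists (fun f => pair f (dseq x)); last first.
  exists (delta R 1); first exact: dd.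
  rewrite pair_delta /dseq /= derivX hornerE mul1r.
  by apply/eqP; exact (wC_neq0 1).
have bf h : dom h -> bounded_functional (fun g : A =>
    pair h (evalP c x) * pair g (dseq x) + pair g (evalP c x) * pair h (dseq x)).
  move=> hd; split=> [k a b ad bd|].
    by rewrite (DF.1 k a b) // (FF.1 k a b) //; ring.
  exists (nrm h * B * B' + nrm h * B' * B) => a ad.
  apply: (le_trans (ler_normcD _ _)); rewrite !normcM mulrDl.
  have h1 := pair_le hc hd eB; have h2 := pair_le hc hd uB.
  have h3 := pair_le hc ad eB; have h4 := pair_le hc ad uB.
  rewrite -[nrm h * B * B' * _]mulrA -[nrm h * B' * B * _]mulrA.
  rewrite [B' * nrm a]mulrC [B * nrm a]mulrC.
  by apply: lerD; [|rewrite [leLHS]mulrC]; apply: ler_pM => //; exact: normc_ge0.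
split=> // f g fd gd; rewrite !(fourierE hc).
apply: (@bilinear_ext _ _ hc (fun f g => pair (mul f g) (dseq x))
  (fun f g => pair f (evalP c x) * pair g (dseq x) + pair g (evalP c x) * pair f (dseq x)))
  => //.
- by move=> h hd; exact: (comp_mul_functionalr hc DF hd).
- by move=> h hd; exact: (comp_mul_functionall hc DF hd).
- move=> h hd; rewrite (_ : (fun f => _) = fun f : A => pair h (evalP c x) *
    pair f (dseq x) + pair f (evalP c x) * pair h (dseq x)); first exact: bf.
  by apply: funext => y; exact: addrC.
move=> m n; rewrite (pair_mul_delta hc) !pair_delta.
rewrite /trans calc_dseq -/(dseq x m) /evalP rmorphM /=; ring.
Qed.

(** The derivation rule on [delta 1] and [delta n] gives the sequences
representing [D (delta n)], divided by [w n], the recurrence of the derivatives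
of the [P n] with the Jacobi operator in place of the variable. *)
Lemma dual_derivation_repr (D : A -> A -> R[i]) :
  @bounded_dual_derivation R A A mul mul D ->
  exists2 u : nat -> R[i], exists B, seq_bounded u B &
    forall n f, dom f -> D (delta R n) f = (w n)%:C * pair f (calc c (P n)^`() u).
Proof.
move=> [D1 D2 D3 D4].
have dd k := (dom_delta hc k).1.
have fl x : dom x -> bounded_functional (D^~ x).
  move=> xd; split=> [k a b ad bd|]; first exact: D2.
  by have [M hM] := D4; exists (M * nrm x) => a ad; rewrite mulrAC hM.
have [y hy] := choice (fun n => functional_pair hc (D1 _ (dd n))).
have [z hz] := choice (fun k => functional_pair hc (fl _ (dd k))).
pose V n k := y n k / (w n)%:C.
have VE n k : D (delta R n) (delta R k) = (w n)%:C * (w k)%:C * V n k.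
  have [_ -> _] := hy n; rewrite /V; field; exact: wC_neq0.
have zE n k : z k n = (w k)%:C * V n k.
  have [_ e _] := hz k; have := VE n k; rewrite e => {}e.
  by apply: (mulIf (wC_neq0 n)); rewrite e; ring.
have yE n k : y n k = (w n)%:C * V n k.
  by rewrite /V mulrC divfK ?wC_neq0.
have rec m n k : trans c m (fun j => V j k) n = trans c k (V n) m + trans c n (V m) k.
  have := D3 _ _ _ (dd m) (dd n) (dd k).
  have [_ _ -> //] := hz k; last by have [] := mul_dom hc (dd m) (dd n).
  have [_ _ -> //] := hy n; last by have [] := mul_dom hc (dd k) (dd m).
  have [_ _ -> //] := hy m; last by have [] := mul_dom hc (dd n) (dd k).
  have -> : z k = fun j => (w k)%:C * V j k by apply: funext => j; exact: zE.
  have -> : y n = fun j => (w n)%:C * V n j by apply: funext => j; exact: yE.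
  have -> : y m = fun j => (w m)%:C * V m j by apply: funext => j; exact: yE.
  rewrite !(pair_mul_delta hc) !(transZ hc) => e.
  apply: (mulfI (wC_neq0 m)); apply: (mulfI (wC_neq0 n)); apply: (mulfI (wC_neq0 k)).
  transitivity ((w m * w n)%:C * ((w k)%:C * trans c m (fun j => V j k) n)).
    by rewrite rmorphM /=; ring.
  by rewrite e !rmorphM /=; ring.
have V0 k : V 0%N k = 0.
  have := rec 0%N 0%N k; rewrite !trans0 (trans_sym hc) trans0 => /eqP.
  by rewrite -subr_eq0 opprD addNKr oppr_eq0 => /eqP.
have Vcalc n : V n = calc c (P n)^`() (V 1%N).
  elim/nat_ind2: n => [||n h0 h1]; apply: funext => k.
  - by rewrite /= derivC calc0 V0.
  - by rewrite /= derivX calc1.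
  apply: (mulfI (aC_neq0 hc n.+1)).
  have := rec 1%N n.+1 k; rewrite trans1 {1}/jacobi /= => /eqP.
  rewrite eq_sym -subr_eq => /eqP <-; rewrite (trans_sym hc k 1) trans1 h0 h1.
  rewrite jacobi_calc -calc_mulX /trans.
  have := congr1 (fun p => calc c p (V 1%N) k) (deriv_rec n.+1).
  rewrite !calcD !calcZ /= => /eqP; rewrite -subr_eq => /eqP <-.
  by ring.
exists (V 1%N).
- have [[B hB] _ _] := hy 1%N; exists (B / w 1) => k.
  rewrite /V normcM normcV normc_real ger0_norm ?(w_ge0 hc) //.
  by rewrite ler_pM2r ?invr_gt0 ?(weight_gt0 hc).
- move=> n f fd; have [[B hB] _ ->//] := hy n.
  rewrite -Vcalc; have vB : seq_bounded (V n) (B / w n).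
    move=> k; rewrite /V normcM normcV normc_real ger0_norm ?(w_ge0 hc) //.
    by rewrite ler_pM2r ?invr_gt0 ?(weight_gt0 hc).
  rewrite -(pair_scale hc _ fd vB); congr (pair f); apply: funext => k.
  exact: yE.
Qed.

Lemma weakly_amenable_of_vanish :
  (forall (u : nat -> R[i]) (D : A -> A -> R[i]),
    @bounded_dual_derivation R A A mul mul D ->
    (exists B, seq_bounded u B) ->
    (forall n f, dom f -> D (delta R n) f = (w n)%:C * pair f (calc c (P n)^`() u)) ->
    forall k, u k = 0) ->
  weakly_amenable A.
Proof.
move=> H D DD; have [u uB Du] := dual_derivation_repr DD.
have [_ D2 _ D4] := DD.
have fl x : dom x -> bounded_functional (D^~ x).
  move=> xd; split=> [k a b ad bd|]; first exact: D2.
  by have [M hM] := D4; exists (M * nrm x) => a ad; rewrite mulrAC hM.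
have u0 := H u D DD uB Du.
exists (fun=> 0); first by split=> [k x y _ _|]; rewrite ?mulr0 ?addr0 //; exists 0 => x _; rewrite normc0 mul0r.
move=> a x ad xd; rewrite subr0.
apply: (functional_zero hc (fl x xd)) => // k; rewrite Du //.
rewrite /pair (@csum_finite _ _ 0) ?big_ord0 ?mulr0 // => j _.
rewrite [calc _ _ _ j](_ : _ = 0) ?mulr0 ?mul0r //.
have -> : u = fun=> 0 by apply: funext => i; exact: u0.
rewrite /calc big1 // => i _; rewrite [iter _ _ _](_ : _ = fun=> 0) ?mulr0 //.
elim: (i : nat) => //= m ->; apply: funext => l; by rewrite /jacobi !mulr0 addr0.
Qed.

(** The derivation is [D(f)(g) = phi(f' g)], where [phi] is a functional on
polynomials; the hypothesis says that it is bounded. *)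
Lemma not_weakly_amenable_of_bounded (phi : nat -> R[i]) (B : R) :
  (forall n, seq_bounded (calc c (P n)^`() phi) B) -> phi 0%N <> 0 ->
  ~ weakly_amenable A.
Proof.
move=> VB phi0 wa.
pose V n := calc c (P n)^`() phi.
have dd k := (dom_delta hc k).1.
pose D (f g : A) : R[i] := pair f (fun n => pair g (V n)).
have B0 : 0 <= B by exact: le_trans (normc_ge0 _) (VB 0%N 0%N).
have gB g : dom g -> seq_bounded (fun n => pair g (V n)) (nrm g * B).
  by move=> gd n; exact: pair_le (VB n).
have D1 f : dom f -> bounded_functional (D f).
  move=> fd; split=> [k a b ad bd|].
    rewrite /D -(pair_linr hc k fd (gB a ad) (gB b bd)); congr (pair f).
    by apply: funext => n; exact: (pair_linl hc k ad bd (VB n)).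
  exists (nrm f * B) => a ad; rewrite -mulrA [B * _]mulrC.
  exact: pair_le (gB a ad).
have D1' g : dom g -> bounded_functional (D^~ g).
  by move=> gd; exact (pair_functional hc (gB g gd)).
have Dmul a b x : dom a -> dom b -> dom x ->
    D (mul a b) x = D b (mul x a) + D a (mul b x).
  have split2 (F G : A -> R[i]) : bounded_functional F -> bounded_functional G ->
      bounded_functional (fun x => F x + G x).
    move=> [FF [M FM]] [GG [M' GM]]; split=> [k y z yd zd|].
      by rewrite FF // GG //; ring.
    exists (M + M') => y yd; apply: (le_trans (ler_normcD _ _)).
    by rewrite mulrDl lerD ?FM ?GM.
  move=> ad bd xd.
  apply: (@functional_ext _ _ hc (fun x => D (mul a b) x)
    (fun x => D b (mul x a) + D a (mul b x))) => //.
  - by apply: D1; have [] := mul_dom hc ad bd.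
  - apply: split2; first exact: (comp_mul_functionall hc (D1 b bd) ad).
    exact: (comp_mul_functionalr hc (D1 a ad) bd).
  move=> k; have kd := dd k.
  apply: (@bilinear_ext _ _ hc (fun a b => D (mul a b) (delta R k))
    (fun a b => D b (mul (delta R k) a) + D a (mul b (delta R k)))) => //.
  - by move=> h hd; exact: (comp_mul_functionalr hc (D1' _ kd) hd).
  - by move=> h hd; exact: (comp_mul_functionall hc (D1' _ kd) hd).
  - move=> h hd; apply: split2.
      by apply: D1'; have [] := mul_dom hc kd hd.
    exact: (comp_mul_functionall hc (D1 h hd) kd).
  - move=> h hd; apply: split2.
      exact: (comp_mul_functionalr hc (D1 h hd) kd).
    by apply: D1'; have [] := mul_dom hc hd kd.
  move=> m n; rewrite /D !pair_delta !(pair_mul_delta hc).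
  have -> : (fun j => pair (delta R k : A) (V j)) = fun j => (w k)%:C * V j k.
    by apply: funext => j; rewrite pair_delta mulrC.
  rewrite (transZ hc).
  have -> : trans c m (fun j => V j k) n = trans c k (V n) m + trans c n (V m) k.
    have e1 p i j : trans c i (calc c p phi) j = psi c phi (p * P i * P j).
      rewrite -(psiM hc) /psi -!calcM; congr (calc _ _ _ _).
      by rewrite mulrC mulrA.
    rewrite /V !e1 (transE hc _ (ltnSn (m + n))).
    transitivity (psi c phi ((P m * P n)^`() * P k)).
      rewrite (lin_poly hc (ltnSn (m + n))) linear_sum mulr_suml /psi calc_sum.
      apply: eq_bigr => j _; rewrite linearZ /= -scalerAl calcZ; congr (_ * _).
      by rewrite -[LHS](trans_at0 hc) /trans -calcM mulrC.
    rewrite derivM /psi -calcD; congr (calc _ _ _ _).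
    by ring.
  by rewrite !rmorphM /=; ring.
have DD : @bounded_dual_derivation R A A mul mul D.
  split=> //.
  - by move=> k a b x ad bd xd; exact: (D1' x xd).1.
  - exists B => a x ad xd; rewrite -mulrA mulrCA [B * _]mulrC.
    exact: pair_le (gB x xd).
have [F [FF _] hF] := wa D DD; apply: phi0.
have := hF (delta R 1) (delta R 0) (dd 1%N) (dd 0%N).
rewrite (mul_comm hc (dd 0%N) (dd 1%N)) subrr /D !pair_delta /V /= derivX calc1.
rewrite mulr1 => /eqP; rewrite mulf_eq0 (negbTE (wC_neq0 1)) orbF => /eqP.
by [].
Qed.

End Derivations.

(** * The Pollaczek coefficients *)

Section Decay.
Variable R : realType.

(** Oresme's grouping: the terms from [n] to [2n + M] contribute at least
[1/2]. *)
Lemma harmonic_unbounded (m : R) (hm : 0 < m) (B : R) :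
  exists n : nat, B <= \sum_(k < n) (k%:R + m)^-1.
Proof.
pose S n := \sum_(k < n) ((k%:R : R) + m)^-1.
have H (j : nat) : exists n : nat, j%:R / 2 <= S n.
  elim: j => [|j [n IH]]; first by exists 0%N; rewrite /S big_ord0 mul0r.
  pose M := (Num.trunc m).+1.
  have mM : m <= M%:R by rewrite ltW // /M truncnS_gt.
  exists (n + (n + M))%N; rewrite /S -(big_mkord xpredT (fun k => ((k%:R : R) + m)^-1)).
  rewrite (@big_cat_nat _ _ _ n) ?leq_addr //= big_mkord -natr1 mulrDl lerD //.
  apply: (@le_trans _ _ (\sum_(n <= i < n + (n + M)) ((2 * (n + M)%:R)^-1 : R))).
    rewrite sumr_const_nat addKn -[leRHS]mulr_natl invfM mulrCA divff ?mulr1 ?div1r //.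
    by rewrite pnatr_eq0 addnS.
  apply: ler_sum_nat => i /andP[h1 h2].
  rewrite lef_pV2 ?posrE; last 2 first.
  - by rewrite mulr_gt0 // ltr0n addnS.
  - by rewrite ltr_wpDl.
  have : (i%:R : R) <= (n + (n + M))%:R by rewrite ler_nat ltnW.
  by rewrite !natrD; move: mM; lra.
have [n hn] := H (Num.trunc (2 * `|B|)).+1.
exists n; apply: le_trans hn.
rewrite ler_pdivlMr // mulrC; apply: le_trans (ltW (truncnS_gt _)).
by rewrite ler_pM2l // ler_norm.
Qed.

(** The product of [x n] and [1 + ka (1/m + ... + 1/(m + n - 1))] does not
increase, since [(1 - y)(1 + s + y) <= 1 + s] for [s, y >= 0]. *)
Lemma decay_to_0 (x : nat -> R) (ka m : R) : 0 < ka -> 0 < m ->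
  (forall n, 0 <= x n) ->
  (forall n, x n.+1 <= x n * (1 - ka / (n%:R + m))) ->
  forall e, 0 < e -> exists n0, forall n, (n0 <= n)%N -> x n < e.
Proof.
move=> k0 m0 x0 hx e e0.
have nm n : 0 < n%:R + m :> R by rewrite ltr_wpDl.
have H n : x n * (1 + ka * \sum_(k < n) (k%:R + m)^-1) <= x 0%N.
  elim: n => [|n IH]; first by rewrite big_ord0 mulr0 addr0 mulr1.
  rewrite big_ord_recr /=; set S := \sum_(k < n) _ in IH *.
  have S0 : 0 <= S by apply: sumr_ge0 => i _; rewrite invr_ge0 ltW.
  have y0 : 0 <= ka / (n%:R + m) by rewrite divr_ge0 // ltW.
  apply: le_trans IH; set y := ka / _ in y0 *.
  have -> : 1 + ka * (S + (n%:R + m)^-1) = 1 + ka * S + y by rewrite /y; ring.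
  have kS : 0 <= ka * S by rewrite mulr_ge0 // ltW.
  apply: (@le_trans _ _ (x n * (1 - y) * (1 + ka * S + y))).
    by rewrite ler_wpM2r ?hx //; lra.
  rewrite -mulrA ler_wpM2l //.
  have -> : (1 - y) * (1 + ka * S + y) = 1 + ka * S - y * (ka * S) - y * y by ring.
  have : 0 <= y * (ka * S) by rewrite mulr_ge0.
  have : 0 <= y * y by rewrite mulr_ge0.
  by lra.
have anti n : x n.+1 <= x n.
  apply: le_trans (hx n) _; rewrite ler_piMr // lerBlDr lerDl divr_ge0 // ltW //.
have [n hn] := harmonic_unbounded m0 (x 0%N / e / ka).
exists n => k nk; apply: (@le_lt_trans _ _ (x n)).
  move: nk => /subnKC <-; elim: (k - n)%N => [|j IH]; first by rewrite addn0.
  by rewrite addnS (le_trans (anti _)).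
have := H n; rewrite -ler_pdivlMr; last first.
  by rewrite ltr_pwDl // mulr_ge0 ?(ltW k0) // sumr_ge0 // => i _; rewrite invr_ge0 ltW.
move=> h; apply: (le_lt_trans h).
rewrite ltr_pdivrMr; last first.
  by rewrite ltr_pwDl // mulr_ge0 ?(ltW k0) // sumr_ge0 // => i _; rewrite invr_ge0 ltW.
rewrite mulrDr mulr1 ltr_pwDl //.
by rewrite mulrA mulrC -ler_pdivrMr ?mulr_gt0 // invfM mulrA.
Qed.

End Decay.

Section PollaczekCoefs.
Variables (R : realType) (al la nu : R).
Hypothesis hal : - (1 / 2) < al.
Hypothesis hla : 0 <= la.
Hypothesis hnu : 0 <= nu.

Local Notation c := (pollaczek_c al la nu).
Local Notation L := (fun n => laguerre (2 * al) nu n (- 2 * la)).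
Local Notation N n := (n%:R + nu).
Local Notation sg n := (2 * N n + 2 * al + 2 * la + 1).

Lemma N_ge0 n : 0 <= N n.
Proof. by rewrite addr_ge0. Qed.

Lemma sg_gt0 n : 0 < sg n.
Proof. by have := N_ge0 n; move: hal hla; lra. Qed.

Lemma NS n : N n.+1 = N n + 1.
Proof. by rewrite -natr1; ring. Qed.

Lemma laguerre1 : (nu + 1) * L 1 = 2 * la + 2 * nu + 2 * al + 1.
Proof. by rewrite /= mulrC divfK ?gt_eqF ?ltr_wpDl //; ring. Qed.

Lemma laguerreS n : (N n + 2) * L n.+2 =
  (2 * la + 2 * N n + 2 * al + 3) * L n.+1 - (N n + 1 + 2 * al) * L n.
Proof.
have h : n.+1%:R + nu + 1 != 0 :> R by rewrite gt_eqF // ltr_wpDl // addr_ge0.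
have -> : N n + 2 = n.+1%:R + nu + 1 by rewrite -natr1; ring.
rewrite /= mulrC divfK // -natr1.
by ring.
Qed.

(** For [la = 0] the recurrence would preserve equality in the second statement;
a positive [la] only increases the right-hand side. *)
Lemma laguerre_growth n : 0 < L n /\ (N n + 1 + 2 * al) * L n <= (N n + 1) * L n.+1.
Proof.
move: (hal) (hla) (hnu) => al0 la0 nu0.
elim: n => [|n [h1 h2]].
  split; first by rewrite /= ltr01.
  rewrite !add0r laguerre1 /=; lra.
have Np := N_ge0 n.
have a0 : 0 < N n + 1 + 2 * al by lra.
have p1 : 0 < L n.+1.
  rewrite -(pmulr_rgt0 _ (_ : 0 < N n + 1)); last by lra.
  by apply: lt_le_trans h2; rewrite mulr_gt0.
split=> //; rewrite NS (_ : N n + 1 + 1 = N n + 2); last by ring.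
rewrite laguerreS.
have : 0 <= la * L n.+1 by rewrite mulr_ge0 // ltW.
by move: h2; nra.
Qed.

Lemma pollaczek_cS n : c n.+1 =
  (N n + 1 + 2 * al) / (2 * N n + 2 * al + 2 * la + 3) * (L n / L n.+1).
Proof.
rewrite /pollaczek_c -natr1; congr (_ / _ * _); ring.
Qed.

Lemma c_rec n : c n.+1 * (1 - c n) =
  (N n + 1) * (N n + 1 + 2 * al) /
  ((2 * N n + 2 * al + 2 * la + 3) * (2 * N n + 2 * al + 2 * la + 1)).
Proof.
move: (hal) (hla) (hnu) => al0 la0 nu0.
have Lp k : L k != 0 by rewrite gt_eqF //; exact: (laguerre_growth k).1.
have s0 k : 2 * N k + 2 * al + 2 * la + 1 != 0 by rewrite gt_eqF ?sg_gt0.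
have s1 k : 2 * N k + 2 * al + 2 * la + 3 != 0.
  by rewrite gt_eqF //; have := sg_gt0 k; lra.
rewrite pollaczek_cS; case: n => [|n].
  rewrite [c 0]/= subr0 mulr1 add0r; have := Lp 1%N; have := laguerre1.
  rewrite [L 0]/=; set l := L 1 => e l0.
  have d0 : 2 * nu + 2 * al + 2 * la + 1 != 0 by have := s0 0%N; rewrite add0r.
  have n1 : nu + 1 != 0 by rewrite gt_eqF // ltr_wpDl.
  have -> : l = (2 * nu + 2 * al + 2 * la + 1) / (nu + 1).
    by apply: (mulfI n1); rewrite e; field.
  by field; rewrite d0 n1 /= andbT; have := s1 0%N; rewrite add0r.
rewrite pollaczek_cS NS.
have e := laguerreS n; have := Lp n.+2; have := Lp n.+1; have := Lp n.
have n2 : N n + 2 != 0 by rewrite gt_eqF //; have := N_ge0 n; lra.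
have s2 : 2 * N n + 2 * al + 2 * la + 5 != 0.
  by rewrite gt_eqF //; have := sg_gt0 n; lra.
have := s0 n; have := s1 n; move: n2 s2.
move: e; set l0 := L n; set l1 := L n.+1; set l2 := L n.+2; set m := N n.
move=> e n2 s2 m1 m0 p0 p1 p2.
have Q : (2 * m + 2 * al + 2 * la + 3) * l1 - (m + 1 + 2 * al) * l0 != 0.
  have -> : (2 * m + 2 * al + 2 * la + 3) * l1 - (m + 1 + 2 * al) * l0 = (m + 2) * l2.
    by rewrite e; ring.
  by rewrite mulf_neq0.
have -> : l2 = ((2 * m + 2 * al + 2 * la + 3) * l1 - (m + 1 + 2 * al) * l0) / (m + 2).
  by apply: (mulfI n2); rewrite e; field.
have e1 : 2 * (m + 1) + 2 * al + 2 * la + 1 = 2 * m + 2 * al + 2 * la + 3 by ring.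
have e2 : 2 * (m + 1) + 2 * al + 2 * la + 3 = 2 * m + 2 * al + 2 * la + 5 by ring.
by field; rewrite e1 e2 m1 s2 p1 n2 Q.
Qed.

(** In the ultraspherical case [c n] is [N n / sg n]; in general it is smaller by
the factor [1 - t] with the defect [t].  The recurrence of [c] becomes a first
order recurrence for [t] with positive terms ([defectS]), from which bounds and
monotonicity can be read off. *)
Definition defect n : R := 1 - c n.+1 * sg n.+1 / N n.+1.

Lemma NS_gt0 n : 0 < N n.+1.
Proof. by rewrite ltr_pwDl // ltr0n. Qed.

Lemma c_defect n : c n.+1 = N n.+1 / sg n.+1 * (1 - defect n).
Proof.
rewrite /defect; have := sg_gt0 n.+1; have := NS_gt0 n; set M := N n.+1 => M0 s0.
by field; rewrite !gt_eqF.
Qed.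

Lemma c1E : c 1 = (1 + nu) * (1 + nu + 2 * al) /
  ((2 * nu + 2 * al + 2 * la + 3) * (2 * nu + 2 * al + 2 * la + 1)).
Proof.
by have := c_rec 0; rewrite [c 0]/= subr0 mulr1 !add0r => ->; rewrite [nu + 1]addrC.
Qed.

Lemma defect0 : defect 0 = (nu + 2 * la) / (1 + 2 * nu + 2 * al + 2 * la).
Proof.
move: (hal) (hla) (hnu) => al0 la0 nu0.
rewrite /defect c1E; field.
by rewrite !gt_eqF //; lra.
Qed.

Lemma defectS n : 0 <= defect n ->
  defect n.+1 = (2 * la + N n.+1 * defect n) /
    (N n.+1 + 1 + 2 * al + 2 * la + N n.+1 * defect n).
Proof.
move: (hal) (hla) (hnu) => al0 la0 nu0 t0.
have M0 := NS_gt0 n; have := c_rec n.+1; rewrite (c_defect n).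
have Mt : 0 <= N n.+1 * defect n by rewrite mulr_ge0 // ltW.
rewrite [defect n.+1]/defect [N n.+2]NS.
move: t0 Mt M0; set t := defect n; set M := N n.+1; set C := c n.+2 => t0 Mt M0 e.
have D0 : 0 < M + 1 + 2 * al + 2 * la + M * t by lra.
have S0 : 0 < 2 * M + 2 * al + 2 * la + 1 by lra.
have S1 : 0 < 2 * M + 2 * al + 2 * la + 3 by lra.
have M1 : 0 < M + 1 by lra.
have a1 : 1 - M / (2 * M + 2 * al + 2 * la + 1) * (1 - t) =
   (M + 1 + 2 * al + 2 * la + M * t) / (2 * M + 2 * al + 2 * la + 1).
  by field; rewrite gt_eqF.
have -> : C = (M + 1) * (M + 1 + 2 * al) /
   ((2 * M + 2 * al + 2 * la + 3) * (M + 1 + 2 * al + 2 * la + M * t)).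
  have a2 : (M + 1 + 2 * al + 2 * la + M * t) / (2 * M + 2 * al + 2 * la + 1) != 0.
    by rewrite mulf_neq0 ?invr_neq0 ?gt_eqF.
  apply: (mulIf a2); rewrite -a1 e a1; field.
  by rewrite !gt_eqF.
field.
by rewrite !gt_eqF //; lra.
Qed.

(** The last inequality is the condition under which [defectS] makes the defect
decrease; it passes to the next index because the defect decreases and [N n]
increases. *)
Lemma defect_inv n : [/\ 0 <= defect n, defect n <= 1 &
  2 * la * (1 - defect n) <= defect n * (1 + 2 * al + N n.+1 * defect n)].
Proof.
move: (hal) (hla) (hnu) => al0 la0 nu0.
elim: n => [|n [t0 t1 tF]].
  rewrite defect0; set D := 1 + 2 * nu + 2 * al + 2 * la.
  have D0 : 0 < D by rewrite /D; lra.
  split; first by rewrite divr_ge0 //; lra.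
    by rewrite ler_pdivrMr // mul1r /D; lra.
  rewrite -(ler_pM2r (_ : 0 < D * D)); last by rewrite mulr_gt0.
  have -> : 2 * la * (1 - (nu + 2 * la) / D) * (D * D) =
    2 * la * (1 + nu + 2 * al) * D by rewrite /D; field; rewrite gt_eqF.
  have -> : (nu + 2 * la) / D * (1 + 2 * al + (1%:R + nu) * ((nu + 2 * la) / D)) * (D * D)
    = (nu + 2 * la) * ((1 + 2 * al) * D + (1 + nu) * (nu + 2 * la)).
    by field; rewrite gt_eqF.
  rewrite -subr_ge0 /D.
  set a := 1 + 2 * al; have -> : 2 * al = a - 1 by rewrite /a; ring.
  have a0 : 0 < a by rewrite /a; lra.
  have -> : (nu + 2 * la) * (a * (1 + 2 * nu + (a - 1) + 2 * la) + (1 + nu) * (nu + 2 * la))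
    - 2 * la * (1 + nu + (a - 1)) * (1 + 2 * nu + (a - 1) + 2 * la)
    = nu * a ^+ 2 + 2 * nu ^+ 2 * a + (nu + 2 * la) ^+ 2 + nu ^+ 3 by ring.
  have h1 : 0 <= nu * a ^+ 2 by rewrite mulr_ge0 // sqr_ge0.
  have h2 : 0 <= 2 * nu ^+ 2 * a by rewrite !mulr_ge0 // ?sqr_ge0 // ltW.
  have h3 : 0 <= nu ^+ 3 by rewrite exprn_ge0.
  by have := sqr_ge0 (nu + 2 * la); lra.
have M0 := NS_gt0 n; rewrite (defectS t0) [N n.+2]NS.
move: M0 t0 t1 tF; set t := defect n; set M := N n.+1 => M0 t0 t1 tF.
have Mt : 0 <= M * t by rewrite mulr_ge0 // ltW.
have D0 : 0 < M + 1 + 2 * al + 2 * la + M * t by lra.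
set t' := _ / _.
have e : t' * (M + 1 + 2 * al + 2 * la + M * t) = 2 * la + M * t.
  by rewrite /t' divfK // gt_eqF.
have t'0 : 0 <= t' by rewrite divr_ge0 //; lra.
have t'1 : t' <= 1 by rewrite ler_pdivrMr // mul1r; lra.
have t't : t' <= t by rewrite ler_pdivrMr //; nra.
split=> //.
have : (1 - t') * (2 * la + M * t') <= (1 - t') * (2 * la + M * t).
  by rewrite ler_wpM2l; [|lra|rewrite lerD2l ler_wpM2l // ltW].
have : 0 <= t' * t' by rewrite mulr_ge0.
by nra.
Qed.

Lemma defect_le n : defect n.+1 <= defect n.
Proof.
move: (hal) (hla) (hnu) => al0 la0 nu0.
have [t0 t1 tF] := defect_inv n.
have M0 := NS_gt0 n; rewrite (defectS t0).
move: M0 t0 t1 tF; set t := defect n; set M := N n.+1 => M0 t0 t1 tF.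
have Mt : 0 <= M * t by rewrite mulr_ge0 // ltW.
by rewrite ler_pdivrMr; nra.
Qed.

Lemma c_gt0 n : 0 < c n.+1.
Proof.
move: (hal) (hla) (hnu) => al0 la0 nu0.
have e := c_rec n; have L0 k := (laguerre_growth k).1.
rewrite pollaczek_cS mulr_gt0 ?divr_gt0 //; have := N_ge0 n; lra.
Qed.

Lemma c_le_base n : c n <= N n / sg n.
Proof.
case: n => [|n]; first by rewrite divr_ge0 ?N_ge0 ?ltW ?sg_gt0.
rewrite c_defect ler_piMr //; last by have [] := defect_inv n; lra.
by rewrite divr_ge0 ?N_ge0 ?ltW ?sg_gt0.
Qed.

Lemma pollaczek_szwarc : szwarc_coefs c.
Proof.
move: (hal) (hla) (hnu) => al0 la0 nu0.
split=> [|||n] //; first exact: c_gt0.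
  move=> n; apply: le_trans (c_le_base n) _; rewrite ler_pdivrMr ?sg_gt0 //.
  by lra.
case: n => [|n]; first exact/ltW/c_gt0.
rewrite !c_defect; have [t0 t1 _] := defect_inv n; have [t'0 t'1 _] := defect_inv n.+1.
have d := defect_le n; have M0 := NS_gt0 n.
have h1 := sg_gt0 n.+1; have h2 := sg_gt0 n.+2.
apply: ler_pM; [by rewrite divr_ge0 ?ltW|lra| |lra].
rewrite ler_pdivrMr // mulrAC ler_pdivlMr // [N n.+2]NS.
by nra.
Qed.

Lemma c_le_half_gap n : c n <= N n / (2 * N n + 2 * al + 1).
Proof.
move: (hal) (hla) => al0 la0.
apply: le_trans (c_le_base n) _; rewrite ler_wpM2l ?N_ge0 //.
by have h := N_ge0 n; rewrite lef_pV2 ?posrE; lra.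
Qed.

Local Notation P := (pollaczek al la nu).

(** [|P_(2n+2)(0) / P_(2n)(0)| = c_(2n+1) / a_(2n+1)], which is at most
[1 - k/(n + m)] with [k = al + 1/2 > 0]. *)
Lemma P_even_at0_to0 e : 0 < e -> exists n, `|(P n.*2).[0]| < e.
Proof.
move: (hal) (hla) (hnu) => al0 la0 nu0 e0.
have hc := pollaczek_szwarc.
have k0 : 0 < (2 * al + 1) / 2 by lra.
have m0 : 0 < (nu + 2 * al + 2) / 2 by lra.
have x0 n : 0 <= `|(P n.*2).[0]| by [].
have xS n : `|(P n.+1.*2).[0]| <= `|(P n.*2).[0]| *
    (1 - (2 * al + 1) / 2 / (n%:R + (nu + 2 * al + 2) / 2)).
  have := P_at0_abs hc n.*2; have a0 := a_gt0 hc n.*2.+1.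
  rewrite -doubleS -/(P n.+1.*2) -/(P n.*2).
  set p := `|_|; set q := `|_| => E.
  have := c_le_half_gap n.*2.+1; have := N_ge0 n.*2.+1.
  have -> : n.*2.+1%:R = 2 * n%:R + 1 :> R by rewrite -natr1 -muln2 natrM; ring.
  have n0 : 0 <= n%:R :> R by [].
  set m : R := n%:R in n0 *; move=> N0 cl.
  have D0 : 0 < 2 * m + 2 + nu + 2 * al by lra.
  have -> : 1 - (2 * al + 1) / 2 / (m + (nu + 2 * al + 2) / 2) =
     (2 * m + 1 + nu) / (2 * m + 2 + nu + 2 * al).
    by field; rewrite !gt_eqF //; lra.
  rewrite mulrA ler_pdivlMr //.
  move: cl; rewrite ler_pdivlMr; last by lra.
  move=> cl; rewrite -(ler_pM2l a0) mulrA E.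
  have q0 : 0 <= q by exact: normr_ge0.
  have : c n.*2.+1 * (2 * m + 2 + nu + 2 * al) <= (1 - c n.*2.+1) * (2 * m + 1 + nu).
    by lra.
  move=> /(ler_wpM2r q0); lra.
have [n0 h] := decay_to_0 k0 m0 x0 xS e0.
by exists n0; exact: h.
Qed.

End PollaczekCoefs.

(** * Growth of the derivatives of the polynomials *)

Section DerivativeGrowth.
Variables (R : realType) (c : nat -> R).
Hypothesis hc : szwarc_coefs c.

Local Notation P := (recurrence_poly c).
Local Notation w := (weight c).
Local Notation p x n := ((P n).[x]).
Local Notation d x n := ((P n)^`().[x]).

Lemma p_rec x n : x * p x n = (1 - c n) * p x n.+1 + c n * p x n.-1.
Proof. by have := congr1 (fun q : {poly R} => q.[x]) (mulX_rec hc n); rewrite !hornerE. Qed.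

Lemma d_rec x n : p x n + x * d x n = (1 - c n) * d x n.+1 + c n * d x n.-1.
Proof. by have := congr1 (fun q : {poly R} => q.[x]) (deriv_rec hc n); rewrite !hornerE. Qed.

Lemma p_recS x n :
  x * p x n.+1 = (1 - c n.+1) * p x n.+2 + c n.+1 * p x n.
Proof. exact: p_rec. Qed.

Lemma d_recS x n :
  p x n.+1 + x * d x n.+1 = (1 - c n.+1) * d x n.+2 + c n.+1 * d x n.
Proof. exact: d_rec. Qed.

Lemma p0 x : p x 0 = 1. Proof. by rewrite hornerE. Qed.
Lemma p1 x : p x 1 = x. Proof. by rewrite hornerX. Qed.
Lemma d0 x : d x 0 = 0. Proof. by rewrite /= derivC horner0. Qed.
Lemma d1 x : d x 1 = 1. Proof. by rewrite /= derivX hornerE. Qed.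

Arguments recurrence_poly : simpl never.
Arguments weight : simpl never.

(** Needed to reduce [x <= -1] to [x >= 1]. *)
Lemma parity x n : p (- x) n = (-1) ^+ n * p x n /\ d (- x) n = - ((-1) ^+ n * d x n).
Proof.
elim/nat_ind2: n => [||n [h0 h1] [h2 h3]].
- by rewrite !p0 !d0 expr0 mulr1 mulr0 oppr0.
- by rewrite !p1 !d1 expr1 !mulN1r opprK.
have a0 := a_neq0 hc n.+1.
split; apply: (mulfI a0).
  have e1 := p_recS (- x) n; have e2 := p_recS x n.
  rewrite h0 h2 in e1.
  have e3 : (1 - c n.+1) * p x n.+2 = x * p x n.+1 - c n.+1 * p x n by rewrite e2; ring.
  have -> : (1 - c n.+1) * p (- x) n.+2 =
    - x * ((-1) ^+ n.+1 * p x n.+1) - c n.+1 * ((-1) ^+ n * p x n) by rewrite e1; ring.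
  transitivity ((-1) ^+ n.+2 * ((1 - c n.+1) * p x n.+2)); last by ring.
  by rewrite e3 !exprS; ring.
have e1 := d_recS (- x) n; have e2 := d_recS x n.
rewrite h1 h2 h3 in e1.
have e3 : (1 - c n.+1) * d x n.+2 = p x n.+1 + x * d x n.+1 - c n.+1 * d x n.
  by rewrite e2; ring.
have -> : (1 - c n.+1) * d (- x) n.+2 = (-1) ^+ n.+1 * p x n.+1
   - x * - ((-1) ^+ n.+1 * d x n.+1) - c n.+1 * - ((-1) ^+ n * d x n).
  by apply: (addIr (c n.+1 * - ((-1) ^+ n * d x n))); rewrite -e1; ring.
transitivity (- ((-1) ^+ n.+2 * ((1 - c n.+1) * d x n.+2))); last by ring.
by rewrite e3 !exprS; ring.
Qed.

Lemma abs_d_opp x n : `|d (- x) n| = `|d x n|.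
Proof. by rewrite (parity x n).2 normrN normrM normrX normrN1 expr1n mul1r. Qed.

Lemma growth_at_ge1 x n : 1 <= x ->
  [/\ 1 <= p x n, p x n <= p x n.+1, 0 <= d x n & d x n + 1 <= d x n.+1].
Proof.
move=> x1; elim: n => [|n [h1 h2 h3 h4]].
  by rewrite p0 p1 d0 d1 add0r.
have a0 := a_gt0 hc n.+1; have c0 := c_ge0 hc n.+1.
have h1' : 1 <= p x n.+1 by lra.
have h3' : 0 <= d x n.+1 by lra.
have e1 := p_recS x n; have e2 := d_recS x n.
split=> //.
  rewrite -(ler_pM2l a0).
  have : 0 <= (x - 1) * p x n.+1 by rewrite mulr_ge0; lra.
  have : 0 <= c n.+1 * (p x n.+1 - p x n) by rewrite mulr_ge0; lra.
  by lra.
have : 0 <= (x - 1) * d x n.+1 by rewrite mulr_ge0; lra.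
have : 0 <= c n.+1 * (d x n.+1 - d x n) by rewrite mulr_ge0; lra.
by move=> g1 g2; rewrite -(ler_pM2l a0); lra.
Qed.

Lemma d_ge_n x n : 1 <= x -> n%:R <= d x n.
Proof.
move=> x1; elim: n => [|n IH]; first by rewrite d0.
by have [_ _ _ h] := growth_at_ge1 n x1; rewrite -natr1; lra.
Qed.

Lemma unbounded_outside x (B : R) : 1 <= `|x| -> exists n, B < `|d x n|.
Proof.
move=> x1; exists (Num.trunc `|B|).+1.
have -> : `|d x (Num.trunc `|B|).+1| = `|d `|x| (Num.trunc `|B|).+1|.
  by case: (ger0P x) => // _; rewrite abs_d_opp.
apply: (le_lt_trans (ler_norm B)); apply: (lt_le_trans (truncnS_gt _)).
exact: le_trans (d_ge_n _ x1) (ler_norm _).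
Qed.

Lemma weight_le n : w n <= w n.+1.
Proof.
have := weightS hc n; have := weight_gt0 hc n; have := weight_gt0 hc n.+1.
have := szwarc_gt0 hc n; have := szwarc_le_half hc n; have := szwarc_le_half hc n.+1.
by move=> h1 h2 h3 h4 h5 e; rewrite -(ler_pM2l h3) e; nra.
Qed.

(** The confluent case of the Christoffel-Darboux formula. *)
Lemma christoffel_darboux x n : \sum_(k < n.+1) w k * p x k ^+ 2 =
  w n * (1 - c n) * (d x n.+1 * p x n - d x n * p x n.+1).
Proof.
elim: n => [|n IH].
  rewrite big_ord_recr big_ord0 /= p0 p1 d0 d1 (szwarc0 hc) /weight.
  by ring.
rewrite big_ord_recr /= IH.
have e1 := p_recS x n; have e2 := d_recS x n; have e3 := weightS hc n.
have e1' : (1 - c n.+1) * p x n.+2 = x * p x n.+1 - c n.+1 * p x n by rewrite e1; ring.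
have e2' : (1 - c n.+1) * d x n.+2 = p x n.+1 + x * d x n.+1 - c n.+1 * d x n.
  by rewrite e2; ring.
transitivity (w n.+1 * ((1 - c n.+1) * d x n.+2 * p x n.+1
   - d x n.+1 * ((1 - c n.+1) * p x n.+2))); last by ring.
rewrite e1' e2'.
transitivity (c n.+1 * w n.+1 * (d x n.+1 * p x n - d x n * p x n.+1)
  + w n.+1 * p x n.+1 ^+ 2); last by ring.
by rewrite e3; ring.
Qed.

Section Interior.
Hypothesis lam_anti : forall n, c n.+2 * (1 - c n.+1) <= c n.+1 * (1 - c n).
Hypothesis lam_ge : forall n, 1 / 4 <= c n.+1 * (1 - c n).
Variable x : R.
Hypothesis x1 : `|x| < 1.

Local Notation lam n := (c n.+1 * (1 - c n)).

(** The quadratic form that is constant in [n] when [lam n] is: the discrete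
analogue of the energy of an oscillation. *)
Definition energy n : R := w n.+1 * (lam n * p x n.+1 ^+ 2
  + (c n.+1 * p x n) ^+ 2 - x * p x n.+1 * (c n.+1 * p x n)).

Lemma x2_lt1 : x ^+ 2 < 1.
Proof. by rewrite -real_normK ?num_real // exprn_ilt1 ?x1. Qed.

Lemma energy_square n : energy n = w n.+1 *
  ((c n.+1 * p x n - x * p x n.+1 / 2) ^+ 2 + (lam n - x ^+ 2 / 4) * p x n.+1 ^+ 2).
Proof. by rewrite /energy; field. Qed.

(** The recurrence turns the next energy into the form of [energy_square], with
only [lam] changed. *)
Lemma energyS n : energy n.+1 = w n.+1 *
  ((c n.+1 * p x n - x * p x n.+1 / 2) ^+ 2 + (lam n.+1 - x ^+ 2 / 4) * p x n.+1 ^+ 2).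
Proof.
have e1 := p_recS x n.
have e1' : (1 - c n.+1) * p x n.+2 = x * p x n.+1 - c n.+1 * p x n by rewrite e1; ring.
have e3 := weightS hc n.+1.
rewrite /energy.
transitivity (c n.+2 * w n.+2 * ((1 - c n.+1) * p x n.+2 ^+ 2
  + c n.+2 * p x n.+1 ^+ 2 - x * p x n.+2 * p x n.+1)); first by ring.
rewrite e3.
transitivity (w n.+1 * (((1 - c n.+1) * p x n.+2) ^+ 2
  + lam n.+1 * p x n.+1 ^+ 2 - x * ((1 - c n.+1) * p x n.+2) * p x n.+1)); first by ring.
by rewrite e1'; field.
Qed.

Lemma energy_anti n : energy n.+1 <= energy n.
Proof.
rewrite energyS energy_square ler_wpM2l ?(w_ge0 hc) // lerD2l ler_wpM2r ?sqr_ge0 //.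
by rewrite lerD2r lam_anti.
Qed.

Lemma energy_le n : energy n <= c 1.
Proof.
elim: n => [|n IH]; last exact: le_trans (energy_anti n) IH.
rewrite /energy p0 p1 (szwarc0 hc).
have := weightS hc 0; rewrite (szwarc0 hc) {2}/weight !subr0 mulr1 => e.
have -> : w 1 * (c 1 * 1 * x ^+ 2 + (c 1 * 1) ^+ 2 - x * x * (c 1 * 1)) = c 1 * w 1 * c 1.
  by ring.
by rewrite e mul1r.
Qed.

Lemma lam_gap n : (1 - x ^+ 2) / 4 <= lam n - x ^+ 2 / 4.
Proof. by have := lam_ge n; lra. Qed.

Lemma ratio_step (W s l l' t : R) : 0 <= W -> 0 <= s -> l' <= l ->
  W * (s + l * t) * l' <= W * (s + l' * t) * l.
Proof.
move=> W0 s0 ll; rewrite -!mulrA ler_wpM2l // !mulrDl mulrAC [l' * t * l]mulrAC.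
by rewrite [l' * l]mulrC lerD2r ler_wpM2l.
Qed.

(** Although the energy decreases, its quotient by [lam n - x^2/4] increases; this
is what bounds the energy from below. *)
Lemma energy_ratio n : c 1 / (lam 0 - x ^+ 2 / 4) <= energy n / (lam n - x ^+ 2 / 4).
Proof.
have gp k : 0 < lam k - x ^+ 2 / 4.
  by apply: lt_le_trans (lam_gap k); rewrite divr_gt0 // subr_gt0 x2_lt1.
elim: n => [|n IH].
  rewrite ler_pM2r ?invr_gt0 //.
  rewrite /energy p0 p1 (szwarc0 hc).
  have := weightS hc 0; rewrite (szwarc0 hc) {2}/weight !subr0 mulr1 => e.
  have -> : w 1 * (c 1 * 1 * x ^+ 2 + (c 1 * 1) ^+ 2 - x * x * (c 1 * 1)) = c 1 * w 1 * c 1.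
    by ring.
  by rewrite e mul1r.
apply: le_trans IH _.
rewrite energyS energy_square ler_pdivrMr // [leRHS]mulrAC ler_pdivlMr //.
apply: ratio_step; rewrite ?(w_ge0 hc) ?sqr_ge0 //.
by rewrite lerD2r lam_anti.
Qed.

Lemma energy_lower : exists2 e0 : R, 0 < e0 & forall n, e0 <= energy n.
Proof.
have gp k : 0 < lam k - x ^+ 2 / 4.
  by apply: lt_le_trans (lam_gap k); rewrite divr_gt0 // subr_gt0 x2_lt1.
exists (c 1 / (lam 0 - x ^+ 2 / 4) * ((1 - x ^+ 2) / 4)).
  by rewrite mulr_gt0 ?divr_gt0 ?(szwarc_gt0 hc) // subr_gt0 x2_lt1.
move=> n; have := energy_ratio n; rewrite ler_pdivlMr // => h; apply: le_trans h.
by rewrite ler_wpM2l ?lam_gap // divr_ge0 ?ltW ?(szwarc_gt0 hc).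
Qed.

Lemma wp2_le n : w n.+1 * p x n.+1 ^+ 2 <= c 1 * (4 / (1 - x ^+ 2)).
Proof.
have x2 := x2_lt1; rewrite [leRHS]mulrA ler_pdivlMr ?subr_gt0 //.
have h : (1 - x ^+ 2) / 4 * (w n.+1 * p x n.+1 ^+ 2) <= energy n.
  rewrite energy_square mulrCA ler_wpM2l ?(w_ge0 hc) //.
  apply: (@le_trans _ _ ((lam n - x ^+ 2 / 4) * p x n.+1 ^+ 2)).
    by rewrite ler_wpM2r ?sqr_ge0 // lam_gap.
  by rewrite lerDr sqr_ge0.
by have := le_trans h (energy_le n); lra.
Qed.

Lemma energy_upper n : energy n <= 2 * (w n.+1 * p x n.+1 ^+ 2 + w n * p x n ^+ 2).
Proof.
have e := weightS hc n; have a0 := a_gt0 hc n; have cc := szwarc_gt0 hc n.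
have ch := szwarc_le_half hc n.+1; have c0 := c_ge0 hc n.
have w1 := w_ge0 hc n.+1; have w0 := w_ge0 hc n.
rewrite /energy; set A := p x n.+1; set B := p x n.
have h1 : lam n * A ^+ 2 <= A ^+ 2 by rewrite ler_piMl ?sqr_ge0 //; nra.
have h2 : - (x * A * (c n.+1 * B)) <= A ^+ 2 + (c n.+1 * B) ^+ 2.
  apply: le_trans (ler_norm _) _; rewrite normrN -mulrA normrM.
  apply: (@le_trans _ _ `|A * (c n.+1 * B)|).
    by rewrite ler_piMl ?normr_ge0 // ltW.
  rewrite ler_norml; apply/andP; split.
    by have := sqr_ge0 (A + c n.+1 * B); have := sqr_ge0 A; have := sqr_ge0 (c n.+1 * B); nra.
  by have := sqr_ge0 (A - c n.+1 * B); have := sqr_ge0 A; have := sqr_ge0 (c n.+1 * B); nra.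
have h3 : w n.+1 * (c n.+1 * B) ^+ 2 <= w n * B ^+ 2.
  have -> : w n.+1 * (c n.+1 * B) ^+ 2 = (c n.+1 * w n.+1) * c n.+1 * B ^+ 2 by ring.
  rewrite e ler_wpM2r ?sqr_ge0 //.
  have -> : (1 - c n) * w n * c n.+1 = w n * ((1 - c n) * c n.+1) by ring.
  by rewrite ler_piMr //; nra.
apply: (@le_trans _ _ (w n.+1 * (2 * A ^+ 2 + 2 * (c n.+1 * B) ^+ 2))).
  by rewrite ler_wpM2l //; lra.
by rewrite mulrDr [w n.+1 * (2 * A ^+ 2)]mulrCA [w n.+1 * (2 * _)]mulrCA; lra.
Qed.

(** The kernel [K n], the sum of [w_k P_k(x)^2], is at least a multiple of [n] by
the lower bound of the energy.  If the derivatives are bounded, the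
Christoffel-Darboux formula and the upper bound of [w_n P_n(x)^2] give
[K n ^ 2 <= const * w n]. *)
Lemma unbounded_inside (B : R) :
  (forall e : R, 0 < e -> exists n, w n.+1 < e * n.+1%:R ^+ 2) ->
  exists n, B < `|d x n|.
Proof.
move=> hw; apply: contrapT => /forallNP dB.
have {}dB n : `|d x n| <= B by rewrite leNgt; apply/negP/dB.
have B0 : 0 <= B by exact: le_trans (dB 0%N).
have [e0 e0p he] := energy_lower.
pose K n := \sum_(k < n.+1) w k * p x k ^+ 2.
have t0 k : 0 <= w k * p x k ^+ 2 by rewrite mulr_ge0 ?(w_ge0 hc) // sqr_ge0.
have Klow n : n%:R * (e0 / 4) <= K n.
  have H : n%:R * (e0 / 2) + w n * p x n ^+ 2 <= 2 * K n.
    elim: n => [|n IH].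
      rewrite mul0r add0r /K big_ord_recr big_ord0 /= add0r.
      by have := t0 0%N; lra.
    rewrite {}/K in IH *; rewrite big_ord_recr /=.
    have := le_trans (he n) (energy_upper n).
    by rewrite -[n.+1%:R]natr1; lra.
  by have := t0 n; lra.
set U := c 1 * (4 / (1 - x ^+ 2)).
have U0 : 0 <= U.
  by rewrite /U mulr_ge0 ?divr_ge0 ?(c_ge0 hc) // subr_ge0 ltW ?x2_lt1.
have key n : (n.+1%:R * (e0 / 4)) ^+ 2 <= 4 * w n.+1 * B ^+ 2 * U.
  apply: (@le_trans _ _ (K n.+1 ^+ 2)).
    by rewrite ler_sqr ?nnegrE ?Klow // ?(le_trans _ (Klow n.+1)) // mulr_ge0 // ltW // divr_gt0.
  rewrite /K christoffel_darboux.
  set q0 := p x n.+1; set q1 := p x n.+2; set W := w n.+1.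
  have W0 : 0 <= W by exact: w_ge0.
  have h0 : W * q0 ^+ 2 <= U by exact: wp2_le.
  have h1 : W * q1 ^+ 2 <= U.
    apply: le_trans (wp2_le n.+1); rewrite ler_wpM2r ?sqr_ge0 //.
    exact: weight_le.
  have a0 := a_gt0 hc n.+1; have c0 := c_ge0 hc n.+1.
  have d2 k : d x k ^+ 2 <= B ^+ 2.
    by rewrite -real_normK ?num_real // ler_sqr ?nnegrE // dB.
  have -> : (W * (1 - c n.+1) * (d x n.+2 * q0 - d x n.+1 * q1)) ^+ 2 =
    W ^+ 2 * ((1 - c n.+1) ^+ 2 * (d x n.+2 * q0 - d x n.+1 * q1) ^+ 2) by ring.
  apply: (@le_trans _ _ (W ^+ 2 * (2 * (B ^+ 2 * q0 ^+ 2) + 2 * (B ^+ 2 * q1 ^+ 2)))).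
    rewrite ler_wpM2l ?sqr_ge0 //.
    apply: (@le_trans _ _ ((d x n.+2 * q0 - d x n.+1 * q1) ^+ 2)).
      rewrite ler_piMl ?sqr_ge0 // -[leRHS](expr1n _ 2).
      by rewrite ler_sqr ?nnegrE; lra.
    have g1 : (d x n.+2 * q0) ^+ 2 <= B ^+ 2 * q0 ^+ 2.
      by rewrite exprMn ler_wpM2r ?sqr_ge0.
    have g2 : (d x n.+1 * q1) ^+ 2 <= B ^+ 2 * q1 ^+ 2.
      by rewrite exprMn ler_wpM2r ?sqr_ge0.
    have := sqr_ge0 (d x n.+2 * q0 + d x n.+1 * q1).
    move: g1 g2; set y := d x n.+2 * q0; set z := d x n.+1 * q1.
    by rewrite sqrrD sqrrB; lra.
  have -> : W ^+ 2 * (2 * (B ^+ 2 * q0 ^+ 2) + 2 * (B ^+ 2 * q1 ^+ 2)) =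
     2 * W * B ^+ 2 * (W * q0 ^+ 2 + W * q1 ^+ 2) by ring.
  have -> : 4 * W * B ^+ 2 * U = 2 * W * B ^+ 2 * (U + U) by ring.
  apply: ler_wpM2l; last exact: lerD.
  by apply: mulr_ge0; [apply: mulr_ge0|exact: sqr_ge0].
have BU : 0 <= 4 * B ^+ 2 * U.
  by apply: mulr_ge0 => //; apply: mulr_ge0 => //; exact: sqr_ge0.
have eps : 0 < (e0 / 4) ^+ 2 / (4 * B ^+ 2 * U + 1).
  by rewrite divr_gt0 ?exprn_gt0 ?divr_gt0 // ltr_wpDl.
have [n] := hw _ eps.
rewrite mulrAC ltr_pdivlMr; last by rewrite ltr_wpDl.
have W0 := weight_gt0 hc n.+1.
by have := key n; rewrite exprMn; nra.
Qed.

End Interior.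

Lemma eventually_bounded (y : nat -> R) (n0 : nat) :
  (forall n, (n0 <= n)%N -> y n.+2 <= y n) -> exists B, forall n, y n <= B.
Proof.
move=> hy; exists (\sum_(k < n0.+2) `|y k|).
have small k : (k < n0.+2)%N -> y k <= \sum_(k < n0.+2) `|y k|.
  move=> kn; rewrite (bigD1 (Ordinal kn)) //=.
  apply: le_trans (ler_norm _) _; rewrite lerDl sumr_ge0 //.
elim/nat_ind2 => [||n h0 _]; [exact: small|exact: small|].
have [h|h] := leqP n0 n; first exact: le_trans (hy n h) h0.
by apply: small; rewrite !ltnS.
Qed.

(** Eventually [(n + nu + 1) |P_n(0)|] decreases along each parity, hence
[|P_n(0)| <= (1 - 2 c_n) C] for some [C]; this is what the recurrence of
[P_n'(0)] needs to preserve the bound [C]. *)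
Lemma bounded_at_0 (nu : R) (n0 : nat) : 0 <= nu ->
  (forall n, (n0 <= n)%N -> c n <= (n%:R + nu) / (2 * (n%:R + nu + 1))) ->
  exists B, forall n, `|d 0 n| <= B.
Proof.
move=> nu0 hn.
have Np n : 0 < n%:R + nu + 1 :> R by rewrite ltr_wpDl // addr_ge0.
have gap n : (n0 <= n)%N -> 2 * c n * (n%:R + nu + 1) <= n%:R + nu.
  by move=> /hn; rewrite ler_pdivlMr ?mulr_gt0 //; lra.
have [B hB] : exists B, forall n, (n%:R + nu + 1) * `|p 0 n| <= B.
  apply: (@eventually_bounded _ n0) => n nn.
  have := P_at0_abs hc n; have g := gap n.+1 (leqW nn).
  have a0 := a_gt0 hc n.+1; have c0 := c_ge0 hc n.+1.
  have := normr_ge0 (p 0 n); have := normr_ge0 (p 0 n.+2).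
  have := Np n; move: g; rewrite -!natr1.
  set q := `|_|; set r := `|_|; set m := n%:R => g m0 q0 r0 e.
  have h1 : (1 - c n.+1) * (m + 1 + nu) >= c n.+1 * (m + 1 + nu + 1 + 1) by nra.
  rewrite -(ler_pM2l a0) mulrCA e.
  by nra.
have B0 : 0 <= B by apply: le_trans (hB 0%N); rewrite mulr_ge0 // ltW.
pose C := B + \sum_(k < n0.+2) `|d 0 k|.
have S0 : 0 <= \sum_(k < n0.+2) `|d 0 k| by rewrite sumr_ge0.
have small k : (k < n0.+2)%N -> `|d 0 k| <= C.
  move=> kn; rewrite /C (bigD1 (Ordinal kn)) //= addrCA lerDl addr_ge0 //.
  by rewrite sumr_ge0.
exists C; elim/nat_ind2 => [||n h0 _]; [exact: small|exact: small|].
have [nn|h] := leqP n0 n.+1; last by apply: small; lia.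
have e := d_recS 0 n; rewrite mul0r addr0 in e.
have a0 := a_gt0 hc n.+1; have c0 := c_ge0 hc n.+1.
have g := gap _ nn; have b := hB n.+1.
rewrite -(ler_pM2l a0).
have -> : (1 - c n.+1) * `|d 0 n.+2| = `|p 0 n.+1 - c n.+1 * d 0 n|.
  by rewrite -[X in X * _](ger0_norm (ltW a0)) -normrM e; congr `|_|; ring.
apply: (le_trans (ler_normB _ _)); rewrite normrM (ger0_norm c0).
have BC : B <= C by rewrite /C lerDl.
have := Np n.+1; move: g b; set m := n.+1%:R + nu => g b m0.
have : `|p 0 n.+1| <= (1 - 2 * c n.+1) * C.
  rewrite -(ler_pM2l m0); apply: (le_trans b); apply: (le_trans BC).
  by nra.
have : c n.+1 * `|d 0 n| <= c n.+1 * C by rewrite ler_wpM2l.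
by lra.
Qed.

End DerivativeGrowth.

(** * Point amenability of the Pollaczek algebras *)

Section PointAmenability.
Variables (R : realType) (al la nu : R).
Hypothesis hal : - (1 / 2) < al.
Hypothesis hla : 0 <= la.
Hypothesis hnu : 0 <= nu.

Local Notation c := (pollaczek_c al la nu).
Local Notation N n := (n%:R + nu).
Local Notation P := (pollaczek al la nu).
Local Notation w := (weight c).
Local Notation t := (defect al la nu).

Let hc : szwarc_coefs c := pollaczek_szwarc hal hla hnu.

(** For [la > 0] the third inequality of [defect_inv] keeps the defect above
[1/(N + 1)] for large [n], and this compensates for a small [al]. *)
Lemma eventually_below : 1 / 2 <= al \/ 0 < la -> exists n0 : nat,
  forall n, (n0 <= n)%N -> c n <= N n / (2 * (N n + 1)).
Proof.
move: (hal) (hla) (hnu) => al0 la0 nu0 [a2|l0].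
  exists 0%N => n _; apply: le_trans (c_le_half_gap hal hla hnu n) _.
  have h := N_ge0 hnu n; rewrite ler_wpM2l // lef_pV2 ?posrE; lra.
exists (Num.trunc ((1 + al) / la)).+1; case=> [|n] // hn.
have M0 := NS_gt0 hnu n; have [t0 t1 tF] := defect_inv hal hla hnu n.
rewrite c_defect //; move: M0 t0 t1 tF; set M := N n.+1; set T := t n => M0 t0 t1 tF.
have S0 : 0 < 2 * M + 2 * al + 2 * la + 1 by lra.
have hM : 1 + al < la * M.
  rewrite mulrC -ltr_pdivrMr //; apply: (lt_le_trans (truncnS_gt _)).
  rewrite /M -[X in X <= _]addr0 lerD // ler_nat; exact: leq_trans hn _.
have hT : 1 <= T * (M + 1).
  rewrite leNgt; apply/negP => lt1.
  have h1 : M * T < 1 by lra.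
  have h2 : T * (1 + 2 * al + M * T) * (M + 1) <= 2 + 2 * al.
    have : 0 <= T * (M + 1) by rewrite mulr_ge0 //; lra.
    have : 0 <= M * T by rewrite mulr_ge0 // ltW.
    by nra.
  have h3 : 2 * la * M <= 2 * la * (1 - T) * (M + 1).
    by have : 0 <= la by []; nra.
  by have := ler_wpM2r (ltW (ltr_wpDl (ltW M0) (@ltr01 R))) tF; lra.
rewrite mulrAC ler_pdivrMr // mulrAC ler_pdivlMr; last by rewrite mulr_gt0 // ltr_wpDl // ltW.
rewrite -!mulrA ler_wpM2l ?(ltW M0) //.
by nra.
Qed.

Lemma not_point_amenable_pollaczek : 1 / 2 <= al \/ 0 < la -> ~ point_amenable P.
Proof.
move=> /eventually_below[n0 hn0].
have [B hB] := bounded_at_0 hc hnu hn0.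
exact (not_point_amenable_of_bounded hc (P_at0_le1 hc) hB).
Qed.

Section Unbounded.
Hypothesis la0 : la = 0.
Hypothesis al_lt : al < 1 / 2.

(** Written so that monotonicity and the lower bound [1/4] are visible. *)
Lemma lamE n : c n.+1 * (1 - c n) = 1 / 4 +
  (1 - 4 * al ^+ 2) / (4 * (4 * (N n + 1 + al) ^+ 2 - 1)).
Proof.
have hal' := hal; have h := N_ge0 hnu n; rewrite c_rec // la0.
set m := N n in h *.
have h1 : 0 < 2 * m + 2 * al + 1 by lra.
have h2 : 0 < 2 * m + 2 * al + 3 by lra.
have -> : 4 * (m + 1 + al) ^+ 2 - 1 = (2 * m + 2 * al + 1) * (2 * m + 2 * al + 3) by ring.
rewrite mulr0 !addr0; field.
by rewrite !gt_eqF.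
Qed.

Lemma al2 : 0 < 1 - 4 * al ^+ 2.
Proof.
have hal' := hal; have al_lt' := al_lt.
have : 0 < (1 / 2 - al) * (1 / 2 + al) by rewrite mulr_gt0; lra.
by lra.
Qed.

Lemma lam_den n : 0 < 4 * (N n + 1 + al) ^+ 2 - 1.
Proof.
have hal' := hal; have h := N_ge0 hnu n; set m := N n in h *.
have s : 1 / 2 < m + 1 + al by lra.
by nra.
Qed.

Lemma lam_ge_quarter n : 1 / 4 <= c n.+1 * (1 - c n).
Proof. by rewrite lamE lerDl ltW // divr_gt0 ?al2 // mulr_gt0 ?lam_den. Qed.

Lemma lam_decr n : c n.+2 * (1 - c n.+1) <= c n.+1 * (1 - c n).
Proof.
rewrite !lamE lerD2l ler_wpM2l ?(ltW al2) // lef_pV2 ?posrE ?mulr_gt0 ?lam_den //.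
have hal' := hal; have h := N_ge0 hnu n.
by rewrite ler_pM2l // lerD2r ler_pM2l // ler_sqr ?nnegrE ?(NS nu n); lra.
Qed.

(** [Y] lies above the stable fixed point [max(0, -2 al)] of the limiting
recurrence of [N n.+1 * t n], and the upper bound is what [a_eventually]
needs. *)
Lemma defect_target : exists Y : R, [/\ 0 < Y, 0 < 2 * al + Y & Y < 1 / 2 - al].
Proof.
have hal' := hal; have al_lt' := al_lt; have [a|a] := leP 0 al.
  by exists ((1 / 2 - al) / 2); split; lra.
by exists ((1 / 2 - 3 * al) / 2); split; lra.
Qed.

(** While [N n.+1 * t n] exceeds [Y] it contracts by a factor [1 - k/(n + m)], where
[k = 2 al + Y > 0], so it drops below [Y], and it remains there. *)
Lemma defect_eventually (Y : R) : 0 < Y -> 0 < 2 * al + Y ->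
  exists n0 : nat, forall n, (n0 <= n)%N -> N n.+1 * t n <= Y.
Proof.
move=> Y0 aY; have hal' := hal; have nu0 := hnu.
pose y n := N n.+1 * t n.
have y0 n : 0 <= y n.
  by rewrite mulr_ge0 ?(ltW (NS_gt0 hnu n)) //; have [] := defect_inv hal hla hnu n.
have yS n : y n.+1 = (N n.+1 + 1) * y n / (N n.+1 + 1 + 2 * al + y n).
  rewrite /y (defectS hal hla hnu); last by have [] := defect_inv hal hla hnu n.
  by rewrite (NS nu n.+1) la0 mulr0 add0r addr0 mulrA.
have [n0 h0] : exists n0, y n0 <= Y.
  apply: contrapT => /forallNP H.
  have {}H n : Y < y n by rewrite ltNge; apply/negP/H.
  have m0 : 0 < 2 + nu + 2 * al + Y by lra.
  have yd n : y n.+1 <= y n * (1 - (2 * al + Y) / (n%:R + (2 + nu + 2 * al + Y))).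
    rewrite yS; have := NS_gt0 hnu n; have := y0 n; have := H n.
    have -> : N n.+1 = n%:R + 1 + nu by rewrite -natr1.
    have : 0 <= n%:R :> R by [].
    set z := y n; set m := n%:R => m0' Yz z0 M0.
    have D1 : 0 < m + 1 + nu + 1 + 2 * al + z by lra.
    have D2 : 0 < m + (2 + nu + 2 * al + Y) by lra.
    have -> : 1 - (2 * al + Y) / (m + (2 + nu + 2 * al + Y)) =
      (m + 1 + nu + 1) / (m + (2 + nu + 2 * al + Y)) by field; rewrite gt_eqF.
    rewrite [_ * z]mulrC -mulrA ler_wpM2l // ler_wpM2l; [by []|lra|].
    by rewrite lef_pV2 ?posrE //; lra.
  have [k hk] := decay_to_0 aY m0 y0 yd Y0.
  by have := hk k (leqnn k); rewrite ltNge ltW.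
exists n0 => n /subnKC <-; elim: (n - n0)%N => [|k IH]; first by rewrite addn0.
rewrite addnS -/(y _) yS; have M0 := NS_gt0 hnu (n0 + k); have z0 := y0 (n0 + k)%N.
move: IH M0 z0; rewrite -/(y _); set z := y _; set M := N _ => zY M0 z0.
rewrite ler_pdivrMr; last by lra.
have : 0 <= z * (Y - z) by rewrite mulr_ge0 // subr_ge0.
have : 0 <= (M + 1 + 2 * al) * (Y - z) by rewrite mulr_ge0 ?subr_ge0 //; lra.
have : 0 <= (2 * al + Y) * z by rewrite mulr_ge0 // ltW.
by lra.
Qed.

Lemma a_eventually : exists k : R, k < 1 / 2 /\ exists n0 : nat,
  forall n, (n0 <= n)%N -> (1 - c n.+1) * N n.+1 <= N n.+1 / 2 + k.
Proof.
have hal' := hal; have [Y [Y0 aY Yl]] := defect_target.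
have [n0 hn0] := defect_eventually Y0 aY.
exists ((Y + al + 1 / 2) / 2); split; first by lra.
exists n0 => n nn; have := hn0 n nn; have M0 := NS_gt0 hnu n.
rewrite c_defect //; set T := t n; rewrite la0 mulr0 addr0.
move: M0; set M := N n.+1 => M0 yY.
have [T0 T1 _] := defect_inv hal hla hnu n; rewrite -/T in T0 T1.
have S0 : 0 < 2 * M + 2 * al + 1 by lra.
have MT : 0 <= M * T by rewrite mulr_ge0 // ltW.
have -> : (1 - M / (2 * M + 2 * al + 1) * (1 - T)) * M =
   M / 2 + (al + 1 / 2 + M * T) * M / (2 * M + 2 * al + 1).
  by field; rewrite gt_eqF.
rewrite lerD2l ler_pdivrMr //.
have h1 : 0 <= al + 1 / 2 + M * T by lra.
have h2 : (al + 1 / 2 + M * T) * (2 * M) <= (al + 1 / 2 + Y) * (2 * M + 2 * al + 1).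
  by apply: ler_pM => //; lra.
by lra.
Qed.

(** Since [c_(n+2) a_(n+1) >= 1/4], the ratio of consecutive weights is at most
[4 a_(n+1)^2], and by [a_eventually] this is at most [(1 + 2k/N)^2] with
[2k < 1]; hence [w_n / N^2] decays like a power of [n]. *)
Lemma weight_small (e : R) : 0 < e -> exists n, w n.+1 < e * n.+1%:R ^+ 2.
Proof.
move=> e0; have [k [k2 [n0 hn0]]] := a_eventually; have nu0 := hnu.
pose x n := w (n0 + n).+1 / N (n0 + n).+1 ^+ 2.
have x0 n : 0 <= x n by rewrite divr_ge0 ?(w_ge0 hc) // sqr_ge0.
have k0 : 0 < 1 - 2 * k by lra.
have m0 : 0 < n0%:R + 2 + nu :> R by rewrite ltr_wpDr // ltr_wpDl.
have xS n : x n.+1 <= x n * (1 - (1 - 2 * k) / (n%:R + (n0%:R + 2 + nu))).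
  rewrite /x addnS; set j := (n0 + n)%N.
  have nj : (n0 <= j)%N by rewrite leq_addr.
  have := hn0 j nj; have := weightS hc j.+1; have := lam_ge_quarter j.+1.
  have W0 := weight_gt0 hc j.+1; have W1 := weight_gt0 hc j.+2.
  have M0 := NS_gt0 hnu j; have a0 := a_gt0 hc j.+1; have c0 := szwarc_gt0 hc j.+1.
  have -> : n%:R + (n0%:R + 2 + nu) = N j.+1 + 1 :> R by rewrite /j -[(n0 + n).+1%:R]natr1 natrD; ring.
  rewrite (NS nu j.+1); move: M0 W0 W1 a0 c0.
  set M := N j.+1; set W := w j.+1; set W' := w j.+2; set a := 1 - c j.+1; set C := c j.+2.
  move=> M0 W0 W1 a0 c0 q e1 h.
  have -> : 1 - (1 - 2 * k) / (M + 1) = (M + 2 * k) / (M + 1) by field; rewrite gt_eqF //; lra.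
  have h0 : 0 < M + 2 * k by have := mulr_gt0 a0 M0; lra.
  have s1 : W' <= 4 * a ^+ 2 * W.
    rewrite -(ler_pM2l c0) e1.
    have h4 : 1 <= 4 * (C * a) by lra.
    have h5 : 0 <= a * W by rewrite mulr_ge0 // ltW.
    by have := ler_peMl h5 h4; lra.
  have s2 : (2 * a * M) ^+ 2 <= (M + 2 * k) ^+ 2.
    by rewrite ler_sqr ?nnegrE; [lra| |]; [rewrite !mulr_ge0 // ltW|rewrite ltW].
  have s3 : W' * M ^+ 2 <= W * (M + 2 * k) ^+ 2.
    apply: (@le_trans _ _ (4 * a ^+ 2 * W * M ^+ 2)).
      by rewrite ler_wpM2r ?sqr_ge0.
    have -> : 4 * a ^+ 2 * W * M ^+ 2 = W * (2 * a * M) ^+ 2 by ring.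
    by rewrite ler_wpM2l // ltW.
  have s4 : (M + 2 * k) ^+ 2 <= (M + 2 * k) * (M + 1).
    by rewrite expr2 ler_wpM2l ?ltW //; lra.
  have M1 : 0 < M + 1 by lra.
  have MM : 0 < M ^+ 2 by rewrite exprn_gt0.
  rewrite ler_pdivrMr ?exprn_gt0 //.
  have -> : W / M ^+ 2 * ((M + 2 * k) / (M + 1)) * (M + 1) ^+ 2 =
     W * ((M + 2 * k) * (M + 1)) / M ^+ 2 by field; rewrite !gt_eqF //; lra.
  rewrite ler_pdivlMr //; apply: (le_trans s3).
  by rewrite ler_wpM2l // ltW.
have nu1 : 0 < (1 + nu) ^+ 2 by rewrite exprn_gt0 // ltr_wpDr.
have [j hj] := decay_to_0 k0 m0 x0 xS (divr_gt0 e0 nu1).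
exists (n0 + j)%N; have := hj j (leqnn j); rewrite /x.
have M0 := NS_gt0 hnu (n0 + j); rewrite ltr_pdivrMr ?exprn_gt0 // => h.
apply: (lt_le_trans h); rewrite mulrAC ler_pdivrMr // -mulrA ler_pM2l // -exprMn.
rewrite ler_sqr ?nnegrE ?(ltW M0) ?mulr_ge0 ?addr_ge0 //.
rewrite mulrDr mulr1 lerD2l ler_peMl // ler1n //.
Qed.

Lemma point_amenable_pollaczek : point_amenable P.
Proof.
apply: (point_amenable_of_unbounded hc) => x B.
have [x1|x1] := leP 1 `|x|; first exact: (unbounded_outside hc B x1).
exact: (unbounded_inside hc lam_decr lam_ge_quarter x1 B weight_small).
Qed.

End Unbounded.
End PointAmenability.

(** * A derivation weighted by 1 - X^2 *)

Section AssociatedPolynomials.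
Variables (R : realType) (c : nat -> R).
Hypothesis hc : szwarc_coefs c.

Local Notation P := (recurrence_poly c).
Local Notation w := (weight c).

(** The solution of the recurrence with initial values 0 and 1, that is, the
associated polynomials shifted by one. *)
Fixpoint assoc_poly (n : nat) : {poly R} :=
  match n with
  | 0 => 0
  | m.+1 => match m with
    | 0 => 1
    | k.+1 => (1 - c m)^-1 *: ('X * assoc_poly m - c m *: assoc_poly k)
    end
  end.

Lemma assoc_rec n : 'X * assoc_poly n.+1 =
  (1 - c n.+1) *: assoc_poly n.+2 + c n.+1 *: assoc_poly n.
Proof. by rewrite [assoc_poly n.+2]/= scalerA divff ?(a_neq0 hc) // scale1r subrK. Qed.

(** The coefficients of [assoc_poly n] with respect to the [P k]. *)
Fixpoint assoc_coef (n : nat) : nat -> R :=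
  match n with
  | 0 => fun=> 0
  | m.+1 => match m with
    | 0 => fun k => (k == 0%N)%:R
    | j.+1 => fun k => (1 - c m)^-1 *
        ((if k is i.+1 then (1 - c i) * assoc_coef m i else 0)
         + c k.+1 * assoc_coef m k.+1 - c m * assoc_coef j k)
    end
  end.

Definition up (f : nat -> R) (k : nat) : R := if k is i.+1 then (1 - c i) * f i else 0.

Lemma assoc_coefS n k : (1 - c n.+1) * assoc_coef n.+2 k =
  up (assoc_coef n.+1) k + c k.+1 * assoc_coef n.+1 k.+1 - c n.+1 * assoc_coef n k.
Proof. by rewrite [assoc_coef n.+2]/= mulrA divff ?(a_neq0 hc) // mul1r. Qed.

Arguments assoc_coef : simpl never.
Arguments assoc_poly : simpl never.

Lemma assoc_coef_out n k : (n <= k)%N -> assoc_coef n k = 0.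
Proof.
elim/nat_ind2: n k => [||n h0 h1] k // nk; first by case: k nk.
apply: (mulfI (a_neq0 hc n.+1)); rewrite assoc_coefS mulr0.
have nk1 : (n.+1 <= k.+1)%N by lia.
have nk0 : (n <= k)%N by lia.
rewrite (h1 k.+1 nk1) (h0 k nk0) !mulr0 addr0 subr0.
by case: k nk {nk1 nk0} => [|k] //= nk; rewrite h1 ?mulr0.
Qed.

Lemma calc_assoc n k :
  calc c (assoc_poly n) (delta R 0) k = (assoc_coef n k / w k)%:C.
Proof.
elim/nat_ind2: n k => [||n h0 h1] k.
- by rewrite [assoc_poly 0]/(0 : {poly R}) calc0 /assoc_coef mul0r.
- rewrite [assoc_poly 1]/(1 : {poly R}) calc1 /assoc_coef /delta; case: eqP => [->|_]; last by rewrite mul0r.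
  by rewrite /weight divr1.
apply: (mulfI (aC_neq0 hc n.+1)).
have := congr1 (fun p => calc c p (delta R 0) k) (assoc_rec n).
rewrite calcD !calcZ => /eqP; rewrite -subr_eq => /eqP <-.
rewrite calc_mulX -jacobi_calc h0 /jacobi !h1 -!rmorphM -rmorphD -rmorphB /=.
have w0 j := weight_neq0 hc j; have e j := weightS hc j.
congr (_%:C); rewrite [RHS]mulrA assoc_coefS.
have A j x : (1 - c j) * (x / w j.+1) = c j.+1 * x / w j.
  have -> : 1 - c j = c j.+1 * w j.+1 / w j by rewrite e mulfK.
  by field; rewrite !w0.
have B j x : c j.+1 * (x / w j) = (1 - c j) * x / w j.+1.
  by rewrite -[RHS]mulrA A mulrA.
rewrite A; case: k => [|k] /=; first by rewrite (szwarc0 hc); ring.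
by rewrite B; ring.
Qed.

Hypothesis lam_anti : forall n, c n.+2 * (1 - c n.+1) <= c n.+1 * (1 - c n).

Lemma lam_le m n : (m <= n)%N -> c n.+1 * (1 - c n) <= c m.+1 * (1 - c m).
Proof.
move=> /subnKC <-; elim: (n - m)%N => [|k IH]; first by rewrite addn0.
by rewrite addnS (le_trans (lam_anti _)).
Qed.

(** The difference equation of [assoc_coef] is a discrete wave equation; its
solution is compared along the diagonals [n - k = const], and the monotonicity
of [c_(n+1) a_n] gives the sign. *)
Lemma assoc_coef_mono n : (forall k, 0 <= assoc_coef n k) /\
  (forall k, 0 <= assoc_coef n.+1 k) /\
  (forall k, up (assoc_coef n) k <= (1 - c n) * assoc_coef n.+1 k).
Proof.
elim: n => [|n [h0 [h1 h2]]].
  split=> //; split=> [k|[|k]] /=; rewrite ?ler0n //.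
    by rewrite (szwarc0 hc) subr0 mul1r ler0n.
  by rewrite !mulr0.
have up0 f k : (forall i, 0 <= f i) -> 0 <= up f k.
  by move=> f0; case: k => [|k] //=; rewrite mulr_ge0 // ltW // (a_gt0 hc).
suff H k : up (assoc_coef n.+1) k <= (1 - c n.+1) * assoc_coef n.+2 k.
  split=> //; split=> // k; rewrite -(pmulr_rge0 _ (a_gt0 hc n.+1)).
  exact: le_trans (up0 _ k h1) (H k).
rewrite assoc_coefS -addrA lerDl subr_ge0.
have [nk|kn] := leqP n k.
  by rewrite (assoc_coef_out nk) mulr0 mulr_ge0 ?(c_ge0 hc).
have an := a_gt0 hc n; have ak := a_gt0 hc k; have ck := szwarc_gt0 hc k.
rewrite -(ler_pM2l an).
have := lam_le (ltnW kn); have := h2 k.+1; rewrite /up.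
have := h0 k; set f := assoc_coef n k; set g := assoc_coef n.+1 k.+1.
move=> f0 e1 e2.
have : c k.+1 * ((1 - c k) * f) <= c k.+1 * ((1 - c n) * g) by rewrite ler_wpM2l // ltW.
have : c n.+1 * (1 - c n) * f <= c k.+1 * (1 - c k) * f by rewrite ler_wpM2r.
by lra.
Qed.

Lemma assoc_coef_ge0 n k : 0 <= assoc_coef n k.
Proof. by have [] := assoc_coef_mono n. Qed.

(** The value of [assoc_poly n] at 1, which bounds the coefficients as they are
nonnegative. *)
Definition assoc_sum n : R := \sum_(k < n) assoc_coef n k.

Lemma assoc_sum_wide N n : (n <= N)%N -> \sum_(k < N) assoc_coef n k = assoc_sum n.
Proof.
move=> nN; rewrite /assoc_sum -!(big_mkord xpredT (assoc_coef n)).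
rewrite (@big_cat_nat _ _ _ n 0 N) //= [X in _ + X]big1_seq ?addr0 // => i /=.
by rewrite mem_index_iota => /andP[/assoc_coef_out].
Qed.

Lemma assoc_sum0 : assoc_sum 0 = 0.
Proof. by rewrite /assoc_sum big_ord0. Qed.

Lemma assoc_sum1 : assoc_sum 1 = 1.
Proof. by rewrite /assoc_sum big_ord_recr big_ord0 /= add0r. Qed.

Lemma assoc_sumS n :
  (1 - c n.+1) * assoc_sum n.+2 + c n.+1 * assoc_sum n = assoc_sum n.+1.
Proof.
rewrite -(@assoc_sum_wide n.+2 n) ?(leqW (leqnSn n)) // /assoc_sum.
rewrite !mulr_sumr -big_split /=.
transitivity (\sum_(k < n.+2) (up (assoc_coef n.+1) k + c k.+1 * assoc_coef n.+1 k.+1)).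
  by apply: eq_bigr => k _; rewrite assoc_coefS subrK.
rewrite big_split /= big_ord_recl /= add0r.
have -> : \sum_(k < n.+2) c k.+1 * assoc_coef n.+1 k.+1 =
    \sum_(k < n.+1) c k * assoc_coef n.+1 k.
  have := @big_ord_recl R 0 +%R n.+2 (fun k => c k * assoc_coef n.+1 k).
  rewrite (szwarc0 hc) mul0r add0r => <-.
  rewrite big_ord_recr big_ord_recr /= !(assoc_coef_out (n := n.+1)) ?leqnSn //.
  by rewrite !mulr0 !addr0.
by rewrite -big_split; apply: eq_bigr => k _ /=; rewrite -mulrDl subrK mul1r.
Qed.

Lemma assoc_coef_le_sum n k : assoc_coef n k <= assoc_sum n.
Proof.
have [nk|kn] := leqP n k.
  by rewrite assoc_coef_out // /assoc_sum sumr_ge0 // => i _; exact: assoc_coef_ge0.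
rewrite /assoc_sum (bigD1 (Ordinal kn)) //= lerDl sumr_ge0 // => i _.
exact: assoc_coef_ge0.
Qed.

(** [r] is a second, positive solution of the recurrence at the point 1.  As the
constants are solutions as well, the value at 1 of the associated polynomial is
[(1 - r n) / (1 - r 1)]. *)
Lemma assoc_sum_bounded (r : nat -> R) : r 0%N = 1 -> (forall n, 0 <= r n) ->
  r 1%N < 1 -> (forall n, (1 - c n.+1) * r n.+2 + c n.+1 * r n = r n.+1) ->
  forall n, assoc_sum n <= (1 - r 1%N)^-1.
Proof.
move=> r0 rp r1 rr n; have d0 : 0 < 1 - r 1%N by rewrite subr_gt0.
have H : assoc_sum n * (1 - r 1%N) = 1 - r n.
  elim/nat_ind2: n => [||n h0 h1].
  - by rewrite assoc_sum0 r0 mul0r subrr.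
  - by rewrite assoc_sum1 mul1r.
  apply: (mulfI (a_neq0 hc n.+1)).
  have e1 := assoc_sumS n; have e2 := rr n.
  have -> : (1 - c n.+1) * (assoc_sum n.+2 * (1 - r 1%N)) =
    (1 - c n.+1) * assoc_sum n.+2 * (1 - r 1%N) by ring.
  have -> : (1 - c n.+1) * assoc_sum n.+2 = assoc_sum n.+1 - c n.+1 * assoc_sum n.
    by rewrite -e1; ring.
  rewrite mulrBl h1 -mulrA h0 -e2; ring.
by rewrite -[leRHS]mul1r ler_pdivlMr // H lerBlDr lerDl.
Qed.

(** The Casoratian of the solutions 1 and [assoc_sum] at the point 1. *)
Lemma assoc_sum_step n : (assoc_sum n.+1 - assoc_sum n) * ((1 - c n) * w n) = 1.
Proof.
elim: n => [|n IH].
  by rewrite assoc_sum0 assoc_sum1 (szwarc0 hc) /weight; ring.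
have e1 := assoc_sumS n; have e2 := weightS hc n.
have -> : (assoc_sum n.+2 - assoc_sum n.+1) * ((1 - c n.+1) * w n.+1) =
   ((1 - c n.+1) * assoc_sum n.+2 - (1 - c n.+1) * assoc_sum n.+1) * w n.+1 by ring.
have -> : (1 - c n.+1) * assoc_sum n.+2 - (1 - c n.+1) * assoc_sum n.+1 =
   c n.+1 * (assoc_sum n.+1 - assoc_sum n).
  have -> : (1 - c n.+1) * assoc_sum n.+2 = assoc_sum n.+1 - c n.+1 * assoc_sum n.
    by rewrite -e1; ring.
  by ring.
by rewrite [c n.+1 * _]mulrC -mulrA e2.
Qed.

(** The increments [1/(a_n w_n)] of the bounded sequence [assoc_sum] decrease, so
[n] times the last one is at most [Q]. *)
Lemma weight_ge_linear (Q : R) : (forall n, assoc_sum n <= Q) ->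
  forall n, n.+1%:R <= Q * w n.
Proof.
move=> hQ n; pose D k := assoc_sum k.+1 - assoc_sum k.
have aw k : 0 < (1 - c k) * w k by rewrite mulr_gt0 ?(a_gt0 hc) ?(weight_gt0 hc).
have DE k : D k = ((1 - c k) * w k)^-1.
  apply: (mulIf (lt0r_neq0 (aw k))); rewrite mulVf ?lt0r_neq0 //.
  exact: assoc_sum_step.
have D0 k : 0 <= D k by rewrite DE invr_ge0 ltW.
have Danti k : D k.+1 <= D k.
  rewrite !DE lef_pV2 ?posrE //.
  have := weightS hc k => e; rewrite -e ler_wpM2r ?(w_ge0 hc) //.
  by have := szwarc_le_half hc k.+1; lra.
have H : n.+1%:R * D n <= assoc_sum n.+1.
  elim: n => [|n IH].
    by rewrite mul1r /D assoc_sum0 subr0.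
  have -> : assoc_sum n.+2 = assoc_sum n.+1 + D n.+1 by rewrite /D addrC subrK.
  rewrite -[n.+2%:R]natr1 mulrDl mul1r lerD2r; apply: le_trans IH.
  by rewrite ler_wpM2l.
have Q0 : 0 <= Q by have := hQ 0%N; rewrite assoc_sum0.
have := le_trans H (hQ _); rewrite DE ler_pdivrMr // => h.
apply: (le_trans h); rewrite ler_wpM2l // ler_piMl ?(w_ge0 hc) //.
by have := c_ge0 hc n; lra.
Qed.

End AssociatedPolynomials.

Section WeakAmenabilityFails.
Variables (R : realType) (c : nat -> R).
Hypothesis hc : szwarc_coefs c.

Local Notation P := (recurrence_poly c).
Local Notation w := (weight c).

(** The analogue of the differentiation formula of the Gegenbauer polynomials.  The
hypothesis is the condition on the coefficients for the inductive step; the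
initial value at [n = 1] leaves the error [(s + 2) c_1 - 1], which
propagates by the recurrence and is therefore a multiple of the associated
polynomials. *)
Lemma structure_relation (s : R) :
  (forall n, 1 + (2 * n%:R + s) * (c n.+1 * (1 - c n))
      = (2 * n%:R + s + 4) * (c n.+2 * (1 - c n.+1))) -> forall n,
  (1 - 'X ^+ 2) * (P n)^`() = ((2 * n%:R + s) * c n) *: P n.-1
    - n%:R *: ('X * P n) - ((s + 2) * c 1 - 1) *: assoc_poly c n.
Proof.
move=> hs; set e := (s + 2) * c 1 - 1.
elim/nat_ind2 => [||n h0 h1].
- by rewrite /= derivC mulr0 (szwarc0 hc) mulr0 !scale0r scaler0 !subr0.
- rewrite /= derivX mulr1 -!mul_polyC /e /assoc_poly !mulr1.
  by rewrite !(rmorphB, rmorphD, rmorphM) /=; ring.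
apply: (scalerI (a_neq0 hc n.+1)).
have dr := deriv_rec hc n.+1; have pr : 'X * P n.+1 = _ := mulX_rec hc n.+1.
have pr0 := mulX_rec hc n; have ar := assoc_rec hc n; have hsn := hs n.
rewrite [n.+1.-1]/= in dr pr h1; rewrite [n.+2.-1]/=.
have dr' : (1 - c n.+1) *: (P n.+2)^`() = P n.+1 + 'X * (P n.+1)^`() - c n.+1 *: (P n)^`().
  by rewrite dr addrK.
have pr' : (1 - c n.+1) *: P n.+2 = 'X * P n.+1 - c n.+1 *: P n by rewrite pr addrK.
have ar' : (1 - c n.+1) *: assoc_poly c n.+2 = 'X * assoc_poly c n.+1 - c n.+1 *: assoc_poly c n.
  by rewrite ar addrK.
have pr0' : c n *: P n.-1 = 'X * P n - (1 - c n) *: P n.+1 by rewrite pr0 addrC addKr.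
rewrite scalerAr dr' mulrBr mulrDr -scalerAr.
rewrite [(1 - 'X ^+ 2) * ('X * _)]mulrCA h1 h0 -[(2 * n%:R + s) * c n *: _]scalerA pr0'.
have -> : (1 - c n.+1) *: (((2 * n.+2%:R + s) * c n.+2) *: P n.+1
    - n.+2%:R *: ('X * P n.+2) - e *: assoc_poly c n.+2) =
  ((1 - c n.+1) * ((2 * n.+2%:R + s) * c n.+2)) *: P n.+1
    - n.+2%:R *: ('X * ((1 - c n.+1) *: P n.+2))
    - e *: ((1 - c n.+1) *: assoc_poly c n.+2).
  move: (P n.+1) (P n.+2) (assoc_poly c n.+2) (1 - c n.+1) n.+2%:R (e).
  move=> q1 q2 y2 a1 a3 a4; rewrite -!mul_polyC rmorphM /=.
  by ring.
rewrite pr' ar'.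
have -> : (1 - c n.+1) * ((2 * n.+2%:R + s) * c n.+2) =
    1 + (2 * n%:R + s) * (c n.+1 * (1 - c n)).
  by rewrite hsn -[n.+2%:R]natr1 -[n.+1%:R]natr1; ring.
rewrite -[n.+2%:R]natr1 -[n.+1%:R]natr1.
move: (P n) (P n.+1) (assoc_poly c n) (assoc_poly c n.+1) => q0 q1 y0 y1.
rewrite -!mul_polyC !(rmorphB, rmorphD, rmorphM, rmorph1, rmorph_nat) /=.
by ring.
Qed.

(** Uses the functional [phi(p)], the integral of [(1 - x^2) p].  By
[structure_relation] the sequences [P_n'(J) phi] are combinations of
[delta_k / w_k] with coefficients of order [n] and [k] close to [n], and of the
associated polynomials. *)
Lemma not_weakly_amenable_criterion (s Q C : R) : 0 <= s ->
  (forall n, c n.+2 * (1 - c n.+1) <= c n.+1 * (1 - c n)) ->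
  (forall n, 1 + (2 * n%:R + s) * (c n.+1 * (1 - c n))
      = (2 * n%:R + s + 4) * (c n.+2 * (1 - c n.+1))) ->
  (forall n, `|(s + 2) * c 1 - 1| * assoc_sum c n <= Q) ->
  (forall n, n.+1%:R <= C * w n) ->
  ~ weakly_amenable (l1alg P).
Proof.
move=> s0 la hs hQ hC.
pose phi := calc c (1 - 'X ^+ 2) (delta R 0).
have w0 n : 0 < w n by exact: weight_gt0.
have C0 : 0 <= C.
  have := hC 0%N; rewrite /weight mulr1; exact: le_trans ler01.
have Q0 : 0 <= Q by have := hQ 0%N; rewrite (assoc_sum0 c) mulr0.
have tr j n : normc (trans c j (delta R 0) n) <= (w j)^-1.
  rewrite (trans_delta0 hc) normcM normc_real ger0_norm ?invr_ge0 ?(ltW (w0 _)) //.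
  by rewrite ler_piMr ?invr_ge0 ?(ltW (w0 _)) // delta_bounded.
have wC k (x : R) : 0 <= x -> x <= k.+1%:R -> x / w k <= C.
  by move=> x0 xk; rewrite ler_pdivrMr // (le_trans xk).
apply: (@not_weakly_amenable_of_bounded _ _ hc phi ((2 + s) * C + C + C + Q)); last first.
  rewrite /phi calcB calc1 expr2 calc_mulX -['X]mulr1 calc_mulX calc1.
  rewrite /jacobi /delta /= (szwarc0 hc) !(mulr0, mul0r, addr0, subr0, mul1r, mulr1).
  rewrite add0r -rmorphB => /eqP; rewrite (inj_eq (@complexI R) _ 0).
  by rewrite (negbTE (a_neq0 hc 1)).
move=> k n; rewrite /phi -calcM mulrC (structure_relation hs) !calcB !calcZ.
rewrite (mulX_rec hc) calcD !calcZ -!/(trans c _ _) (calc_assoc hc).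
case: k => [|k].
  rewrite (assoc_coef_out hc (leq0n n)) (szwarc0 hc) !(mulr0, mul0r) !subr0 normc0.
  by rewrite !addr_ge0 // mulr_ge0 // addr_ge0.
rewrite [k.+1.-1]/=; set e := (s + 2) * c 1 - 1.
have c01 : 0 <= c k.+1 by exact: (c_ge0 hc).
have c1' : c k.+1 <= 1 by have := szwarc_le_half hc k.+1; lra.
have m0 : 0 <= k.+1%:R :> R by [].
have m1 : 1 <= k.+1%:R :> R by rewrite ler1n.
have b1 : normc (((2 * k.+1%:R + s) * c k.+1)%:C * trans c k (delta R 0) n) <= (2 + s) * C.
  rewrite normcM normc_real ger0_norm; last by rewrite mulr_ge0 // addr_ge0 // mulr_ge0.
  apply: (@le_trans _ _ ((2 + s) * k.+1%:R / w k)).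
    have h0 : 0 <= 2 * k.+1%:R + s by rewrite addr_ge0 // mulr_ge0.
    apply: ler_pM; [exact: mulr_ge0|exact: normc_ge0| |exact: tr].
    apply: (@le_trans _ _ (2 * k.+1%:R + s)); first by rewrite ler_piMr.
    by rewrite [leRHS]mulrDl lerD2l ler_peMr.
  by rewrite -mulrA ler_wpM2l ?addr_ge0 // wC.
have b2 : normc (k.+1%:R%:C * ((1 - c k.+1)%:C * trans c k.+2 (delta R 0) n)) <= C.
  rewrite !normcM !normc_real ger0_norm // ger0_norm ?subr_ge0 //.
  apply: (@le_trans _ _ (k.+1%:R / w k.+2)).
    rewrite ler_wpM2l //; apply: le_trans (tr _ n).
    by rewrite ler_piMl ?normc_ge0 // lerBlDr lerDl.
  by apply: wC => //; rewrite ler_nat; lia.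
have b3 : normc (k.+1%:R%:C * ((c k.+1)%:C * trans c k (delta R 0) n)) <= C.
  rewrite !normcM !normc_real ger0_norm // ger0_norm //.
  apply: (@le_trans _ _ (k.+1%:R / w k)).
    rewrite ler_wpM2l //; apply: le_trans (tr _ n).
    by rewrite ler_piMl ?normc_ge0.
  by apply: wC.
have b4 : normc (e%:C * (assoc_coef c k.+1 n / w n)%:C) <= Q.
  rewrite normcM !normc_real; apply: le_trans (hQ k.+1).
  have h0 := assoc_coef_ge0 hc la k.+1 n.
  rewrite ler_wpM2l // ger0_norm ?divr_ge0 ?(ltW (w0 _)) //.
  rewrite ler_pdivrMr //; apply: le_trans (assoc_coef_le_sum hc la k.+1 n) _.
  by rewrite ler_peMr ?(weight_ge1 hc) // (le_trans h0) // assoc_coef_le_sum.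
apply: (le_trans (ler_normcD _ _)); rewrite normc_opp; apply: lerD b4.
apply: (le_trans (ler_normcD _ _)); rewrite normc_opp -addrA; apply: lerD b1 _.
by rewrite mulrDr; apply: (le_trans (ler_normcD _ _)); exact: lerD.
Qed.

End WeakAmenabilityFails.

Section PollaczekWeak.
Variables (R : realType) (al la nu : R).
Hypothesis hal : - (1 / 2) < al.
Hypothesis hla : 0 <= la.
Hypothesis hnu : 0 <= nu.

Local Notation c := (pollaczek_c al la nu).
Local Notation N n := (n%:R + nu).
Local Notation P := (pollaczek al la nu).
Local Notation w := (weight c).

Let hc : szwarc_coefs c := pollaczek_szwarc hal hla hnu.

Lemma not_weakly_amenable_large : 1 / 2 <= al \/ 0 < la -> ~ weakly_amenable (l1alg P).
Proof.
move=> /(eventually_below hal hla hnu)[n0 hn0].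
have [B hB] := bounded_at_0 hc hnu hn0.
apply: (@not_weakly_amenable_of_bounded _ _ hc (evalP c 0) B) => [n k|].
  rewrite (calc_evalP hc) normcM normc_real -[leRHS]mulr1.
  by apply: ler_pM; rewrite ?normc_ge0 ?hB // (E_bounded hc).
by rewrite E_at0; apply/eqP; exact: oner_neq0.
Qed.

Lemma not_weakly_amenable_small : la = 0 -> al < 1 / 2 -> 0 < nu \/ 0 <= al ->
  ~ weakly_amenable (l1alg P).
Proof.
move=> la0 al_lt hna; have hal' := hal; have nu0 := hnu.
have Np n : 0 <= N n by exact: N_ge0.
have lam n : c n.+1 * (1 - c n) = (N n + 1) * (N n + 1 + 2 * al) /
    ((2 * N n + 2 * al + 3) * (2 * N n + 2 * al + 1)).
  by rewrite c_rec // la0 mulr0 !addr0.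
pose s := 2 * nu + 2 * al + 1.
have s0 : 0 < s by rewrite /s; lra.
have hs n : 1 + (2 * n%:R + s) * (c n.+1 * (1 - c n))
      = (2 * n%:R + s + 4) * (c n.+2 * (1 - c n.+1)).
  rewrite !lam (NS nu n) /s; have := Np n.
  have -> : 2 * n%:R + (2 * nu + 2 * al + 1) = 2 * N n + 2 * al + 1 by ring.
  set m := N n => m0; field.
  by rewrite !gt_eqF //; lra.
have eE : (s + 2) * c 1 - 1 = nu * (nu + 2 * al) / s.
  rewrite c1E // la0 mulr0 !addr0 /s; field.
  by rewrite !gt_eqF //; lra.
have hla' := @lam_decr R al la nu hal hla hnu la0 al_lt.
have [nup|nun] := ltP 0 nu; last first.
  have nu00 : nu = 0 by apply/le_anti; rewrite nun nu0.
  have al0 : 0 <= al by case: hna => //; rewrite nu00 ltxx.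
  apply: (@not_weakly_amenable_criterion _ _ hc s 0 1) => //; first exact: ltW.
    by move=> n; rewrite eE nu00 !mul0r normr0 mul0r.
  move=> n; rewrite mul1r.
  have H : 2 * n%:R + 1 <= w n.
    elim: n => [|n IH]; first by rewrite /weight mulr0 add0r.
    have := weightS hc n; have := c_le_half_gap hal hla hnu n.
    have := c_le_half_gap hal hla hnu n.+1; have cp := szwarc_gt0 hc n.
    have W0 := weight_gt0 hc n.
    have Ne k : N k = k%:R :> R by rewrite nu00 addr0.
    rewrite !Ne -[n.+1%:R]natr1; have : 0 <= n%:R :> R by [].
    move: cp IH W0; set m := n%:R; set W := w n; set W' := w n.+1.
    move=> cp IH W0 m0; rewrite ler_pdivlMr; last by lra.
    move=> h1; rewrite ler_pdivlMr; last by lra.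
    move=> h2 E.
    have g1 : c n.+1 * (2 * m + 3) <= m + 1.
      have g0 : 0 <= c n.+1 * al by rewrite mulr_ge0 // ltW.
      by lra.
    have g2 : m + 1 <= (1 - c n) * (2 * m + 1).
      have g0 : 0 <= c n * al by rewrite mulr_ge0 // (c_ge0 hc).
      by lra.
    rewrite -(ler_pM2l cp) E.
    apply: (@le_trans _ _ (m + 1)); first by lra.
    apply: (le_trans g2); rewrite ler_wpM2l //.
    by have := szwarc_le_half hc n; lra.
  apply: le_trans H; rewrite -natr1 lerD2r ler_peMl //; lra.
(* A positive solution r of the recurrence at the point 1, not constant because
   nu > 0: its ratios come from the second factorization of c n.+1 * (1 - c n),
   with A n and 1 - A n.+1 in place of 1 - c n and c n.+1. *)
pose A n := (N n + 2 * al + 1) / (2 * N n + 2 * al + 1).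
pose r := fix r n := if n is m.+1 then r m * (A m / (1 - c m)) else 1.
have Ap n : 0 < A n by rewrite /A divr_gt0 //; have := Np n; lra.
have rp n : 0 < r n.
  by elim: n => //= n IH; rewrite mulr_gt0 // divr_gt0 // (a_gt0 hc).
have rr n : (1 - c n.+1) * r n.+2 + c n.+1 * r n = r n.+1.
  have a0 := a_neq0 hc n; have a1 := a_neq0 hc n.+1.
  have e1 : (1 - c n.+1) * r n.+2 = r n.+1 * A n.+1.
    rewrite [r n.+2]/= -[r n * _]/(r n.+1) mulrCA; congr (_ * _).
    by rewrite mulrC divfK.
  have e2 : c n.+1 * r n = r n.+1 * (1 - A n.+1).
    rewrite [r n.+1]/= -mulrA mulrC; congr (_ * _).
    apply: (mulIf a0); rewrite lam [RHS]mulrAC divfK //.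
    rewrite /A (NS nu n); have := Np n; set m := N n => m0.
    by field; rewrite !gt_eqF //; lra.
  by rewrite e1 e2; ring.
have r1 : r 1%N < 1.
  rewrite /= mul1r subr0 divr1 /A add0r ltr_pdivrMr; last by lra.
  by rewrite mul1r; lra.
have hS := assoc_sum_bounded hc (erefl : r 0%N = 1) (fun n => ltW (rp n)) r1 rr.
have wl := weight_ge_linear hc hS.
apply: (@not_weakly_amenable_criterion _ _ hc s
  (`|(s + 2) * c 1 - 1| * (1 - r 1%N)^-1) _ (ltW s0) hla' hs _ wl) => n.
by rewrite ler_wpM2l.
Qed.

End PollaczekWeak.

(** * Chebyshev polynomials and weak amenability *)

Section Chebyshev.
Variable R : realType.

Fixpoint chebT (n : nat) : {poly R} :=
  match n with
  | 0 => 1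
  | m.+1 => match m with
    | 0 => 'X
    | k.+1 => 'X * chebT m + 'X * chebT m - chebT k
    end
  end.

Fixpoint chebU (n : nat) : {poly R} :=
  match n with
  | 0 => 1
  | m.+1 => match m with
    | 0 => 'X + 'X
    | k.+1 => 'X * chebU m + 'X * chebU m - chebU k
    end
  end.

Lemma chebTS n : chebT n.+2 = 'X * chebT n.+1 + 'X * chebT n.+1 - chebT n.
Proof. by []. Qed.

Lemma chebUS n : chebU n.+2 = 'X * chebU n.+1 + 'X * chebU n.+1 - chebU n.
Proof. by []. Qed.

Arguments chebT : simpl never.
Arguments chebU : simpl never.

Lemma chebT_U n : chebT n.+2 = 'X * chebU n.+1 - chebU n.
Proof.
elim/nat_ind2: n => [||n h0 h1].
- by rewrite chebTS /chebT /chebU; ring.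
- by rewrite !chebTS chebUS /chebT /chebU; ring.
by rewrite [LHS]chebTS h1 h0 !chebUS; ring.
Qed.

Lemma deriv_chebT n : (chebT n.+1)^`() = n.+1%:R * chebU n.
Proof.
elim/nat_ind2: n => [||n h0 h1].
- by rewrite /chebT /chebU derivX mulr1.
- rewrite chebTS /chebT /chebU.
  by rewrite derivB derivD derivM derivX derivC; ring.
rewrite chebTS derivB derivD derivM derivX h1 h0 chebT_U chebUS.
by rewrite -[n.+3%:R]natr1 -[n.+2%:R]natr1; ring.
Qed.

Lemma chebU_T m n : chebT m * chebU (n + m) + chebT m * chebU (n + m) =
  chebU (n + m + m) + chebU n.
Proof.
elim/nat_ind2: m n => [||m h0 h1] n.
- by rewrite !addn0 /chebT mul1r.
- by rewrite /(chebT 1) !addn1 chebUS; ring.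
have e1 := h1 n.+1; have e0 := h0 n.+2.
have f1 : (n.+1 + m.+1 = n + m.+2)%N by lia.
have f2 : (n + m.+2 + m.+1 = (n + m.+2 + m).+1)%N by lia.
have f3 : (n.+2 + m = n + m.+2)%N by lia.
have f4 : (n + m.+2 + m.+2 = (n + m.+2 + m).+2)%N by lia.
rewrite f1 f2 in e1; rewrite f3 in e0.
rewrite f4 chebTS.
have -> : ('X * chebT m.+1 + 'X * chebT m.+1 - chebT m) * chebU (n + m.+2) +
  ('X * chebT m.+1 + 'X * chebT m.+1 - chebT m) * chebU (n + m.+2) =
  ('X + 'X) * (chebT m.+1 * chebU (n + m.+2) + chebT m.+1 * chebU (n + m.+2))
  - (chebT m * chebU (n + m.+2) + chebT m * chebU (n + m.+2)) by ring.
by rewrite e1 e0 [chebU (n + m.+2 + m).+2]chebUS [chebU n.+2]chebUS; ring.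
Qed.

(** This is [2 T_n U_n = U_(2n) + 1] with [U_k = T_(k+1)' / (k+1)]. *)
Lemma chebyshev_unit n : (1 : {poly R}) =
  (2 / n.+1%:R) *: (chebT n * (chebT n.+1)^`())
  - (2 * n + 1)%:R^-1 *: (chebT (2 * n).+1)^`().
Proof.
have e := chebU_T n 0; rewrite !add0n addnn -mul2n in e.
have h1 : n.+1%:R != 0 :> R by rewrite pnatr_eq0.
have h2 : (2 * n).+1%:R != 0 :> R by rewrite pnatr_eq0.
have nat_scale (k : nat) (p : {poly R}) : k%:R * p = (k%:R : R) *: p.
  by rewrite scaler_nat mulr_natl.
rewrite addn1 !deriv_chebT !nat_scale -scalerAr !scalerA divfK // mulVf // scale1r.
rewrite (_ : (2 : R) *: _ = chebT n * chebU n + chebT n * chebU n); last first.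
  by rewrite scaler_nat mulr2n.
by rewrite e [chebU 0]/(1 : {poly R}) addrAC subrr add0r.
Qed.

End Chebyshev.

Section Elements.
Arguments weight : simpl never.
Variables (R : realType) (c : nat -> R).
Hypothesis hc : szwarc_coefs c.

Local Notation P := (recurrence_poly c).
Local Notation w := (weight c).
Local Notation A := (l1alg P).
Local Notation mul := (@Defs.mul R A).

(** The element of the algebra with Fourier transform [p]. *)
Definition elt (p : {poly R}) : A := calc c p (delta R 0).

Lemma mul_delta1 (f : A) : dom f ->
  mul (delta R 1 : A) f = ((w 1)%:C *: (jacobi c f : A) : A).
Proof.
move=> fd; rewrite (mul_comm hc (dom_delta hc 1).1 fd); apply: funext => n.
by rewrite (mulE hc) pair_delta (trans_sym hc) trans1 mulrC.
Qed.

Lemma jacobi_mul (f : A) : dom f ->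
  (jacobi c f : A) = ((w 1)^-1%:C *: mul (delta R 1 : A) f : A).
Proof.
move=> fd; rewrite mul_delta1 // scalerA -rmorphM /= mulVf ?scale1r //.
exact: (weight_neq0 hc).
Qed.

Lemma elt_mulX p : elt ('X * p) = jacobi c (elt p).
Proof. by rewrite /elt jacobi_calc; apply: funext => n; rewrite calc_mulX. Qed.

Lemma elt_lin p (a : R) : elt ('X * p + a%:P) =
  (a%:C *: (delta R 0 : A) + (jacobi c (elt p) : A) : A).
Proof.
apply: funext => n; rewrite linE -elt_mulX /elt calcD calcC addrC.
by [].
Qed.

Lemma jacobi_dom (f : A) : dom f -> dom (jacobi c f : A).
Proof.
move=> fd; rewrite jacobi_mul //; apply: (dom_scale hc).
exact: (mul_dom hc (dom_delta hc 1).1 fd).1.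
Qed.

Lemma elt_dom p : dom (elt p).
Proof.
elim/poly_ind: p => [|p a IH].
  rewrite (_ : elt 0 = 0); first exact: dom0.
  by apply: funext => n; exact: calc0.
rewrite mulrC elt_lin.
exact: (dom_lin hc _ (dom_delta hc 0).1 (jacobi_dom IH)).1.
Qed.

Lemma jacobi_bounded u (B : R) : seq_bounded u B -> seq_bounded (jacobi c u) B.
Proof. by move=> uB; rewrite -trans1; exact: trans_bounded. Qed.

Lemma pair_jacobi (f : A) u (B : R) : dom f -> seq_bounded u B ->
  pair (jacobi c f : A) u = pair f (jacobi c u).
Proof.
move=> fd uB; have d1 := (dom_delta hc 1).1.
have bu := pair_functional hc uB.
have z0 : dom (0 : A) by exact: dom0.
have := bu.1 (w 1)^-1%:C (mul (delta R 1 : A) f) 0 (mul_dom hc d1 fd).1 z0.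
rewrite addr0 -jacobi_mul // (functional0 hc bu.1) addr0 => ->.
rewrite (mul_comm hc d1 fd) (pair_mul hc fd d1 uB).
rewrite (act_delta hc) trans1 (pair_scale hc _ fd (jacobi_bounded uB)) mulrA -rmorphM /= mulVf ?mul1r //.
exact: (weight_neq0 hc).
Qed.

Lemma act_elt p u (B : R) : seq_bounded u B -> act (elt p) u = calc c p u.
Proof.
elim/poly_ind: p u => [|p a IH] u uB; apply: funext => n.
  rewrite calc0 /act /pair (@csum_finite _ _ 0) ?big_ord0 // => k _.
  by rewrite [elt 0 k]calc0 !mul0r.
rewrite [p * 'X]mulrC elt_lin /act.
have tB := trans_bounded hc n uB.
rewrite (pair_linl hc a%:C (dom_delta hc 0).1 (jacobi_dom (elt_dom p)) tB).
rewrite pair_delta /weight mulr1 (pair_jacobi (elt_dom p) tB).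
rewrite -/(trans c n u) -[jacobi c (trans c n u)]/(jacobi c (calc c (P n) u)) jacobi_calc.
rewrite -/(trans c n (jacobi c u)) -/(act (elt p) (jacobi c u) n).
rewrite (IH _ (jacobi_bounded uB)) (trans_at0 hc).
by rewrite calcD calcC calc_mulX addrC.
Qed.

Lemma calc_bounded p u : (exists B : R, seq_bounded u B) ->
  exists B : R, seq_bounded (calc c p u) B.
Proof.
move=> [B uB]; exists (nrm (elt p) * B); rewrite -(act_elt p uB).
exact: (act_bounded hc (elt_dom p) uB).
Qed.

(** Induction on [p]: [delta 1] is a multiple of [elt 'X], and the derivation rule
turns into the product rule. *)
Lemma derivation_elt (D : A -> A -> R[i]) u (B : R) : seq_bounded u B ->
  @bounded_dual_derivation R A A mul mul D ->
  (forall g, dom g -> D (delta R 0) g = 0) ->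
  (forall g, dom g -> D (delta R 1) g = (w 1)%:C * pair g u) ->
  forall p g, dom g -> D (elt p) g = pair g (calc c p^`() u).
Proof.
move=> uB [D1 D2 D3 D4] D0 Du; have d0 := (dom_delta hc 0).1; have d1 := (dom_delta hc 1).1.
have pb p : exists B' : R, seq_bounded (calc c p u) B'.
  by apply: calc_bounded; exists B.
elim/poly_ind => [|p a IH] g gd.
  have -> : elt 0 = (- 1 : R[i]) *: (delta R 0 : A) + (delta R 0 : A).
    by rewrite scaleN1r addNr; apply: funext => n; exact: calc0.
  rewrite D2 // !D0 // mulr0 addr0 deriv0 /pair (@csum_finite _ _ 0) ?big_ord0 // => k _.
  by rewrite calc0 mulr0 mul0r.
rewrite [p * 'X]mulrC elt_lin D2 ?D0 ?mulr0 ?add0r //; last exact: jacobi_dom (elt_dom p).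
have ed := elt_dom p; have md := (mul_dom hc d1 ed).1.
have -> : D (jacobi c (elt p)) g = (w 1)^-1%:C * D (mul (delta R 1 : A) (elt p)) g.
  have := D2 (w 1)^-1%:C (mul (delta R 1 : A) (elt p)) (0 *: (delta R 0 : A)) g md
    (dom_scale hc 0 d0) gd.
  rewrite scale0r addr0 -jacobi_mul // => ->.
  have -> : D 0 g = 0; last by rewrite addr0.
  have := D2 (- 1) (delta R 0) (delta R 0) g d0 d0 gd.
  by rewrite scaleN1r addNr !D0 // mulr0 addr0.
rewrite D3 // IH; last exact: (mul_dom hc gd d1).1.
rewrite Du; last exact: (mul_dom hc ed gd).1.
rewrite (mul_comm hc ed gd) (pair_mul hc gd ed uB) (act_elt p uB).
have [B' vB] := pb p^`(); have [B'' pB] := pb p.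
rewrite (pair_mul hc gd d1 vB) (act_delta hc) trans1.
rewrite derivD derivM derivX derivC mul1r addr0.
have jB := jacobi_bounded vB.
rewrite (pair_scale hc _ gd jB) -mulrDr mulrA -rmorphM /= mulVf ?(weight_neq0 hc) // mul1r.
have := pair_linr hc 1 gd pB jB; rewrite mul1r addrC => <-.
congr (pair g); apply: funext => n.
by rewrite mul1r calcD calc_mulX jacobi_calc.
Qed.

Lemma fourier_elt_at1 p : fourier P (elt p) 1 = (p.[1])%:C.
Proof.
have eB : seq_bounded (evalP c 1) 1.
  by move=> n; rewrite /evalP (P_at1 hc) normc1.
have := congr1 (fun v => v 0%N) (act_elt p eB).
rewrite (calc_evalP hc) (act_evalP hc (elt_dom p) eB).
by rewrite (_ : evalP c 1 0 = 1) ?mulr1 // /evalP (P_at1 hc).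
Qed.

(** For polynomials [p] and [q] the derivation bounds [(q p')(J) u] by a multiple of
[||q|| ||p||].  Writing 1 as a small combination of such products shows that
[u] is 0. *)
Lemma weakly_amenable_criterion :
  (forall e : R, 0 < e -> exists n : nat,
    2 / n.+1%:R * (nrm (elt (chebT R n)) * nrm (elt (chebT R n.+1)))
    + (2 * n + 1)%:R^-1 * nrm (elt (chebT R (2 * n).+1)) < e) ->
  weakly_amenable A.
Proof.
move=> small; apply: (weakly_amenable_of_vanish hc) => u D DD [B uB] Du k.
have [_ _ _ [M hM]] := DD.
have d0 := (dom_delta hc 0).1; have dk := (dom_delta hc k).1.
have Dp : forall p g, dom g -> D (elt p) g = pair g (calc c p^`() u).
  apply: (derivation_elt uB DD) => g gd; rewrite Du //.
    rewrite /= derivC /pair (@csum_finite _ _ 0) ?big_ord0 ?mulr0 // => j _.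
    by rewrite calc0 mulr0 mul0r.
  by rewrite /= derivX calc1.
have pb p : exists B' : R, seq_bounded (calc c p u) B'.
  by apply: calc_bounded; exists B.
have key p q : (w k)%:C * calc c (q * p^`()) u k = D (elt p) (mul (elt q) (delta R k : A)).
  have eqd := elt_dom q; rewrite Dp; last exact: (mul_dom hc eqd dk).1.
  have [B' vB] := pb p^`().
  rewrite (mul_comm hc eqd dk) (pair_mul hc dk eqd vB) (act_elt q vB).
  by rewrite pair_delta mulrC calcM.
have M0 : 0 < `|M| + 1 by rewrite ltr_wpDl.
have wk := weight_gt0 hc k.
have est p q : normc (calc c (q * p^`()) u k) <= (`|M| + 1) * (nrm (elt q) * nrm (elt p)).
  rewrite -(ler_pM2l wk).
  have -> : w k * normc (calc c (q * p^`()) u k) =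
      normc ((w k)%:C * calc c (q * p^`()) u k).
    by rewrite normcM normc_real (ger0_norm (ltW wk)).
  rewrite key.
  have eqd := elt_dom q; have epd := elt_dom p; have [md mn] := mul_dom hc eqd dk.
  apply: (le_trans (hM _ _ epd md)).
  have np := nrm_ge0 hc epd; have nq := nrm_ge0 hc eqd; have nm := nrm_ge0 hc md.
  have nd := (dom_delta hc k).2; have nd0 := nrm_ge0 hc dk.
  apply: (@le_trans _ _ ((`|M| + 1) * nrm (elt p) * nrm (mul (elt q) (delta R k : A) : A))).
    rewrite ler_wpM2r // ler_wpM2r //.
    by rewrite (le_trans (ler_norm M)) // lerDl.
  have -> : w k * ((`|M| + 1) * (nrm (elt q) * nrm (elt p))) =
     (`|M| + 1) * nrm (elt p) * (nrm (elt q) * w k) by ring.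
  rewrite ler_wpM2l ?mulr_ge0 ?(ltW M0) //; apply: (le_trans mn).
  by rewrite ler_wpM2l.
apply: eq_of_normc_lt => e e0; rewrite subr0.
have [n hn] := small _ (divr_gt0 e0 M0).
have -> : u k = calc c 1 u k by rewrite calc1.
rewrite (chebyshev_unit R n) calcB !calcZ.
apply: (le_lt_trans (ler_normcD _ _)); rewrite normc_opp !normcM !normc_real.
rewrite ger0_norm ?divr_ge0 // ger0_norm ?invr_ge0 //.
have n1 : nrm (elt 1) <= 1.
  have -> : elt 1 = delta R 0 by rewrite /elt calc1.
  exact: (dom_delta hc 0).2.
have e1 := est (chebT R n.+1) (chebT R n); have e2 := est (chebT R (2 * n).+1) 1.
rewrite mul1r in e2.
have e3 : nrm (elt 1) * nrm (elt (chebT R (2 * n).+1)) <= nrm (elt (chebT R (2 * n).+1)).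
  by rewrite ler_piMl ?(nrm_ge0 hc) //; exact: elt_dom.
rewrite ltr_pdivlMr // in hn; apply: le_lt_trans hn.
rewrite [leRHS]mulrDl; apply: lerD.
  by rewrite -[leRHS]mulrA ler_wpM2l ?divr_ge0 // [leRHS]mulrC.
rewrite -[leRHS]mulrA ler_wpM2l ?invr_ge0 // (le_trans e2) // [leRHS]mulrC.
by rewrite ler_wpM2l // ltW.
Qed.

End Elements.

(** * The ultraspherical case *)

Section Ultraspherical.
Arguments weight : simpl never.
Arguments chebT : simpl never.
Arguments elt : simpl never.
Variables (R : realType) (al : R).
Hypothesis hal : - (1 / 2) < al.
Hypothesis al0 : al < 0.

Local Notation c := (pollaczek_c al 0 0).
Local Notation P := (pollaczek al 0 0).
Local Notation w := (weight c).
Local Notation A := (l1alg P).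

Let hc : szwarc_coefs c := pollaczek_szwarc hal (lexx 0) (lexx 0).
Let l : R := al + 1 / 2.

Lemma l_gt0 : 0 < l. Proof. by rewrite /l; have := hal; lra. Qed.
Lemma l_lt : l < 1 / 2. Proof. by rewrite /l; have := al0; lra. Qed.

Lemma ultra_c n : c n = n%:R / (2 * (n%:R + l)).
Proof.
have l0 := l_gt0; elim: n => [|n IH]; first by rewrite mul0r.
have m0 : 0 <= n%:R :> R by [].
have e := c_rec hal (lexx 0) (lexx 0) n; move: e; rewrite mulr0 !addr0 IH -natr1.
move: m0; set m := n%:R => m0 e.
have a0 : 1 - m / (2 * (m + l)) = (m + 2 * l) / (2 * (m + l)).
  by field; rewrite gt_eqF //; lra.
have a1 : (m + 2 * l) / (2 * (m + l)) != 0.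
  by rewrite gt_eqF // divr_gt0 //; lra.
rewrite a0 in e; apply: (mulIf a1); rewrite e.
have -> : al = l - 1 / 2 by rewrite /l; ring.
by field; rewrite !gt_eqF //; lra.
Qed.

Lemma ultra_a n : 1 - c n = (n%:R + 2 * l) / (2 * (n%:R + l)).
Proof.
have l0 := l_gt0; have m0 : 0 <= n%:R :> R by [].
by rewrite ultra_c; field; rewrite gt_eqF //; lra.
Qed.

(** The Pochhammer quotients [(-l)_k / k!], and [j! / (l + 1)_j] below. *)
Fixpoint ratio_f (k : nat) : R :=
  if k is i.+1 then ratio_f i * ((i%:R - l) / i.+1%:R) else 1.

Fixpoint ratio_g (j : nat) : R :=
  if j is i.+1 then ratio_g i * (i.+1%:R / (l + i.+1%:R)) else 1.

(** The coefficient of [w_(j-k) P_(j-k)] in [T_(j+k)], a connection coefficient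
between two families of Gegenbauer polynomials, with parameters 0 and [l]. *)
Definition cheb_coef (j k : nat) : R :=
  if j is 0 then 1 else (j + k)%:R / (2 * j%:R) * ratio_f k * ratio_g j.

(** The coefficients of [T_n] in the basis [w_m P_m], by the recurrence of the
[T_n]. *)
Fixpoint cheb_seq (n : nat) : nat -> R :=
  match n with
  | 0 => fun m => (m == 0%N)%:R
  | i.+1 => match i with
    | 0 => fun m => c m * (m.-1 == 0%N)%:R
    | k.+1 => fun m => 2 * ((1 - c m) * cheb_seq i m.+1 + c m * cheb_seq i m.-1)
                       - cheb_seq k m
    end
  end.

Lemma cheb_seqS n m : cheb_seq n.+2 m =
  2 * ((1 - c m) * cheb_seq n.+1 m.+1 + c m * cheb_seq n.+1 m.-1) - cheb_seq n m.
Proof. by []. Qed.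

Arguments cheb_seq : simpl never.

Lemma elt_chebT n m : (elt c (chebT R n) m : R[i]) = (cheb_seq n m)%:C.
Proof.
elim/nat_ind2: n m => [||n h0 h1] m.
- by rewrite /elt /chebT calc1 /delta /cheb_seq; case: eqP.
- rewrite /elt /chebT -['X]mulr1 calc_mulX calc1 /jacobi /delta /cheb_seq mulr0 add0r.
  by rewrite rmorphM /=; congr (_ * _); case: eqP.
rewrite chebTS /elt calcB !calcD !calc_mulX -!jacobi_calc cheb_seqS.
have -> : calc c (chebT R n) (delta R 0) m = (cheb_seq n m)%:C by exact: h0.
have h1' k : calc c (chebT R n.+1) (delta R 0) k = (cheb_seq n.+1 k)%:C by exact: h1.
rewrite /jacobi !h1'.
by ring.
Qed.

(** The recurrence of [cheb_seq] in closed form away from the boundary; the next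
two lemmas are the boundary cases [m = 0] and [m = n]. *)
Lemma cheb_coef_rec j k m : (0 < k)%N -> (0 < m)%N -> j = (m + k)%N ->
  cheb_coef j k = 2 * ((1 - c m) * cheb_coef j k.-1 + c m * cheb_coef j.-1 k)
  - cheb_coef j.-1 k.-1.
Proof.
have l0 := l_gt0; case: k m j => [|k] [|m] // j _ _ ->.
have -> : (m.+1 + k.+1 = (m + k).+2)%N by lia.
rewrite ultra_a ultra_c /cheb_coef /=.
have x0 : 0 <= m%:R :> R by []; have y0 : 0 <= k%:R :> R by [].
rewrite !(addSn, addnS) -!natr1 !natrD.
set f := ratio_f k; set g := ratio_g (m + k).
move: x0 y0; set x := m%:R; set y := k%:R => x0 y0.
by field; rewrite !gt_eqF //; lra.
Qed.

Lemma cheb_coef_diag k : cheb_coef k.+1 k.+1 = 2 * cheb_coef k.+1 k - cheb_coef k k.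
Proof.
have l0 := l_gt0; case: k => [|k].
  by rewrite /cheb_coef /=; field; rewrite gt_eqF //; lra.
rewrite /cheb_coef /=.
have y0 : 0 <= k%:R :> R by [].
rewrite !(addSn, addnS) -!natr1 !natrD.
set f := ratio_f k; set g := ratio_g k.
move: y0; set y := k%:R => y0.
by field; rewrite !gt_eqF //; lra.
Qed.

Lemma cheb_coef_top j : cheb_coef j.+2 0 = 2 * (c j.+2 * cheb_coef j.+1 0).
Proof.
have l0 := l_gt0; rewrite /cheb_coef ultra_c !addn0 /=.
have y0 : 0 <= j%:R :> R by [].
rewrite -!natr1.
set g := ratio_g j; move: y0; set y := j%:R => y0.
by field; rewrite !gt_eqF //; lra.
Qed.

Lemma cheb_seq_closed n :
  (forall j k, (j + k = n)%N -> (k <= j)%N -> cheb_seq n (j - k) = cheb_coef j k) /\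
  (forall m, (n < m)%N || odd (n + m) -> cheb_seq n m = 0).
Proof.
have l0 := l_gt0.
elim/nat_ind2: n => [||n [a0 b0] [a1 b1]].
- split=> [[|j] [|k] //|[|m]] //.
- split=> [j k jk kj|m].
    have [-> ->] : j = 1%N /\ k = 0%N by lia.
    have -> : cheb_seq 1 (1 - 0) = c 1 * 1 by [].
    rewrite ultra_c /cheb_coef /=; field.
    by rewrite !gt_eqF //; lra.
  by case: m => [|[|m]] // _; rewrite /cheb_seq ?mul0r ?mulr0.
split=> [j k jk kj|m h].
  rewrite cheb_seqS; case: k jk kj => [|k] jk kj.
    have -> : j = n.+2 by lia.
    have z0 : cheb_seq n n.+2 = 0 by apply: b0; lia.
    have z1 : cheb_seq n.+1 n.+3 = 0 by apply: b1; lia.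
    have -> : (n.+2 - 0 = n.+2)%N by [].
    rewrite z0 z1 mulr0 add0r subr0 cheb_coef_top.
    by rewrite -(a1 n.+1 0%N (addn0 _) (leq0n _)).
  have [e|ne] := eqVneq j k.+1.
    have nk : n = (k + k)%N by lia.
    rewrite e subnn (szwarc0 hc) mul0r addr0 subr0 mul1r cheb_coef_diag.
    rewrite -(a1 k.+1 k); [|lia|exact: leqnSn]; rewrite -(a0 k k (esym nk) (leqnn _)).
    by rewrite subnn subSnn.
  have kj' : (k.+1 < j)%N by rewrite ltn_neqAle eq_sym ne.
  rewrite (@cheb_coef_rec j k.+1 (j - k.+1)) //; [|lia|lia].
  rewrite [k.+1.-1]/= -(a1 j k); [|lia|lia].
  rewrite -(a1 j.-1 k.+1); [|lia|lia]; rewrite -(a0 j.-1 k); [|lia|lia].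
  have -> : (j.-1 - k = j - k.+1)%N by lia.
  have -> : ((j - k.+1).+1 = j - k)%N by lia.
  by have -> : ((j - k.+1).-1 = j.-1 - k.+1)%N by lia.
rewrite cheb_seqS (b0 m) ?(b1 m.+1); [|lia|lia].
case: m h => [|m] h; first by rewrite (szwarc0 hc) mul0r mulr0 addr0 mulr0 subr0.
by rewrite [m.+1.-1]/= b1 ?mulr0 ?addr0 ?mulr0 ?subr0 //; lia.
Qed.

Lemma ratio_f_le0 k : ratio_f k.+1 <= 0.
Proof.
have l0 := l_gt0; have l1 := l_lt; elim: k => [|k IH] /=.
  by rewrite mul1r sub0r mulNr oppr_le0 divr_ge0 // ltW.
rewrite -/(ratio_f k.+1) mulr_le0_ge0 // divr_ge0 // subr_ge0.
have : 1 <= k.+1%:R :> R by rewrite ler1n.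
by move: l1; set m := k.+1%:R; lra.
Qed.

Lemma ratio_g_gt0 j : 0 < ratio_g j.
Proof.
have l0 := l_gt0; elim: j => //= j IH.
by rewrite mulr_gt0 // divr_gt0 // addr_gt0.
Qed.

Lemma cheb_seq_le0 n m : (m < n)%N -> cheb_seq n m <= 0.
Proof.
move=> mn; have [a b] := cheb_seq_closed n.
have [od|ev] := boolP (odd (n + m)); first by rewrite b // od orbT.
have [k nk] : exists k, n = (m + k.+1 + k.+1)%N.
  by exists ((n - m)./2).-1; lia.
have := a (m + k.+1)%N k.+1 (esym nk) (leq_addl _ _); rewrite addnK => ->.
rewrite addnS /cheb_coef mulr_le0_ge0 ?(ltW (ratio_g_gt0 _)) //.
by rewrite mulr_ge0_le0 ?ratio_f_le0 // divr_ge0 // mulr_ge0.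
Qed.

Lemma cheb_seq_diag n : cheb_seq n.+1 n.+1 = ratio_g n.+1 / 2.
Proof.
have [a _] := cheb_seq_closed n.+1.
have := a n.+1 0%N (addn0 _) isT; rewrite subn0 => ->.
rewrite /cheb_coef addn0 /ratio_f mulr1; set g := ratio_g _.
have : n.+1%:R != 0 :> R by rewrite pnatr_eq0.
by set m := n.+1%:R => m0; field.
Qed.

Lemma chebT_at1 n : (chebT R n).[1] = 1.
Proof.
elim/nat_ind2: n => [||n h0 h1]; [by rewrite hornerE|by rewrite hornerX|].
by rewrite chebTS !hornerE h0 h1; ring.
Qed.

(** Twice the leading term in the norm of [T_n], if [n] is positive. *)
Definition cheb_norm n : R := ratio_g n * w n.

(** Since [T_n(1) = 1], the terms of the expansion sum to 1; all but the leading
one are nonpositive, so the sum of their moduli is at most twice the leading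
one. *)
Lemma elt_chebT_norm n : nrm (elt c (chebT R n.+1)) <= cheb_norm n.+1.
Proof.
have supp k : (n.+2 <= k)%N -> elt c (chebT R n.+1) k = 0.
  move=> nk; have := elt_chebT n.+1 k; have [_ b] := cheb_seq_closed n.+1.
  by rewrite b ?nk.
have [_ h] := dom_finite hc supp; apply: (le_trans h).
have one : \sum_(k < n.+2) cheb_seq n.+1 k * w k = 1.
  have := fourier_elt_at1 hc (chebT R n.+1); rewrite chebT_at1 (fourierE hc).
  rewrite /pair (@csum_finite _ _ n.+2); last by move=> k /supp ->; rewrite !mul0r.
  move=> e; apply: complexI; rewrite -e rmorph_sum; apply: eq_bigr => k _.
  by rewrite elt_chebT /evalP (P_at1 hc) mulr1 rmorphM.
rewrite big_ord_recr /= in one; rewrite big_ord_recr /=.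
rewrite !elt_chebT !normc_real.
have -> : \sum_(k < n.+1) normc (elt c (chebT R n.+1) k) * w k =
   - \sum_(k < n.+1) cheb_seq n.+1 k * w k.
  rewrite -sumrN; apply: eq_bigr => k _; rewrite elt_chebT normc_real.
  by rewrite ler0_norm ?cheb_seq_le0 // mulNr.
have gp := ratio_g_gt0 n.+1; have wp := weight_gt0 hc n.+1.
have dE := cheb_seq_diag n; rewrite ger0_norm; last by rewrite dE divr_ge0 // ltW.
rewrite /cheb_norm; move: one; rewrite dE.
by set S := \sum_(_ < _) _; lra.
Qed.

Lemma cheb_normS n :
  cheb_norm n.+2 = cheb_norm n.+1 * ((n.+1%:R + 2 * l) / (n.+1%:R + l)).
Proof.
have l0 := l_gt0; have e := weightS hc n.+1; have cp := c_neq0 hc n.+1.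
have w2 : w n.+2 = (1 - c n.+1) / c n.+2 * w n.+1.
  apply: (mulfI cp); rewrite e; move: cp.
  by set x := c n.+2; set y := 1 - _; set z := w n.+1 => x0; field.
rewrite /cheb_norm w2 ultra_a ultra_c [ratio_g n.+2]/= -/(ratio_g n.+1).
set g := ratio_g n.+1; set W := w n.+1; rewrite -[n.+2%:R]natr1.
have : 0 < n.+1%:R :> R by rewrite ltr0n.
set m := n.+1%:R => m0.
by field; rewrite !gt_eqF //; lra.
Qed.

(** [cheb_norm n] grows like [n^l] with [l < 1/2]. *)
Lemma cheb_norm_small (e : R) : 0 < e ->
  exists n0, forall n, (n0 <= n)%N -> cheb_norm n.+1 ^+ 2 < e * n.+1%:R.
Proof.
move=> e0; have l0 := l_gt0; have l1 := l_lt.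
pose x n := cheb_norm n.+1 ^+ 2 / n.+1%:R.
have x0 n : 0 <= x n by rewrite divr_ge0 // sqr_ge0.
have k0 : 0 < 1 - 2 * l by lra.
have xS n : x n.+1 <= x n * (1 - (1 - 2 * l) / (n%:R + 2)).
  rewrite /x cheb_normS -[n.+2%:R]natr1 -[n.+1%:R]natr1.
  have : 0 <= n%:R :> R by []; set m := n%:R; set b := cheb_norm _ => m0.
  have m1 : 0 < m + 1 by lra.
  have -> : (b * ((m + 1 + 2 * l) / (m + 1 + l))) ^+ 2 / (m + 1 + 1) =
     b ^+ 2 / (m + 1) * (((m + 1 + 2 * l) ^+ 2 * (m + 1)) / ((m + 1 + l) ^+ 2 * (m + 2))).
    by field; rewrite !gt_eqF //; lra.
  rewrite ler_wpM2l ?divr_ge0 ?sqr_ge0 ?(ltW m1) //.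
  have -> : 1 - (1 - 2 * l) / (m + 2) = (m + 1 + 2 * l) / (m + 2).
    by field; rewrite gt_eqF //; lra.
  have d1 : 0 < m + 2 by lra.
  have d2 : 0 < (m + 1 + l) ^+ 2 by rewrite exprn_gt0 //; lra.
  have d3 : 0 < m + 1 + 2 * l by lra.
  rewrite ler_pdivrMr; last exact: mulr_gt0.
  have -> : (m + 1 + 2 * l) / (m + 2) * ((m + 1 + l) ^+ 2 * (m + 2)) =
    (m + 1 + 2 * l) * (m + 1 + l) ^+ 2 by field; rewrite gt_eqF.
  rewrite expr2 -mulrA ler_wpM2l ?(ltW d3) //.
  by have := sqr_ge0 l; rewrite !expr2; lra.
have [n0 h] := decay_to_0 k0 (ltr0n R 2) x0 xS e0.
by exists n0 => n /h; rewrite /x ltr_pdivrMr.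
Qed.

Lemma weakly_amenable_ultraspherical : weakly_amenable A.
Proof.
apply: (weakly_amenable_criterion hc) => e e0.
have e4 : 0 < e / 8 by rewrite divr_gt0.
have [n0 h] := cheb_norm_small e4.
have [K hK] : exists K : nat, 2 / e < K%:R.
  by exists (Num.trunc (2 / e)).+1; exact: truncnS_gt.
have [n nE] : exists n, n = (n0 + K).+1 by eexists.
have [n0n n02 Kn] : [/\ n0 <= n, n0 <= 2 * n & K <= 2 * n + 1]%N.
  by split; clear -nE; lia.
exists n.
set N0 := nrm (elt c (chebT R n)); set N1 := nrm (elt c (chebT R n.+1)).
set N2 := nrm (elt c (chebT R (2 * n).+1)).
have b0 := elt_chebT_norm (n0 + K); have b1 := elt_chebT_norm n.
have b2 := elt_chebT_norm (2 * n).
rewrite -nE -/N0 in b0; rewrite -/N1 in b1; rewrite -/N2 in b2.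
have p0 : 0 <= N0 by exact: (nrm_ge0 hc (elt_dom hc _)).
have p1 : 0 <= N1 by exact: (nrm_ge0 hc (elt_dom hc _)).
have p2 : 0 <= N2 by exact: (nrm_ge0 hc (elt_dom hc _)).
have s0 := h (n0 + K)%N (leq_addr _ _); rewrite -nE in s0.
have s1 : cheb_norm n.+1 ^+ 2 < e / 8 * n.+1%:R by exact: h.
have s2 : cheb_norm (2 * n).+1 ^+ 2 < e / 8 * (2 * n).+1%:R.
  by exact: h.
have sq0 : N0 ^+ 2 <= cheb_norm n ^+ 2 by rewrite ler_sqr ?nnegrE // (le_trans p0).
have sq1 : N1 ^+ 2 <= cheb_norm n.+1 ^+ 2 by rewrite ler_sqr ?nnegrE // (le_trans p1).
have sq2 : N2 ^+ 2 <= cheb_norm (2 * n).+1 ^+ 2 by rewrite ler_sqr ?nnegrE // (le_trans p2).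
have nn : n%:R <= n.+1%:R :> R by rewrite ler_nat.
have n1p : 0 < n.+1%:R :> R by rewrite ltr0n.
have n2p : 0 < (2 * n + 1)%:R :> R by rewrite addn1 ltr0n.
have nK : 2 / e < (2 * n + 1)%:R.
  by apply: (lt_le_trans hK); rewrite ler_nat.
have t1 : 2 / n.+1%:R * (N0 * N1) <= e / 4.
  rewrite mulrAC ler_pdivrMr //.
  have : 2 * (N0 * N1) <= N0 ^+ 2 + N1 ^+ 2.
    by have := sqr_ge0 (N0 - N1); rewrite sqrrB; lra.
  have : e / 8 * n%:R <= e / 8 * n.+1%:R by rewrite ler_wpM2l // ltW.
  by lra.
have t2 : (2 * n + 1)%:R^-1 * N2 <= e / 2.
  rewrite mulrC ler_pdivrMr //.
  have := sqr_ge0 (N2 - 1); rewrite sqrrB expr1n mulr1.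
  have : 2 < (2 * n + 1)%:R * e by rewrite -ltr_pdivrMr.
  move: s2 sq2; rewrite -[(2 * n).+1]addn1.
  by set m := (2 * n + 1)%:R; lra.
apply: (le_lt_trans (lerD t1 t2)).
have -> : e / 4 + e / 2 = e * (3 / 4) by field.
by rewrite -[ltRHS]mulr1 ltr_pM2l //; lra.
Qed.

End Ultraspherical.

(** * The amenability properties *)

Theorem theorem5p1 (R : realType) (alpha lambda nu : R)
    (halpha : - (1 / 2) < alpha) (hlambda : 0 <= lambda) (hnu : 0 <= nu) :
  [/\ point_amenable (pollaczek alpha lambda nu) <->
        (alpha < 1 / 2 /\ lambda = 0),
      weakly_amenable (l1alg (pollaczek alpha lambda nu)) <->
        [/\ alpha < 0, lambda = 0 & nu = 0],
      ~ right_character_amenable (l1alg (pollaczek alpha lambda nu))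
    & ~ amenable (l1alg (pollaczek alpha lambda nu))].
Proof.
have [not_rca not_am] := not_right_character_amenable_of_lim
  (pollaczek_szwarc halpha hlambda hnu) (P_even_at0_to0 halpha hlambda hnu).
split=> //; split.
- move=> pa.
  have [big|small] := leP (1 / 2) alpha.
    by case: (not_point_amenable_pollaczek halpha hlambda hnu (or_introl big)).
  split=> //; apply/eqP; rewrite eq_le hlambda andbT leNgt; apply/negP => pos.
  by case: (not_point_amenable_pollaczek halpha hlambda hnu (or_intror pos)).
- by case=> small lambda0; apply: point_amenable_pollaczek.
- move=> wa.
  have lambda0 : lambda = 0.
    apply/eqP; rewrite eq_le hlambda andbT leNgt; apply/negP => pos.
    by case: (not_weakly_amenable_large halpha hlambda hnu (or_intror pos)).
  have small : alpha < 1 / 2.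
    rewrite ltNge; apply/negP => big.
    by case: (not_weakly_amenable_large halpha hlambda hnu (or_introl big)).
  split=> //.
    rewrite ltNge; apply/negP => al0.
    by case: (not_weakly_amenable_small halpha hlambda hnu lambda0 small (or_intror al0)).
  apply/eqP; rewrite eq_le hnu andbT leNgt; apply/negP => pos.
  by case: (not_weakly_amenable_small halpha hlambda hnu lambda0 small (or_introl pos)).
- by case=> al0 -> ->; apply: weakly_amenable_ultraspherical.
Qed.
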